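(* Let $n\ge1$ and let $\nu$ be a Borel probability measure on $\mathbb P^n(\mathbb R)$. (1) $\nu$ is stable if and only if for every linear subspace $L\subset\mathbb R^{n+1}$ with $0<\dim L<n+1$, $$\nu(\mathbb P(L))<\frac{\dim L}{n+1}.$$ (2) $\nu$ is semi-stable if and only if for every such $L$, $$\nu(\mathbb P(L))\le\frac{\dim L}{n+1}.$$ (3) $\nu$ is polystable if and only if there exists a splitting $\mathbb R^{n+1}=L_1\oplus\dots\oplus L_r$ such that $\nu$ is supported on $\mathbb P(L_1)\cup\dots\cup\mathbb P(L_r)$. Moreover, $$\nu=\sum_{j=1}^r\frac{\dim L_j}{n+1}\,\delta_{\mathbb P(L_j)},$$ where $\delta_{\mathbb P(L_j)}$ is a stable measure of $\mathbb P(L_j)$ with respect to $\mathrm{SL}(L_j)$.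
   Context: For a finite-dimensional Euclidean vector space $V$ of dimension $m$, $\mathrm{SL}(V)$ acts on the real projective space $\mathbb P(V)$, with maximal compact subgroup $\mathrm{SO}(V)$ (Lie algebra $\mathfrak{so}(V)$) and $\mathfrak p=\mathrm{sym}_0(V)$ the traceless symmetric endomorphisms. The gradient map is $\mu_{\mathfrak p}([x])=\frac12\left[\frac{xx^T}{|x|^2}-\frac1m\mathrm{Id}\right]$. Let $\mathscr P(\mathbb P(V))$ be the space of Borel probability measures on $\mathbb P(V)$ with the weak topology (weak-$*$ as a subset of the dual of $C(\mathbb P(V))$), with the push-forward action of $\mathrm{SL}(V)$, and let $\mathfrak F_V(\nu)=\int_{\mathbb P(V)}\mu_{\mathfrak p}\,d\nu$. With respect to $\mathrm{SL}(V)$: $\nu$ is polystable if $\mathrm{SL}(V)\nu\cap\mathfrak F_V^{-1}(0)\neq\emptyset$; stable if it is polystable and the Lie algebra of its stabilizer is conjugate to a subalgebra of $\mathfrak{so}(V)$; semi-stable if $\overline{\mathrm{SL}(V)\nu}\cap\mathfrak F_V^{-1}(0)\ne\emptyset$. In the claim, stable/semi-stable/polystable without further specification refer to $V=\mathbb R^{n+1}$ with the standard inner product, and each subspace $L_j$ carries the restricted inner product. The symbol $\delta_{\mathbb P(L_j)}$ denotes some probability measure on $\mathbb P(L_j)$ (not a specific one). *)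

(* Defs.v *)
From HB Require Import structures.
From mathcomp Require Import all_boot all_order all_algebra.
From mathcomp Require Import all_classical all_reals all_analysis.

Set Implicit Arguments.
Unset Strict Implicit.
Unset Printing Implicit Defensive.

Import Order.TTheory GRing.Theory Num.Theory.
Import numFieldNormedType.Exports.

Local Open Scope classical_set_scope.
Local Open Scope ring_scope.

(* The zero space is excluded: its projective space is empty, so it carries no
   probability measure (and measurable types are pointed).
   {dot V for idfun} is the type of real inner products on V. *)
Record euclidean (R : realType) := Euclidean {
  evect :> vectType R ;
  edot : {dot evect for idfun} ;
  edim_gt0 : (0 < \dim {: evect})%N }.

Section StandardEuclidean.
Context (R : realType) (n : nat).

Definition std_dot (u v : 'rV[R]_n) : R := (u *m v^T) 0 0.

Lemma std_dot_bilinear : bilinear_for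
  (GRing.Scale.Law.clone _ _ ( *%R ) _)
  (GRing.Scale.Law.clone _ _ (idfun \; *%R ) _) std_dot.
Proof.
split=> [v|u] a x y; rewrite /std_dot /=.
  by rewrite mulmxDl -scalemxAl !mxE.
by rewrite linearP /= mulmxDr -scalemxAr !mxE.
Qed.

HB.instance Definition _ := bilinear_isBilinear.Build R _ _ _
  (GRing.Scale.Law.clone _ _ ( *%R ) _)
  (GRing.Scale.Law.clone _ _ (idfun \; *%R ) _) std_dot std_dot_bilinear.

Lemma std_dotC (u v : 'rV[R]_n) :
  std_dot u v = (-1) ^+ false * idfun (std_dot v u).
Proof.
rewrite expr0 mul1r /std_dot !mxE /=.
by apply: eq_bigr => i _; rewrite !mxE mulrC.
Qed.

HB.instance Definition _ :=
  isHermitianSesquilinear.Build R 'rV[R]_n false idfun std_dot std_dotC.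

Lemma std_dot_gt0 (u : 'rV[R]_n) : u != 0 -> 0 < std_dot u u.
Proof.
move=> u0; rewrite /std_dot mxE lt0r; apply/andP; split; last first.
  by apply: sumr_ge0 => i _; rewrite !mxE -expr2 sqr_ge0.
apply: contra u0 => /eqP /psumr_eq0P H; apply/eqP/rowP => i; rewrite mxE.
have u2_ge0 j : true -> 0 <= u 0 j * u^T j 0 by rewrite mxE -expr2 sqr_ge0.
by have /eqP := H u2_ge0 i isT; rewrite mxE -expr2 sqrf_eq0 => /eqP.
Qed.

HB.instance Definition _ :=
  isDotProduct.Build R 'rV[R]_n std_dot std_dot_gt0.

End StandardEuclidean.

Lemma std_dim_gt0 (R : realType) (n : nat) : (0 < \dim {: 'rV[R]_n.+1})%N.
Proof. by rewrite dimvf dim_matrix muln_gt0. Qed.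

Definition std_euclidean (R : realType) (n : nat) : euclidean R :=
  Euclidean (std_dot (R := R) (n := n.+1)) (std_dim_gt0 R n).

Section RestrictedEuclidean.
Context (R : realType) (E : euclidean R) (L : {vspace E}).

Definition sub_dot (u v : subvs_of L) : R := edot E (vsval u) (vsval v).

Lemma sub_dot_bilinear : bilinear_for
  (GRing.Scale.Law.clone _ _ ( *%R ) _)
  (GRing.Scale.Law.clone _ _ (idfun \; *%R ) _) sub_dot.
Proof.
by split=> [v|u] a x y; rewrite /sub_dot linearP /= ?linearPl.
Qed.

HB.instance Definition _ := bilinear_isBilinear.Build R _ _ _
  (GRing.Scale.Law.clone _ _ ( *%R ) _)
  (GRing.Scale.Law.clone _ _ (idfun \; *%R ) _) sub_dot sub_dot_bilinear.

Lemma sub_dotC (u v : subvs_of L) :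
  sub_dot u v = (-1) ^+ false * idfun (sub_dot v u).
Proof. exact: (hermC (edot E)). Qed.

HB.instance Definition _ :=
  isHermitianSesquilinear.Build R (subvs_of L) false idfun sub_dot sub_dotC.

Lemma sub_dot_gt0 (u : subvs_of L) : u != 0 -> 0 < sub_dot u u.
Proof.
move=> u0; apply: (neq0_dnorm_gt0 (s := edot E)).
by apply: contra u0 => /eqP u0; apply/eqP/val_inj.
Qed.

HB.instance Definition _ :=
  isDotProduct.Build R (subvs_of L) sub_dot sub_dot_gt0.

Lemma sub_dim_gt0 : (0 < \dim L)%N -> (0 < \dim {: subvs_of L})%N.
Proof. by rewrite [\dim {: subvs_of L}]dimvf. Qed.

Definition sub_euclidean (hL : (0 < \dim L)%N) : euclidean R :=
  Euclidean sub_dot (sub_dim_gt0 hL).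

End RestrictedEuclidean.

Section Projective.
Context (R : realType) (E : euclidean R).

(* The points of P(E) are the lines of E. *)
Definition proj_space := {l : {vspace E} | \dim l == 1%N}.

HB.instance Definition _ :=
  SubChoice.copy proj_space {l : {vspace E} | \dim l == 1%N}.

Lemma dim_line_vpick : \dim <[vpick {: E}]>%VS == 1%N.
Proof.
by rewrite dim_vline vpick0 -dimv_eq0 -lt0n (edim_gt0 E).
Qed.

HB.instance Definition _ :=
  isPointed.Build proj_space (exist _ <[vpick {: E}]>%VS dim_line_vpick).

(* The class [x] of a nonzero vector x; junk value for x = 0. *)
Definition proj_class (x : E) : proj_space :=
  insubd (point : proj_space) <[x]>%VS.

Definition proj_repr (p : proj_space) : E := vpick (val p).

(* Quotient topology of E \ {0} -> P(E), where E has its topology as a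
   finite-dimensional vector space, that is, the one of its coordinates. *)
Definition proj_open (U : set proj_space) : Prop :=
  open [set c : 'rV[R]_(\dim {: E}) |
    c != 0 /\ U (proj_class (passmx.vecof (vbasis {: E}) c))].

Let proj_openT : proj_open setT.
Proof.
rewrite /proj_open (_ : mkset _ = ~` [set 0]); last first.
  by apply/seteqP; split=> c /=; [case=> /eqP|move=> /eqP].
by rewrite openC; apply: accessible_closed_set1; apply: hausdorff_accessible;
  exact: norm_hausdorff.
Qed.

Let proj_openI : setI_closed proj_open.
Proof.
move=> A B oA oB; rewrite /proj_open.
rewrite (_ : mkset _ = [set c : 'rV[R]_(\dim {: E}) |
    c != 0 /\ A (proj_class (passmx.vecof (vbasis {: E}) c))] `&`
  [set c : 'rV[R]_(\dim {: E}) |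
    c != 0 /\ B (proj_class (passmx.vecof (vbasis {: E}) c))]).
  exact: openI.
by apply/seteqP; split=> c /=; [case=> ? [] | case=> -[? ?] []].
Qed.

Let proj_open_bigU (I : Type) (f : I -> set proj_space) :
  (forall i, proj_open (f i)) -> proj_open (\bigcup_i f i).
Proof.
move=> of_; rewrite /proj_open.
rewrite (_ : mkset _ = \bigcup_i [set c : 'rV[R]_(\dim {: E}) |
    c != 0 /\ f i (proj_class (passmx.vecof (vbasis {: E}) c))]).
  by apply: bigcup_open => i _; exact: of_.
apply/seteqP; split=> c /=; first by case=> c0 [i _ fi]; exists i.
by case=> i _ /= [c0 fi]; split=> //; exists i.
Qed.

HB.instance Definition _ :=
  isOpenTopological.Build proj_space proj_openT proj_openI proj_open_bigU.

End Projective.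

Definition proj_borel (R : realType) (E : euclidean R) :=
  g_sigma_algebraType (@open (proj_space E)).

Definition proj_prob (R : realType) (E : euclidean R) :=
  probability (proj_borel E) R.

(* P(L) as a subset of P(E), for a linear subspace L of E. *)
Definition proj_sub (R : realType) (E : euclidean R) (L : {vspace E}) :
  set (proj_borel E) := [set p : proj_space E | (val p <= L)%VS].

(* The map [x] |-> [f x]; meaningful only when f is injective. *)
Definition proj_map (R : realType) (E F : euclidean R) (f : 'Hom(E, F))
  (p : proj_borel E) : proj_borel F :=
  insubd (point : proj_space F) (f @: val (p : proj_space E))%VS.

(* The vector of W whose coordinates are the limits (resp. the integrals) of
   those of u (resp. f); this does not depend on the basis. *)
Definition vlim (R : realType) (W : vectType R) (u : nat -> W) : W :=
  \sum_(i < \dim {: W})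
    lim (coord (vbasis {: W}) i (u k) @[k --> \oo]) *: (vbasis {: W})`_i.

Definition vintegral (R : realType) (W : vectType R) d (T : measurableType d)
  (m : {measure set T -> \bar R}) (f : T -> W) : W :=
  \sum_(i < \dim {: W})
    (\int[m]_(x in setT) coord (vbasis {: W}) i (f x)) *: (vbasis {: W})`_i.

Definition lfun_exp (R : realType) (V : vectType R) (A : 'End(V)) : 'End(V) :=
  vlim (fun N => \sum_(k < N) (k`!%:R)^-1 *: iter k (comp_lfun A) \1%VF).

Section Stability.
Context (R : realType) (E : euclidean R).
Implicit Types (g A X : 'End(E)) (nu : proj_prob E).

Definition SL : set 'End(E) :=
  [set g | \det (passmx.mxof (vbasis {: E}) (vbasis {: E}) g) = 1].

Definition so : set 'End(E) :=
  [set A | forall u v, edot E (A u) v + edot E u (A v) = 0].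

(* The gradient map, with x x^T the endomorphism v |-> <v, x> x. *)
Definition grad_map (p : proj_borel E) : 'End(E) :=
  let x := proj_repr p in
  2^-1 *: ((edot E x x)^-1 *: linfun (fun v : E => edot E v x *: x)
           - (\dim {: E})%:R^-1 *: \1%VF).

Definition grad_int nu : 'End(E) := vintegral nu grad_map.

(* nu' = g nu as Borel measures; a library measure is a function on all sets,
   only its values on measurable sets matter. *)
Definition is_translate g nu nu' : Prop :=
  forall B, measurable B -> nu' B = pushforward nu (proj_map g) B.

Definition SL_orbit nu : set (proj_prob E) :=
  [set nu' | exists2 g, SL g & is_translate g nu nu'].

Definition stabilizer nu : set 'End(E) :=
  [set g | SL g /\ is_translate g nu nu].

Definition stabilizer_lie nu : set 'End(E) :=
  [set X | forall t : R, stabilizer nu (lfun_exp (t *: X))].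

Definition test_integral nu :
    {ptws {f : proj_space E -> R | continuous f} -> R} :=
  fun f => \int[nu]_(p in setT) sval f p.

Definition weak_prob := initial_topology test_integral.

Definition polystable nu : Prop :=
  exists nu', SL_orbit nu nu' /\ grad_int nu' = 0.

Definition stable nu : Prop :=
  polystable nu /\
  exists2 g, SL g &
    forall X, stabilizer_lie nu X -> so (g \o X \o g^-1)%VF.

Definition semistable nu : Prop :=
  exists nu', closure (SL_orbit nu : set weak_prob) nu' /\ grad_int nu' = 0.

End Stability.

(* Main.v *)
(** In coordinates a measure on P(E) is a measurable field of lines [x t], and
    the gradient condition for the translate by [g] says that the average of
    the projections onto the lines [x t *m g] is the scalar matrix 1/m; call
    such a [g] balancing.  Averaging against the projection onto a subspace
    shows that a balanced field gives each subspace W mass at most dim W / m,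
    with equality only if the remaining mass lies on the orthogonal complement
    of W; an approximate version gives the inequality for semistable measures.

    Conversely, if all these inequalities are strict, minimise over det g = 1
    the integral of ln (|x g|^2 / |x|^2) plus e |g|^2.  As e tends to 0 the
    minimisers, normalised in norm, converge up to a subsequence to some h.
    A singular h would put too much mass on its kernel, so h is invertible and
    it is balancing.  If equality holds for some W, choose a complement W' of W
    and stretch along W': the field degenerates to one carried by W and W',
    both of which satisfy the inequalities, and induction on the dimension
    gives a balanced limit.  When W' can be chosen to carry the mass outside W,
    the limit is attained, so the measure is polystable; iterating this
    decomposition yields the splitting of (3).

    A balanced measure satisfying the strict inequalities is fixed in SL only
    by orthogonal maps (look at the top eigenspace of [h *m h^T]), hence is
    stable.  If equality holds for W, the maps acting by different scalars on W
    and on W' fix the measure and do not form a compact group. *)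


Require Import Defs.
From HB Require Import structures.
From mathcomp Require Import all_boot all_order all_algebra perm.
From mathcomp Require Import all_classical all_reals all_analysis.
From mathcomp Require Import measurable_realfun ring lra zify.

Set Implicit Arguments.
Unset Strict Implicit.
Unset Printing Implicit Defensive.

Import Order.TTheory GRing.Theory Num.Theory.
Import numFieldNormedType.Exports.

Local Open Scope classical_set_scope.
Local Open Scope ring_scope.

(** * Integrals of bounded functions *)

(** The representative of a point of P(E) is picked without any measurability, so a field [x] is
    used only through what rescaling of [x t] does not change: the entries of the projection
    [dirmx (x t)], and scale-invariant open sets. The penalty e |g|^2 gives every field a minimiser,
    because up to a constant the logarithmic term is bounded below by a multiple of - ln (1 +
    |g|^2). Its Euler equation reads avg = kp + e (|g|^2 / m - g^T g). If the normalised limit h is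
    singular, the bracket, traced over the w directions orthogonal to the image of h, is eventually
    nonnegative. These directions keep an average of at least kp w, which in the limit must come
    from the lines in ker h; as ker h also has dimension w, strictness excludes this. If h is
    invertible, det g = 1 keeps |g| bounded and the penalty disappears with e. Degenerating
    sequences live in GL with determinants of one sign: a single reflection, which preserves
    balance, then brings them all into SL after rescaling. *)

Section BoundedIntegral.
Context d (T : measurableType d) (R : realType) (P : probability T R).
Context (D : set T) (mD : measurable D).
Implicit Types f g : T -> R.

Definition bdd_meas f :=
  measurable_fun D f /\ exists M, forall t, D t -> `|f t| <= M.

Lemma bdd_meas_integrable f : bdd_meas f -> P.-integrable D (EFin \o f).
Proof.
case=> mf [M fM]; apply: measurable_bounded_integrable => //.
  by rewrite (le_lt_trans (probability_le1 P mD)) ?ltry.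
exists M; split; first exact: num_real.
by move=> y My t Dt /=; apply: le_trans (fM _ Dt) (ltW My).
Qed.

Lemma bdd_measD f g : bdd_meas f -> bdd_meas g ->
  bdd_meas (fun t => f t + g t).
Proof.
move=> [mf [M fM]] [mg [N gN]]; split; first exact: measurable_funD.
by exists (M + N) => t Dt; rewrite (le_trans (ler_normD _ _))// lerD ?fM ?gN.
Qed.

Lemma bdd_measM f g : bdd_meas f -> bdd_meas g ->
  bdd_meas (fun t => f t * g t).
Proof.
move=> [mf [M fM]] [mg [N gN]]; split; first exact: measurable_funM.
by exists (M * N) => t Dt; rewrite normrM ler_pM ?fM ?gN.
Qed.

Lemma bdd_meas_cst r : bdd_meas (fun=> r).
Proof. by split; [exact: measurable_cst|exists `|r|]. Qed.

Lemma bdd_measZ r f : bdd_meas f -> bdd_meas (fun t => r * f t).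
Proof. by move=> bf; apply: bdd_measM => //; exact: bdd_meas_cst. Qed.

Lemma bdd_measB f g : bdd_meas f -> bdd_meas g ->
  bdd_meas (fun t => f t - g t).
Proof.
move=> bf /(bdd_measZ (-1)) bg.
by under eq_fun do rewrite -mulN1r; exact: bdd_measD.
Qed.

Lemma bdd_meas_sum (I : Type) (r : seq I) (F : I -> T -> R) :
  (forall i, bdd_meas (F i)) -> bdd_meas (fun t => \sum_(i <- r) F i t).
Proof.
move=> bF; elim: r => [|i r ih].
  by under eq_fun do rewrite big_nil; exact: bdd_meas_cst.
by under eq_fun do rewrite big_cons; exact: bdd_measD.
Qed.

Lemma bdd_meas_indic (A : set T) : measurable A -> bdd_meas (\1_A).
Proof.
move=> mA; split; first exact: measurable_indic.
by exists 1 => t _; rewrite indicE; case: (_ \in _); rewrite ?normr1 ?normr0.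
Qed.

Lemma bdd_meas_eq f g : (forall t, D t -> f t = g t) -> bdd_meas f ->
  bdd_meas g.
Proof.
move=> fg [mf [M fM]]; split.
  by apply: eq_measurable_fun mf => t /set_mem /fg.
by exists M => t Dt; rewrite -fg ?fM.
Qed.

Lemma eq_Rint f g : (forall t, D t -> f t = g t) ->
  \int[P]_(t in D) f t = \int[P]_(t in D) g t.
Proof. by move=> fg; apply: eq_Rintegral => t /set_mem /fg. Qed.

Lemma bddD f g : bdd_meas f -> bdd_meas g ->
  \int[P]_(t in D) (f t + g t) = \int[P]_(t in D) f t + \int[P]_(t in D) g t.
Proof. by move=> bf bg; rewrite RintegralD//; exact: bdd_meas_integrable. Qed.

Lemma bddB f g : bdd_meas f -> bdd_meas g ->
  \int[P]_(t in D) (f t - g t) = \int[P]_(t in D) f t - \int[P]_(t in D) g t.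
Proof. by move=> bf bg; rewrite RintegralB//; exact: bdd_meas_integrable. Qed.

Lemma bddZ r f : bdd_meas f ->
  \int[P]_(t in D) (r * f t) = r * \int[P]_(t in D) f t.
Proof. by move=> bf; rewrite RintegralZl//; exact: bdd_meas_integrable. Qed.

Lemma bdd_sum (I : Type) (r : seq I) (F : I -> T -> R) :
  (forall i, bdd_meas (F i)) ->
  \int[P]_(t in D) (\sum_(i <- r) F i t) = \sum_(i <- r) \int[P]_(t in D) F i t.
Proof.
move=> bF; elim: r => [|i r ih].
  by under eq_Rint do rewrite big_nil; rewrite big_nil Rintegral_cst ?mul0r.
under eq_Rint do rewrite big_cons.
by rewrite big_cons bddD ?ih//; exact: bdd_meas_sum.
Qed.

Lemma bdd_le f g : bdd_meas f -> bdd_meas g ->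
  (forall t, D t -> f t <= g t) ->
  \int[P]_(t in D) f t <= \int[P]_(t in D) g t.
Proof. by move=> bf bg fg; apply: le_Rintegral => //; exact: bdd_meas_integrable. Qed.

Lemma fine_prob_le1 (A : set T) : measurable A -> fine (P A) <= 1.
Proof.
move=> mA; rewrite -lee_fin fineK ?probability_le1//.
exact: fin_num_measure.
Qed.

Lemma Rint_indic (A : set T) : measurable A ->
  \int[P]_(t in D) \1_A t = fine (P (D `&` A)).
Proof. by move=> mA; rewrite /Rintegral integral_indic// setIC. Qed.

(** Dominated convergence with a constant bound; the limit inherits the bound, hence is integrable
    too. *)
Lemma bdd_cvg (f_ : nat -> T -> R) f M :
  (forall n, measurable_fun D (f_ n)) ->
  (forall n t, D t -> `|f_ n t| <= M) ->
  (forall t, D t -> f_ n t @[n --> \oo] --> f t) ->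
  measurable_fun D f ->
  \int[P]_(t in D) f_ n t @[n --> \oo] --> \int[P]_(t in D) f t.
Proof.
move=> mf_ fM f_f mf.
have bf : bdd_meas f.
  split=> //; exists M => t Dt.
  have /(cvg_comp _ _) /(_ (@norm_continuous _ R^o _)) h := f_f t Dt.
  apply: (@closed_cvg _ _ _ eventually_filter _ [set x | x <= M] _ _ _ h) => /=.
    exact: closed_le.
  by near=> n; exact: fM.
have cvgE : {ae P, forall t, D t -> (EFin \o f_ ^~ t) n @[n --> \oo] --> (f t)%:E}.
  by apply: aeW => t Dt; apply: cvg_EFin; [exact: nearW|exact: f_f].
have [_ _ h] := @dominated_convergence _ _ _ P D mD (fun n => EFin \o f_ n)
  (EFin \o f) (fun=> M%:E) (fun n => (measurable_EFinP _ _).2 (mf_ n))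
  ((measurable_EFinP _ _).2 mf) cvgE
  (bdd_meas_integrable (bdd_meas_cst M))
  (aeW P (fun t n Dt => fM n t Dt)).
apply: fine_cvg; rewrite fineK//; exact: (integrable_fin_num mD (bdd_meas_integrable bf)).
Unshelve. all: by end_near. Qed.

Lemma Rint_ge0_eq0 f : bdd_meas f -> (forall t, D t -> 0 <= f t) ->
  \int[P]_(t in D) f t = 0 -> P (D `&` [set t | f t != 0]) = 0%E.
Proof.
move=> bf f0 If.
have fin := integrable_fin_num mD (bdd_meas_integrable bf).
have : (\int[P]_(x in D) `|(f x)%:E| = 0)%E.
  transitivity (\int[P]_(x in D) (f x)%:E)%E.
    by apply: eq_integral => t /set_mem Dt /=; rewrite ger0_norm ?f0.
  by rewrite -[LHS]fineK// -/(Rintegral P D f) If.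
have mf : measurable_fun D (EFin \o f) by apply/measurable_EFinP; case: bf.
move/(ae_eq_integral_abs P mD mf) => [N [mN N0 sN]].
apply/eqP; rewrite -measure_le0 -N0 le_measure ?inE//.
  rewrite (_ : _ `&` _ = D `&` f @^-1` (~` [set 0])).
    by apply: bf.1 => //; exact: measurableC.
  by apply/seteqP; split => t [Dt /= /eqP ft].
move=> t [Dt /= /eqP ft]; apply: sN => /= /(_ Dt) [].
exact: ft.
Qed.

End BoundedIntegral.

(** * Projections onto lines *)

Section StdDot.
Context (R : realType).

Lemma std_dotE n (u v : 'rV[R]_n) : std_dot u v = \sum_i u 0 i * v 0 i.
Proof. by rewrite /std_dot mxE; apply: eq_bigr => i _; rewrite mxE. Qed.

Lemma std_dot_sym n (u v : 'rV[R]_n) : std_dot u v = std_dot v u.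
Proof. by rewrite !std_dotE; apply: eq_bigr => i _; rewrite mulrC. Qed.

Lemma std_dotMr m n (u : 'rV[R]_m) (v : 'rV[R]_n) (A : 'M[R]_(m, n)) :
  std_dot (u *m A) v = std_dot u (v *m A^T).
Proof. by rewrite /std_dot trmx_mul trmxK mulmxA. Qed.

Lemma std_dotDl n (u v w : 'rV[R]_n) :
  std_dot (u + v) w = std_dot u w + std_dot v w.
Proof. by rewrite /std_dot mulmxDl mxE. Qed.

Lemma std_dotDr n (u v w : 'rV[R]_n) :
  std_dot u (v + w) = std_dot u v + std_dot u w.
Proof. by rewrite ![std_dot u _]std_dot_sym std_dotDl. Qed.

Lemma std_dotZl n a (u v : 'rV[R]_n) : std_dot (a *: u) v = a * std_dot u v.
Proof. by rewrite /std_dot -scalemxAl mxE. Qed.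

Lemma std_dotZr n a (u v : 'rV[R]_n) : std_dot u (a *: v) = a * std_dot u v.
Proof. by rewrite ![std_dot u _]std_dot_sym std_dotZl. Qed.

Lemma std_dotNl n (u v : 'rV[R]_n) : std_dot (- u) v = - std_dot u v.
Proof. by rewrite -scaleN1r std_dotZl mulN1r. Qed.

Lemma std_dotNr n (u v : 'rV[R]_n) : std_dot u (- v) = - std_dot u v.
Proof. by rewrite -scaleN1r std_dotZr mulN1r. Qed.

Lemma std_dot0l n (u : 'rV[R]_n) : std_dot 0 u = 0.
Proof. by rewrite /std_dot mul0mx mxE. Qed.

Lemma sqn_ge0 n (u : 'rV[R]_n) : 0 <= std_dot u u.
Proof. by rewrite std_dotE sumr_ge0// => i _; rewrite -expr2 sqr_ge0. Qed.

Lemma sqn_gt0 n (u : 'rV[R]_n) : (0 < std_dot u u) = (u != 0).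
Proof.
apply/idP/idP => [|/std_dot_gt0//]; apply: contraTneq => ->.
by rewrite std_dot0l ltxx.
Qed.

Lemma sqn_eq0 n (u : 'rV[R]_n) : (std_dot u u == 0) = (u == 0).
Proof. by apply/idP/idP; apply: contraTT; rewrite -sqn_gt0 lt0r sqn_ge0 andbT. Qed.

Lemma sqn_coord n (u : 'rV[R]_n) i : u 0 i ^+ 2 <= std_dot u u.
Proof.
rewrite std_dotE (bigD1 i)//= -expr2 lerDl sumr_ge0// => j _.
by rewrite -expr2 sqr_ge0.
Qed.

Lemma std_dot_delta n (u : 'rV[R]_n) i : std_dot u (delta_mx 0 i) = u 0 i.
Proof.
rewrite std_dotE (bigD1 i)//= big1 ?addr0 => [|j ji]; rewrite mxE.
  by rewrite !eqxx mulr1.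
by rewrite (negPf ji) andbF mulr0.
Qed.

(** Induction by elimination of the first coordinate, which leaves the Schur complement [C']. It
    plays the part of Gram-Schmidt, both for row spaces and for the inner product of a Euclidean
    space. *)
Lemma cholesky n (G : 'M[R]_n) : G^T = G ->
  (forall v : 'rV_n, v != 0 -> 0 < (v *m G *m v^T) 0 0) ->
  exists2 S : 'M[R]_n, S \in unitmx & G = S *m S^T.
Proof.
elim: n G => [|n IH] G symG posG.
  by exists 1%:M; [exact: unitmx1|apply/matrixP => -[]].
rewrite -[n.+1]/(1 + n)%N in G symG posG *.
pose a : R := ulsubmx G 0 0; pose b := ursubmx G; pose C := drsubmx G.
have bT : dlsubmx G = b^T by rewrite /b trmx_ursub symG.
have CT : C^T = C by rewrite /C trmx_drsub symG.
have GE : G = block_mx a%:M b b^T C.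
  by rewrite -[LHS]submxK bT /a -mx11_scalar.
have a0 : 0 < a.
  have v0 : row_mx (1%:M : 'M[R]_1) (0 : 'rV_n) != 0.
    apply/negP => /eqP /(congr1 lsubmx); rewrite row_mxKl linear0.
    by move=> /matrixP /(_ 0 0)/eqP; rewrite !mxE oner_eq0.
  have := posG _ v0; rewrite {1}GE mul_row_block tr_row_mx mul_row_col.
  by rewrite !mul1mx !mul0mx !addr0 trmx0 mulmx0 addr0 trmx1 mulmx1 mxE.
pose C' := C - a^-1 *: (b^T *m b).
have [||S' S'u C'E] := IH C'.
- by rewrite /C' linearB /= linearZ /= trmx_mul trmxK CT.
- move=> w w0.
  (* The first entry makes [v *m G] vanish there, so that the form at this vector is the value of
     [C'] at [w]. *)
  have v0 : row_mx (- a^-1 *: (w *m b^T)) w != 0.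
    by apply: contra w0 => /eqP /(congr1 rsubmx); rewrite row_mxKr linear0 => ->.
  have := posG _ v0; rewrite {1}GE mul_row_block tr_row_mx mul_row_col.
  rewrite mul_mx_scalar scalerA mulrN mulfV ?gt_eqF// scaleN1r addNr mul0mx add0r.
  by rewrite /C' -scalemxAl mulmxBr -!scalemxAr mulmxA addrC scaleNr.
pose s := Num.sqrt a; have s0 : 0 < s by rewrite sqrtr_gt0.
have ss : s * s = a by rewrite -expr2 sqr_sqrtr ?ltW.
exists (block_mx s%:M 0 (s^-1 *: b^T) S').
  by rewrite unitmxE det_lblock det_scalar1 unitrM -unitmxE S'u unitfE gt_eqF.
rewrite {1}GE tr_block_mx mulmx_block !trmx0 !mul0mx !mulmx0 !addr0.
rewrite tr_scalar_mx -scalar_mxM ss mul_scalar_mx mul_mx_scalar linearZ /= trmxK.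
rewrite !scalerA mulfV ?gt_eqF// !scale1r; congr block_mx.
rewrite -C'E /C' -scalemxAl -scalemxAr scalerA -invfM ss.
by rewrite addrC subrK.
Qed.

Lemma mulmx_gram m n (A : 'M[R]_(m, n)) (v : 'rV_m) :
  (v *m (A *m A^T) *m v^T) 0 0 = std_dot (v *m A) (v *m A).
Proof. by rewrite /std_dot trmx_mul !mulmxA. Qed.

(** The Gram matrix of [row_base W] factors as S S^T, and S^-1 orthonormalises the rows. *)
Lemma orthonormal_rows k m (W : 'M[R]_(k, m)) :
  exists U : 'M[R]_(\rank W, m), U *m U^T = 1%:M /\ (U :=: W)%MS.
Proof.
have [||S Su SE] := @cholesky _ (row_base W *m (row_base W)^T).
- by rewrite trmx_mul trmxK.
- move=> v v0; rewrite mulmx_gram sqn_gt0; apply: contra v0 => /eqP vB.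
  by apply/eqP/(row_free_inj (row_base_free W)); rewrite vB mul0mx.
exists (invmx S *m row_base W); split.
  by rewrite trmx_mul mulmxA -(mulmxA _ (row_base W)) SE mulmxA mulVmx// mul1mx
     -trmx_mul mulVmx// trmx1.
apply: eqmx_trans (eq_row_base W); apply: eqmxMfull.
by rewrite row_full_unit unitmx_inv.
Qed.

Lemma orthonormal_sqn k m (U : 'M[R]_(k, m)) (x : 'rV_m) :
  U *m U^T = 1%:M -> std_dot x x - std_dot (x *m U^T) (x *m U^T) =
  std_dot (x - x *m U^T *m U) (x - x *m U^T *m U).
Proof.
move=> UU; set y := x *m U^T.
have xy : std_dot x (y *m U) = std_dot y y by rewrite std_dot_sym std_dotMr.
have yy : std_dot (y *m U) (y *m U) = std_dot y y.
  by rewrite std_dotMr -mulmxA UU mulmx1.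
rewrite std_dotDl !std_dotDr !std_dotNl !std_dotNr (std_dot_sym _ x) xy yy.
by ring.
Qed.

Lemma orthonormal_bessel k m (U : 'M[R]_(k, m)) (x : 'rV_m) :
  U *m U^T = 1%:M -> std_dot (x *m U^T) (x *m U^T) <= std_dot x x.
Proof. by move=> UU; rewrite -subr_ge0 orthonormal_sqn// sqn_ge0. Qed.

Lemma orthonormal_submx k m (U : 'M[R]_(k, m)) (x : 'rV_m) :
  U *m U^T = 1%:M ->
  (x <= U)%MS = (std_dot (x *m U^T) (x *m U^T) == std_dot x x).
Proof.
move=> UU; rewrite eq_sym -subr_eq0 orthonormal_sqn// sqn_eq0.
apply/idP/idP => [/submxP[y ->]|]; first by rewrite -!mulmxA (mulmxA U) UU mul1mx subrr.
by rewrite subr_eq0 => /eqP ->; exact: submxMl.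
Qed.

(** The rows of [U] span the orthogonal complement of the image of x |-> x h: the directions lost in
    a singular limit. *)
Lemma orthonormal_ker k m (h : 'M[R]_(k, m)) :
  exists U : 'M[R]_(m - \rank h, m), U *m U^T = 1%:M /\ h *m U^T = 0.
Proof.
have [U [UU UK]] := orthonormal_rows (kermx h^T).
have rE : \rank (kermx h^T) = (m - \rank h)%N by rewrite mxrank_ker mxrank_tr.
have UhT : U *m h^T = 0.
  by apply/sub_kermxP; rewrite UK.
move: U UU UhT {UK}; rewrite rE => U UU UhT; exists U; split => //.
by apply/trmx_inj; rewrite trmx_mul trmxK UhT trmx0.
Qed.

(** Sylvester's identity: [A *m B] and [B *m A] are both block triangular and have the same
    determinant. For orthogonal [u] and [v] it gives shears of determinant 1. *)
Lemma det_rank1 m (u v : 'rV[R]_m) : \det (1%:M + u^T *m v) = 1 + std_dot v u.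
Proof.
have H0 (w : 'rV[R]_m) : \det (1%:M - w^T *m v) = \det (1%:M - v *m w^T).
  pose A := block_mx (1%:M : 'M[R]_1) (- v) 0 (1%:M : 'M[R]_m).
  pose B := block_mx (1%:M : 'M[R]_1) v w^T (1%:M : 'M[R]_m).
  have AB : A *m B = block_mx (1%:M - v *m w^T) 0 w^T 1%:M.
    by rewrite mulmx_block !mul1mx !mulmx1 !mul0mx !add0r mulNmx subrr.
  have BA : B *m A = block_mx 1%:M 0 w^T (1%:M - w^T *m v).
    by rewrite mulmx_block !mul1mx !mulmx1 !mulmx0 !addr0 mulmxN addNr addrC.
  have := congr1 determinant AB; have := congr1 determinant BA.
  by rewrite !det_mulmx !det_lblock !det1 mulr1 mul1r mulrC => -> <-.
have := H0 (- u); rewrite linearN /= mulNmx mulmxN !opprK => ->.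
by rewrite det_mx11 /std_dot !mxE.
Qed.

End StdDot.

Section DirMx.
Context (R : realType).

(** The orthogonal projection onto the line of [v], an encoding of the point [v] that ignores
    rescaling; it is 0 for [v = 0]. *)
Definition dirmx n (v : 'rV[R]_n) : 'M[R]_n := (std_dot v v)^-1 *: (v^T *m v).

Lemma dirmxE n (v : 'rV[R]_n) i j :
  dirmx v i j = v 0 i * v 0 j / std_dot v v.
Proof. by rewrite !mxE big_ord1 !mxE mulrC. Qed.

Lemma dirmxZ n c (v : 'rV[R]_n) : c != 0 -> dirmx (c *: v) = dirmx v.
Proof.
move=> c0; apply/matrixP => i j; rewrite !dirmxE std_dotZl std_dotZr !mxE.
have [->|v0] := eqVneq v 0; first by rewrite !mxE !(mulr0, mul0r).
by field; rewrite sqn_eq0 v0 c0.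
Qed.

Lemma dirmx_le1 n (v : 'rV[R]_n) i j : `|dirmx v i j| <= 1.
Proof.
rewrite dirmxE; have [->|v0] := eqVneq v 0.
  by rewrite !mxE !mul0r normr0.
have s0 : 0 < std_dot v v by rewrite sqn_gt0.
rewrite normrM normfV (gtr0_norm s0) ler_pdivrMr// mul1r.
rewrite normrM; have := sqn_coord v i; have := sqn_coord v j.
rewrite -(real_normK (num_real (v 0 i))) -(real_normK (num_real (v 0 j))).
move: `|v 0 i| `|v 0 j| => a b hb ha; have := sqr_ge0 (a - b); nra.
Qed.

(** Writes the projection onto [x g] in terms of the one onto [x] alone; measurability passes from
    [x] to [x g] this way. *)
Lemma dirmxM m n (x : 'rV[R]_m) (g : 'M[R]_(m, n)) : x != 0 ->
  dirmx (x *m g) = (\tr (g^T *m dirmx x *m g))^-1 *: (g^T *m dirmx x *m g).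
Proof.
move=> x0; rewrite /dirmx.
have xx0 : std_dot x x != 0 by rewrite sqn_eq0.
have -> : g^T *m ((std_dot x x)^-1 *: (x^T *m x)) *m g =
    (std_dot x x)^-1 *: ((x *m g)^T *m (x *m g)).
  by rewrite trmx_mul -scalemxAr -scalemxAl !mulmxA.
rewrite mxtraceZ mxtrace_mulC {1}/mxtrace big_ord1 -/(std_dot _ _) scalerA.
by rewrite invfM invrK mulrAC divff ?mul1r.
Qed.

Lemma tr_dirmx n (A : 'M[R]_n) (v : 'rV_n) :
  \tr (A *m dirmx v) = (v *m A *m v^T) 0 0 / std_dot v v.
Proof.
rewrite /dirmx -scalemxAr linearZ /= mulmxA mxtrace_mulC mulmxA.
by rewrite /mxtrace big_ord1 mulrC.
Qed.

Lemma tr_dirmx_cross n (v a b : 'rV[R]_n) :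
  \tr ((a^T *m b) *m dirmx v) = std_dot v a * std_dot v b / std_dot v v.
Proof.
rewrite tr_dirmx !mulmxA -mulmxA mxE big_ord1; congr (_ * _ / _).
by rewrite -/(std_dot _ _) std_dot_sym.
Qed.

Lemma tr_dirmx_gram k n (U : 'M[R]_(n, k)) (v : 'rV_n) :
  \tr (U *m U^T *m dirmx v) = std_dot (v *m U) (v *m U) / std_dot v v.
Proof. by rewrite tr_dirmx mulmx_gram. Qed.

End DirMx.

(** * Entrywise convergence of matrices *)

Section MatrixSequences.
Context (R : realType).

Definition mxcvg m n (g_ : nat -> 'M[R]_(m, n)) (g : 'M[R]_(m, n)) :=
  forall i j, g_ k i j @[k --> \oo] --> g i j.

Lemma cvg_sumr (T I : Type) (F : set_system T) {FF : Filter F} (r : seq I)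
    (f : T -> I -> R) (l : I -> R) :
  (forall i, f x i @[x --> F] --> l i) ->
  \sum_(i <- r) f x i @[x --> F] --> \sum_(i <- r) l i.
Proof.
move=> fl; elim: r => [|i r ih].
  by under eq_fun do rewrite big_nil; rewrite big_nil; exact: cvg_cst.
by under eq_fun do rewrite big_cons; rewrite big_cons; exact: cvgD.
Qed.

Lemma cvgn_prod (I : Type) (r : seq I) (F : nat -> I -> R) (l : I -> R) :
  (forall i, F k i @[k --> \oo] --> l i) ->
  \prod_(i <- r) F k i @[k --> \oo] --> \prod_(i <- r) l i.
Proof.
move=> Fl; elim: r => [|i r ih].
  by under eq_fun do rewrite big_nil; rewrite big_nil; exact: cvg_cst.
by under eq_fun do rewrite big_cons; rewrite big_cons; exact: cvgM.
Qed.

Lemma mxcvg_cst m n (A : 'M[R]_(m, n)) : mxcvg (fun=> A) A.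
Proof. by move=> i j; exact: cvg_cst. Qed.

Lemma mxcvgD m n (A_ B_ : nat -> 'M[R]_(m, n)) A B :
  mxcvg A_ A -> mxcvg B_ B -> mxcvg (fun k => A_ k + B_ k) (A + B).
Proof.
move=> hA hB i j; rewrite mxE; under eq_fun do rewrite mxE.
exact: cvgD (hA _ _) (hB _ _).
Qed.

Lemma mxcvgZ m n (c_ : nat -> R) (A_ : nat -> 'M[R]_(m, n)) (c : R) A :
  c_ k @[k --> \oo] --> c -> mxcvg A_ A ->
  mxcvg (fun k => c_ k *: A_ k) (c *: A).
Proof.
move=> hc hA i j; rewrite mxE; under eq_fun do rewrite mxE.
exact: cvgM hc (hA _ _).
Qed.

Lemma mxcvgM m n p (A_ : nat -> 'M[R]_(m, n)) (B_ : nat -> 'M[R]_(n, p)) A B :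
  mxcvg A_ A -> mxcvg B_ B -> mxcvg (fun k => A_ k *m B_ k) (A *m B).
Proof.
move=> hA hB i j; rewrite mxE; under eq_fun do rewrite mxE.
by apply: cvg_sumr => l; exact: cvgM (hA _ _) (hB _ _).
Qed.

Lemma mxcvg_tr m n (A_ : nat -> 'M[R]_(m, n)) A :
  mxcvg A_ A -> mxcvg (fun k => (A_ k)^T) A^T.
Proof. by move=> hA i j; rewrite mxE; under eq_fun do rewrite mxE; exact: hA. Qed.

Lemma mxcvg_trace n (A_ : nat -> 'M[R]_n) A :
  mxcvg A_ A -> \tr (A_ k) @[k --> \oo] --> \tr A.
Proof. by move=> hA; exact: cvg_sumr. Qed.

Lemma mxcvg_det n (A_ : nat -> 'M[R]_n) A :
  mxcvg A_ A -> \det (A_ k) @[k --> \oo] --> \det A.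
Proof.
move=> hA; apply: cvg_sumr => s; apply: cvgM; first exact: cvg_cst.
by apply: cvgn_prod => i.
Qed.

Lemma mxcvg_std_dot n (u_ v_ : nat -> 'rV[R]_n) u v :
  mxcvg u_ u -> mxcvg v_ v ->
  std_dot (u_ k) (v_ k) @[k --> \oo] --> std_dot u v.
Proof. by move=> hu hv; exact: (mxcvgM hu (mxcvg_tr hv)). Qed.

Lemma mxcvg_dirmx n (u_ : nat -> 'rV[R]_n) u : u != 0 ->
  mxcvg u_ u -> mxcvg (fun k => dirmx (u_ k)) (dirmx u).
Proof.
move=> u0 hu; apply: mxcvgZ; last exact: mxcvgM (mxcvg_tr hu) hu.
by apply: cvgV; [rewrite sqn_eq0|exact: mxcvg_std_dot].
Qed.

Lemma increasing_seq_cvg (f : nat -> nat) : {mono f : n m / (n <= m)%N} ->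
  f k @[k --> \oo] --> \oo.
Proof.
move=> incf; have ge_f k : (k <= f k)%N.
  elim: k => // k ih; apply: leq_ltn_trans ih _.
  by rewrite ltnNge incf -ltnNge.
by apply/cvgnyPge => A; exists A => // k /= Ak; exact: leq_trans (ge_f k).
Qed.

Lemma mx_bolzano_weierstrass m n (A_ : nat -> 'M[R]_(m, n)) (C : R) :
  (forall k i j, `|A_ k i j| <= C) ->
  exists2 f : nat -> nat, {mono f : n m / (n <= m)%N} &
    exists A, mxcvg (A_ \o f) A.
Proof.
move=> bA; suff [f incf [l fl]] : exists2 f : nat -> nat,
    {mono f : n m / (n <= m)%N} & exists l : 'I_m * 'I_n -> R,
    forall p, p \in enum {: 'I_m * 'I_n} -> A_ (f k) p.1 p.2 @[k --> \oo] --> l p.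
  exists f => //; exists (\matrix_(i, j) l (i, j)) => i j; rewrite mxE.
  by apply: (fl (i, j)); rewrite mem_enum.
(* One entry at a time: each step refines the previous subsequence, along which the entries already
   treated still converge. *)
elim: (enum _) => [|p s [f incf [l fl]]].
  by exists id => //; exists (fun=> 0).
have [|f' incf' /cvg_ex[/= a f'a]] :=
    @bolzano_weierstrass R (fun k => A_ (f k) p.1 p.2).
  by exists C; split; [exact: num_real|move=> x Cx k _; exact: le_trans (ltW Cx)].
exists (f \o f') => [n1 n2|]; first by rewrite /= incf -leEnat incf'.
exists (fun q => if q == p then a else l q) => q; rewrite inE.
case: eqVneq => [-> _ //|_ /= qs].
exact: (cvg_comp _ _ (increasing_seq_cvg (f := f') incf') (fl q qs)).
Qed.

Lemma tr_sumE n (A B : 'M[R]_n) : \tr (A *m B) = \sum_i \sum_j A i j * B j i.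
Proof. by apply: eq_bigr => i _; rewrite mxE. Qed.

Lemma det_bound n (A : 'M[R]_n) (C : R) :
  (forall i j, `|A i j| <= C) -> `|\det A| <= (n`!)%:R * C ^+ n.
Proof.
move=> bA; rewrite /determinant (le_trans (ler_norm_sum _ _ _))//.
rewrite (@le_trans _ _ (\sum_(s : 'S_n) C ^+ n))//; last first.
  by rewrite sumr_const card_Sn mulr_natl.
apply: ler_sum => s _; rewrite normrM normrX normrN1 expr1n mul1r normr_prod.
rewrite -[n in C ^+ n]card_ord -prodr_const; apply: ler_prod => i _.
by rewrite normr_ge0 bA.
Qed.

End MatrixSequences.

(** * Measurable fields of lines and their averages *)

Section DirectionField.
Context d (T : measurableType d) (R : realType) (P : probability T R).
Context (D : set T) (mD : measurable D).

(** Measurability is asked of the lines, through their projections, and not of the representative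
    vectors. *)
Definition dirmeas m (x : T -> 'rV[R]_m) :=
  (forall t, D t -> x t != 0) /\
  forall i j, measurable_fun D (fun t => dirmx (x t) i j).

Definition avg m (x : T -> 'rV[R]_m) : 'M[R]_m :=
  \matrix_(i, j) \int[P]_(t in D) dirmx (x t) i j.

Context (m : nat).
Implicit Types (x : T -> 'rV[R]_m).

Lemma dirmeas_bdd x i j : dirmeas x -> bdd_meas D (fun t => dirmx (x t) i j).
Proof. by case=> _ mx; split=> //; exists 1 => t _; exact: dirmx_le1. Qed.

Lemma dirmeas_tr x (A : 'M[R]_m) : dirmeas x ->
  bdd_meas D (fun t => \tr (A *m dirmx (x t))).
Proof.
move=> mx; under eq_fun do rewrite tr_sumE.
apply: bdd_meas_sum => i; apply: bdd_meas_sum => j.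
by apply: bdd_measZ; exact: dirmeas_bdd.
Qed.

Lemma int_tr x (A : 'M[R]_m) : dirmeas x ->
  \int[P]_(t in D) \tr (A *m dirmx (x t)) = \tr (A *m avg x).
Proof.
move=> mx; rewrite tr_sumE; under eq_Rint do rewrite tr_sumE.
rewrite bdd_sum// => [|i]; last first.
  by apply: bdd_meas_sum => j; apply: bdd_measZ; exact: dirmeas_bdd.
apply: eq_bigr => i _; rewrite bdd_sum// => [|j]; last first.
  by apply: bdd_measZ; exact: dirmeas_bdd.
by apply: eq_bigr => j _; rewrite bddZ ?mxE//; exact: dirmeas_bdd.
Qed.

Lemma dirmx_meas n x (g : 'M[R]_(m, n)) i j : dirmeas x ->
  measurable_fun D (fun t => dirmx (x t *m g) i j).
Proof.
(* A quotient of two linear functions of [dirmx (x t)]; the inverse is written as a power, which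
   agrees with it on nonnegative numbers. *)
move=> mx; have E t : D t -> dirmx (x t *m g) i j =
    \tr (g *m g^T *m dirmx (x t)) `^ (-1) * \tr ((delta_mx j i : 'M[R]_n) *m g^T *m dirmx (x t) *m g).
  move=> Dt; rewrite dirmxM ?mx.1// mxE; congr (_ * _).
    rewrite mxtrace_mulC mulmxA powR_inv1// tr_dirmx_gram.
    by rewrite divr_ge0 ?sqn_ge0.
  rewrite -!mulmxA (mulmxA g^T) tr_sumE (bigD1 j)//= [X in _ + X]big1 ?addr0.
    rewrite (bigD1 i)//= [X in _ + X]big1 ?addr0 => [|k ki].
      by rewrite [delta_mx _ _ _ _]mxE !eqxx mul1r.
    by rewrite [delta_mx _ _ _ _]mxE (negPf ki) andbF mul0r.
  by move=> k kj; rewrite big1// => l _; rewrite [delta_mx _ _ _ _]mxE (negPf kj) mul0r.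
apply: eq_measurable_fun (fun t Dt => esym (E t (set_mem Dt))) _.
apply: measurable_funM.
  apply: (measurableT_comp (f := fun r : R => r `^ (-1))).
    exact: measurable_powR.
  exact: (dirmeas_tr _ mx).1.
under eq_fun do rewrite mxtrace_mulC mulmxA.
exact: (dirmeas_tr _ mx).1.
Qed.

Lemma dirmeasM x (g : 'M[R]_m) : g \in unitmx -> dirmeas x ->
  dirmeas (fun t => x t *m g).
Proof.
move=> gu mx; split=> [t Dt|i j]; last exact: dirmx_meas.
apply: contra (mx.1 t Dt) => /eqP xg0.
by rewrite -(mulmxK gu (x t)) xg0 mul0mx.
Qed.

(** A line lies in [W] iff its projection has trace 1 against the orthogonal projection [U^T *m U]
    onto [W]. *)
Lemma measurable_sub x n (W : 'M[R]_(n, m)) : dirmeas x ->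
  measurable (D `&` [set t | (x t <= W)%MS]).
Proof.
move=> mx; have [U [UU UW]] := orthonormal_rows W.
rewrite (_ : _ `&` _ =
    D `&` (fun t => \tr (U^T *m U *m dirmx (x t))) @^-1` [set 1]).
  by apply: (dirmeas_tr _ mx).1.
have E t : D t -> (x t <= W)%MS <-> \tr (U^T *m U *m dirmx (x t)) = 1.
  move=> Dt; rewrite -UW orthonormal_submx//.
  have := tr_dirmx_gram U^T (x t); rewrite trmxK => ->.
  have xx0 : std_dot (x t) (x t) != 0 by rewrite sqn_eq0 mx.1.
  by split=> [/eqP ->|/divr1_eq ->]; [exact: divff|].
by apply/seteqP; split => t [Dt /(E _ Dt)].
Qed.

Lemma tr_avg x : dirmeas x -> \tr (avg x) = fine (P D).
Proof.
move=> mx; rewrite -[avg x]mul1mx -int_tr//.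
rewrite (@eq_Rint _ _ _ _ _ _ (fun=> 1)) ?Rintegral_cst ?mul1r// => t Dt.
have := tr_dirmx_gram 1%:M (x t); rewrite trmx1 !mulmx1 => ->.
by rewrite divff// sqn_eq0 mx.1.
Qed.

End DirectionField.

(** * The Kempf-Ness function *)

Section Balance.
Context d (T : measurableType d) (R : realType) (P : probability T R).
Context (D : set T) (mD : measurable D) (m : nat).
Context (x : T -> 'rV[R]_m) (mx : dirmeas D x).
Implicit Types g h : 'M[R]_m.

Definition frob (g : 'M[R]_m) : R := \tr (g *m g^T).

Lemma frobE g : frob g = \sum_i \sum_j g i j ^+ 2.
Proof.
rewrite /frob tr_sumE; apply: eq_bigr => i _; apply: eq_bigr => j _.
by rewrite mxE.
Qed.

Lemma frob_ge0 g : 0 <= frob g.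
Proof.
by rewrite frobE; apply: sumr_ge0 => i _; apply: sumr_ge0 => j _; exact: sqr_ge0.
Qed.

Lemma frob_coord g i j : g i j ^+ 2 <= frob g.
Proof.
rewrite frobE (bigD1 i)//= (bigD1 j)//= -addrA lerDl addr_ge0//.
  by apply: sumr_ge0 => k _; exact: sqr_ge0.
by apply: sumr_ge0 => k _; apply: sumr_ge0 => l _; exact: sqr_ge0.
Qed.

Lemma frob_norm g i j : `|g i j| <= 1 + frob g.
Proof.
have := frob_coord g i j; rewrite -(real_normK (num_real (g i j))).
move: `|g i j| => a h; have := sqr_ge0 (a - 1); nra.
Qed.

Lemma frob_mul (y : 'rV[R]_m) g :
  std_dot (y *m g) (y *m g) <= std_dot y y * frob g.
Proof.
have cs (u v : 'rV[R]_m) : std_dot u v ^+ 2 <= std_dot u u * std_dot v v.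
  have [->|v0] := eqVneq v 0.
    by rewrite std_dot_sym !std_dot0l mulr0 expr0n.
  have vv : 0 < std_dot v v by rewrite sqn_gt0.
  have := sqn_ge0 (std_dot v v *: u - std_dot u v *: v).
  rewrite std_dotDl !std_dotDr !std_dotNl !std_dotNr !std_dotZl !std_dotZr.
  rewrite (std_dot_sym v u); nra.
rewrite [leLHS]std_dotE /frob mxtrace_mulC tr_sumE mulr_sumr.
apply: ler_sum => j _; rewrite -expr2.
have := cs y (\row_i g i j); rewrite [std_dot y _]std_dotE [std_dot (\row__ _) _]std_dotE.
rewrite mxE (eq_bigr (fun i => y 0 i * g i j)) => [|i _]; last by rewrite mxE.
move=> /le_trans; apply; rewrite ler_wpM2l ?sqn_ge0// ler_sum// => i _.
by rewrite !mxE.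
Qed.

Definition qf (g : 'M[R]_m) t := \tr (g *m g^T *m dirmx (x t)).

Lemma qfE g t : qf g t = std_dot (x t *m g) (x t *m g) / std_dot (x t) (x t).
Proof. exact: tr_dirmx_gram. Qed.

Lemma xx_gt0 t : D t -> 0 < std_dot (x t) (x t).
Proof. by move=> Dt; rewrite sqn_gt0 mx.1. Qed.

(** A bound for |g^-1|^2 when det g = 1 and the entries of g are at most [C]: the inverse is then
    the adjugate, whose m^2 cofactors are at most (m-1)! C^(m-1) in absolute value. *)
Definition invbound C : R := (m * m)%:R * (((m.-1)`!)%:R * C ^+ m.-1) ^+ 2.

Lemma frob_adj g C : 0 <= C -> (forall i j, `|g i j| <= C) ->
  frob (\adj g) <= invbound C.
Proof.
move=> C0 gC; rewrite frobE (le_trans (_ : _ <= \sum_(i < m) \sum_(j < m)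
    (((m.-1)`!)%:R * C ^+ m.-1) ^+ 2))//; last first.
  by rewrite /invbound !sumr_const !card_ord -mulrnA -[leLHS]mulr_natl.
apply: ler_sum => i _; apply: ler_sum => j _; rewrite mxE /cofactor.
rewrite exprMn sqrr_sign mul1r -real_normK ?num_real// lerXn2r ?nnegrE//.
  by rewrite mulr_ge0 ?ler0n ?exprn_ge0.
by apply: det_bound => k l; rewrite !mxE.
Qed.

Lemma qf_le g t : D t -> qf g t <= frob g.
Proof. by move=> Dt; rewrite qfE ler_pdivrMr ?xx_gt0// mulrC frob_mul. Qed.

Lemma qf_ge g C t : D t -> 0 <= C -> (forall i j, `|g i j| <= C) ->
  \det g = 1 -> 1 <= invbound C * qf g t.
Proof.
move=> Dt C0 gC g1; rewrite qfE mulrA ler_pdivlMr ?xx_gt0// mul1r.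
have E : x t *m g *m \adj g = x t by rewrite -mulmxA mul_mx_adj g1 mulmx1.
rewrite -[in leLHS]E (le_trans (frob_mul _ _))// mulrC ler_wpM2r ?sqn_ge0//.
exact: frob_adj.
Qed.

Lemma qf_ge0 g t : 0 <= qf g t.
Proof. by rewrite qfE divr_ge0 ?sqn_ge0. Qed.

Lemma qf_gt0 g t : D t -> \det g = 1 -> 0 < qf g t.
Proof.
move=> Dt g1; rewrite lt0r qf_ge0 andbT; apply/eqP => q0.
have := qf_ge Dt (_ : 0 <= 1 + frob g) (frob_norm g) g1.
by rewrite q0 mulr0 ler10 addr_ge0 ?frob_ge0// => /(_ isT).
Qed.

Definition lnq g t : R := ln (qf g t).

Lemma lnq_meas g : measurable_fun D (lnq g).
Proof.
apply: (measurableT_comp (f := @ln R)); first exact: measurable_ln.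
exact: (dirmeas_tr _ mx).1.
Qed.

Lemma lnq_ge g C t : D t -> 0 <= C -> (forall i j, `|g i j| <= C) ->
  \det g = 1 -> - ln (invbound C) <= lnq g t.
Proof.
move=> Dt C0 gC g1; have q0 := qf_gt0 Dt g1; have q1 := qf_ge Dt C0 gC g1.
have i0 : 0 < invbound C.
  by rewrite -(pmulr_lgt0 _ q0); exact: lt_le_trans q1.
rewrite -lnV ?posrE// ler_ln ?posrE ?invr_gt0//.
by rewrite -[leLHS]mulr1 mulrC ler_pdivrMr// mulrC.
Qed.

Lemma lnq_le g t : D t -> \det g = 1 -> lnq g t <= frob g.
Proof.
move=> Dt g1; have q0 := qf_gt0 Dt g1.
by rewrite (le_trans _ (qf_le g Dt))// ltW// ln_sublinear.
Qed.

Lemma lnq_bound g C t : D t -> 0 <= C -> (forall i j, `|g i j| <= C) ->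
  \det g = 1 -> `|lnq g t| <= (m * m)%:R * C ^+ 2 + `|ln (invbound C)|.
Proof.
move=> Dt C0 gC g1; rewrite ler_norml; apply/andP; split.
  have /(le_trans _)-> // := lnq_ge Dt C0 gC g1.
  have := ler_norm (ln (invbound C)).
  have : 0 <= (m * m)%:R * C ^+ 2 by rewrite mulr_ge0 ?ler0n ?exprn_ge0.
  lra.
have h : frob g <= (m * m)%:R * C ^+ 2.
  rewrite frobE (le_trans (_ : _ <= \sum_(i < m) \sum_(j < m) C ^+ 2))//.
    apply: ler_sum => i _; apply: ler_sum => j _.
    by rewrite -real_normK ?num_real// lerXn2r ?nnegrE.
  by rewrite !sumr_const !card_ord -mulrnA -[leLHS]mulr_natl.
rewrite (le_trans (lnq_le Dt g1))// (le_trans h)// lerDl//.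
Qed.

Lemma lnq_bdd g : \det g = 1 -> bdd_meas D (lnq g).
Proof.
move=> g1; split; first exact: lnq_meas.
eexists => t Dt; apply: lnq_bound (frob_norm g) g1 => //.
by rewrite addr_ge0 ?frob_ge0.
Qed.

(* The Kempf-Ness function of the field; the second term makes it coercive on
   det g = 1. *)
Definition energy (e : R) g : R := \int[P]_(t in D) lnq g t + e * frob g.

(** By [lnq_ge] the logarithm costs at most a multiple of ln (1 + frob g) plus a constant, which
    half of the term [e * frob g] absorbs. *)
Lemma energy_coercive e : 0 < e -> exists2 K : R, 0 < K &
  forall g, \det g = 1 -> e / 2 * frob g <= energy e g + K.
Proof.
move=> e0; pose A : R := (m * m)%:R * ((m.-1)`!)%:R ^+ 2.
pose p : R := (m.-1 * 2)%:R + 1; have p0 : 0 < p by rewrite ltr_wpDl ?ltr01.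
(* [p] exceeds the degree of [invbound]; applying ln y <= y to y = dl (1 + N) leaves the slope
   [p * dl], which is [e / 2]. *)
pose dl := e / 2 / p; have dl0 : 0 < dl by rewrite !divr_gt0.
pose K := `|ln A| + p * `|ln dl| + e / 2 + 1.
exists K => [|g g1]; first by rewrite ltr_wpDl ?ltr01// !addr_ge0 ?mulr_ge0 ?divr_ge0// ltW.
set N := frob g; have N0 : 0 <= N by exact: frob_ge0.
have invE : invbound (1 + N) = A * (1 + N) ^+ (m.-1 * 2).
  by rewrite /invbound exprMn mulrA -exprM.
have low t : D t -> - (`|ln A| + p * `|ln dl| + e / 2 * (1 + N)) <= lnq g t.
  move=> Dt; apply: le_trans (lnq_ge Dt (_ : 0 <= 1 + N) (frob_norm g) g1); last by rewrite addr_ge0.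
  rewrite lerN2.
  have i0 : 0 < invbound (1 + N).
    rewrite -(pmulr_lgt0 _ (qf_gt0 Dt g1)); apply: lt_le_trans ltr01 _.
    by apply: qf_ge => //; [rewrite addr_ge0|exact: frob_norm].
  have n1 : 0 < 1 + N by rewrite ltr_pwDl.
  have A0 : 0 < A by move: i0; rewrite invE pmulr_lgt0// exprn_gt0.
  rewrite invE lnM ?posrE ?exprn_gt0// lnXn// -addrA lerD ?ler_norm//.
  have h1 : ln (1 + N) <= dl * (1 + N) + `|ln dl|.
    have := ln_sublinear (mulr_gt0 dl0 n1); rewrite lnM ?posrE//.
    have := ler_norm (- ln dl); rewrite normrN; lra.
  have h2 : (m.-1 * 2)%:R * ln (1 + N) <= p * ln (1 + N).
    by rewrite ler_wpM2r ?ln_ge0 ?lerDl.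
  rewrite -[X in X <= _]mulr_natl (le_trans h2)// (le_trans (ler_wpM2l (ltW p0) h1))//.
  by rewrite mulrDr addrC mulrA [p * dl]mulrC divfK// gt_eqF.
have := @bdd_le _ _ _ P _ mD _ _ (bdd_meas_cst _ _) (lnq_bdd g1) low.
rewrite Rintegral_cst// /energy -/N.
have := fine_prob_le1 P mD; have : 0 <= fine (P D) by rewrite fine_ge0.
move: (fine (P D)) (\int[P]_(t in D) _) => mu I mu0 mu1.
have a0 : 0 <= `|ln A| + p * `|ln dl| + e / 2 * (1 + N).
  by rewrite !addr_ge0 ?mulr_ge0 ?divr_ge0 ?addr_ge0 ?ler01// ltW.
rewrite /K; nra.
Qed.

Lemma energy_cvg e (g_ : nat -> 'M[R]_m) g C : (forall k, \det (g_ k) = 1) ->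
  (forall k i j, `|g_ k i j| <= C) -> mxcvg g_ g -> \det g = 1 ->
  energy e (g_ k) @[k --> \oo] --> energy e g.
Proof.
move=> g1 gC hg hg1; apply: cvgD; last first.
  apply: cvgM; first exact: cvg_cst.
  apply: (mxcvg_trace (A_ := fun k => g_ k *m (g_ k)^T)).
  by apply: (mxcvgM hg); exact: mxcvg_tr.
pose C' := `|C| + 1.
have gC' k i j : `|g_ k i j| <= C'.
  by rewrite (le_trans (gC k i j))// /C'; have := ler_norm C; lra.
have C'0 : 0 <= C' by rewrite addr_ge0.
apply: (bdd_cvg mD (M := (m * m)%:R * C' ^+ 2 + `|ln (invbound C')|)).
- by move=> k; exact: lnq_meas.
- by move=> k t Dt; exact: lnq_bound.
- move=> t Dt; apply: continuous_cvg; first exact: continuous_ln (qf_gt0 Dt hg1).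
  apply: (mxcvg_trace (A_ := fun k => g_ k *m (g_ k)^T *m dirmx (x t))).
  apply: mxcvgM; last exact: mxcvg_cst.
  by apply: (mxcvgM hg); exact: mxcvg_tr.
- exact: lnq_meas.
Qed.

(** Direct method: coercivity bounds a minimising sequence, and det g = 1 is a closed condition. *)
Lemma energy_min e : 0 < e ->
  exists2 g, \det g = 1 & forall h, \det h = 1 -> energy e g <= energy e h.
Proof.
move=> e0; have [K K0 coer] := energy_coercive e0.
pose S := [set energy e g | g in [set g | \det g = 1]].
have hS : has_inf S.
  split; first by exists (energy e 1%:M), 1%:M => //=; rewrite det1.
  exists (- K) => _ [g g1 <-]; have := coer g g1.
  have : 0 <= e / 2 * frob g by rewrite mulr_ge0 ?frob_ge0// divr_ge0 ?ltW.
  lra.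
have /choice[g_ hg_] (k : nat) : exists g, \det g = 1 /\ energy e g < inf S + k.+1%:R^-1.
  have [|_ [g g1 <-] lt] := inf_adherent (_ : 0 < k.+1%:R^-1 :> R) hS.
    by rewrite invr_gt0.
  by exists g.
pose N := (inf S + 1 + K) / (e / 2).
have [|f incf [g hg]] := mx_bolzano_weierstrass (A_ := g_) (C := 1 + N).
  move=> k i j; rewrite (le_trans (frob_norm _ _ _))// lerD2l.
  rewrite /N ler_pdivlMr ?divr_gt0// mulrC (le_trans (coer _ (hg_ k).1))//.
  rewrite lerD2r (le_trans (ltW (hg_ k).2))// lerD2l invf_le1 ?ler1n//.
have hg1 : \det g = 1.
  have := mxcvg_det hg; under eq_fun do rewrite /= (hg_ _).1.
  by move/cvg_lim => <- //; rewrite lim_cst.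
exists g => // h h1.
have hE : energy e ((g_ \o f) k) @[k --> \oo] --> energy e g.
  apply: (energy_cvg (C := 1 + N)) => // [k|k i j]; first exact: (hg_ _).1.
  rewrite (le_trans (frob_norm _ _ _))// lerD2l.
  rewrite /N ler_pdivlMr ?divr_gt0// mulrC (le_trans (coer _ (hg_ (f k)).1))//.
  by rewrite lerD2r (le_trans (ltW (hg_ (f k)).2))// lerD2l invf_le1 ?ler1n.
apply: (@le_trans _ _ (inf S)); last by apply: inf_lbound => //; [exact: hS.2|exists h].
have hI : inf S + (f k).+1%:R^-1 @[k --> \oo] --> inf S.
  rewrite -[X in _ --> X]addr0; apply: cvgD; first exact: cvg_cst.
  exact: (cvg_comp _ _ (increasing_seq_cvg incf) (@cvg_harmonic R)).
apply: ler_cvg_to hE hI _.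
by near=> k; exact/ltW/(hg_ _).2.
Unshelve. all: by end_near. Qed.

End Balance.

(** * First variation of the energy *)

Section Critical.
Context d (T : measurableType d) (R : realType) (P : probability T R).
Context (D : set T) (mD : measurable D) (m : nat).
Context (x : T -> 'rV[R]_m) (mx : dirmeas D x).
Implicit Types g h : 'M[R]_m.

Lemma quad_lin0 (a b : R) : (forall t, 0 <= t * a + t ^+ 2 * b) -> a = 0.
Proof.
move=> H; have b0 : 0 < `|b| + 1 by rewrite ltr_wpDl.
have := H (- a / (`|b| + 1)); have := ler_norm b => lb.
have -> : - a / (`|b| + 1) * a + (- a / (`|b| + 1)) ^+ 2 * b =
  - (a / (`|b| + 1)) ^+ 2 * (`|b| + 1 - b) by field; rewrite gt_eqF.
rewrite mulNr oppr_ge0 pmulr_lle0 ?subr_gt0; last by lra.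
by rewrite le_eqVlt ltNge sqr_ge0 orbF expf_eq0 mulf_eq0 invr_eq0 (gt_eqF b0) orbF /= => /eqP.
Qed.

(** The orthogonal pairs e_i, e_j make [S] diagonal; the pairs e_i + e_j, e_i - e_j make its
    diagonal constant. *)
Lemma scalar_of_orth (S : 'M[R]_m) : S^T = S ->
  (forall u v : 'rV_m, std_dot u v = 0 -> std_dot (v *m S) u = 0) ->
  S = (\tr S / m%:R)%:M.
Proof.
move=> symS H; have off i j : i != j -> S i j = 0.
  move=> ij; have := H (delta_mx 0 j) (delta_mx 0 i).
  rewrite std_dot_delta -rowE std_dot_delta !mxE (negPf ij) andbF.
  exact.
have dia i j : S i i = S j j.
  have [->//|ij] := eqVneq i j.
  have ijF := negPf ij; have jiF : (j == i) = false by rewrite eq_sym.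
  have uv : std_dot (delta_mx 0 i + delta_mx 0 j)
                    (delta_mx 0 i - delta_mx 0 j : 'rV[R]_m) = 0.
    rewrite !(std_dotDl, std_dotDr, std_dotNl, std_dotNr) !std_dot_delta !mxE.
    by rewrite !eqxx ijF jiF /= ?mulr0n ?mulr1n; ring.
  have := H _ _ uv; rewrite mulmxBl -!rowE.
  rewrite !(std_dotDl, std_dotDr, std_dotNl, std_dotNr) !std_dot_delta !mxE.
  by rewrite (off i j)// (off j i) 1?eq_sym// => h; lra.
apply/matrixP => i j; rewrite mxE; have [->|/off//] := eqVneq i j.
rewrite mulr1n /mxtrace (eq_bigr (fun=> S j j)) => [|k _]; last exact: dia.
rewrite sumr_const card_ord -[S j j *+ m]mulr_natr mulfK// pnatr_eq0.
by case: (m) j => [[]|].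
Qed.

Lemma frob_rank1 g (w v : 'rV[R]_m) : frob (g + w^T *m v) =
  frob g + std_dot (v *m g^T) w *+ 2 + std_dot w w * std_dot v v.
Proof.
rewrite /frob linearD /= trmx_mul trmxK mulmxDl !mulmxDr !mxtraceD.
have -> : \tr (w^T *m v *m g^T) = std_dot (v *m g^T) w.
  by rewrite -mulmxA mxtrace_mulC [LHS]big_ord1.
have -> : \tr (g *m (v^T *m w)) = std_dot (v *m g^T) w.
  rewrite -mxtrace_tr !trmx_mul trmxK -mulmxA mxtrace_mulC [LHS]big_ord1 //.
have -> : \tr (w^T *m v *m (v^T *m w)) = std_dot w w * std_dot v v.
  rewrite mxtrace_mulC -mulmxA (mulmxA w) (mx11_scalar (w *m w^T)) mul_scalar_mx.
  by rewrite -scalemxAr mxtraceZ mxtrace_mulC [\tr _]big_ord1.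
by ring.
Qed.

(* First variation along the shears [1 + s u^T v] with [u] and [v] orthogonal,
   which preserve the determinant. *)
Lemma energy_critical e g : \det g = 1 ->
  (forall h, \det h = 1 -> energy P D x e g <= energy P D x e h) ->
  avg P D (fun t => x t *m g) =
    (fine (P D) / m%:R)%:M + e *: ((frob g / m%:R)%:M - g^T *m g).
Proof.
move=> g1 gmin; set y := fun t => x t *m g.
have gu : g \in unitmx by rewrite unitmxE g1 unitr1.
have my : dirmeas D y by exact: dirmeasM.
set M := avg P D y; pose S := M + e *: (g^T *m g).
have symM : M^T = M.
  apply/matrixP => i j; rewrite !mxE; apply: eq_Rint => t _.
  by rewrite !dirmxE [in LHS]mulrAC [in RHS]mulrAC [in RHS]mulrC mulrA mulrAC.
have orth (u v : 'rV_m) : std_dot u v = 0 -> std_dot (v *m S) u = 0.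
  (* [s * a + s ^+ 2 * b] will bound from above the change of energy along the shear of parameter
     [s]; by minimality it is nonnegative for every [s]. *)
  move=> uv; pose a := std_dot (v *m S) u *+ 2.
  pose b := std_dot v v * \tr (u^T *m u *m M) +
            e * (std_dot (u *m g^T) (u *m g^T) * std_dot v v).
  suff : a = 0 by move=> /eqP; rewrite mulrn_eq0 => /eqP.
  apply: (@quad_lin0 a b) => s.
  pose N := 1%:M + (s *: u)^T *m v.
  have N1 : \det N = 1 by rewrite det_rank1 std_dotZr std_dot_sym uv mulr0 addr0.
  have gN1 : \det (g *m N) = 1 by rewrite det_mulmx g1 N1 mulr1.
  have := gmin _ gN1; rewrite -subr_ge0 => /le_trans; apply.
  have yN t : y t *m N = y t + (s * std_dot (y t) u) *: v.
    rewrite mulmxDr mulmx1 mulmxA (mx11_scalar (y t *m (s *: u)^T)).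
    by rewrite mul_scalar_mx -/(std_dot _ _) std_dotZr.
  (* The inequality ln (1 + z) <= z yields the linear term and a quadratic remainder, so nothing is
     differentiated under the integral. *)
  have I1 : \int[P]_(t in D) lnq x (g *m N) t - \int[P]_(t in D) lnq x g t <=
      2 * s * \tr (u^T *m v *m M) + s ^+ 2 * (std_dot v v * \tr (u^T *m u *m M)).
    rewrite -bddB//; [|exact: lnq_bdd..].
    have b1 := dirmeas_tr (u^T *m v) my; have b2 := dirmeas_tr (u^T *m u) my.
    rewrite -!int_tr// mulrA -!bddZ// -bddD//; [|exact: bdd_measZ..].
    apply: bdd_le => //; first by apply: bdd_measB; exact: lnq_bdd.
      by apply: bdd_measD; exact: bdd_measZ.
    move=> t Dt; have q1 := qf_gt0 mx Dt g1; have q2 := qf_gt0 mx Dt gN1.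
    rewrite /lnq -ln_div ?posrE//.
    have E : qf x (g *m N) t / qf x g t = 1 + (2 * s * \tr (u^T *m v *m dirmx (y t)) +
        s ^+ 2 * std_dot v v * \tr (u^T *m u *m dirmx (y t))).
      have yy : std_dot (y t) (y t) != 0 by rewrite sqn_eq0 my.1.
      have xx : std_dot (x t) (x t) != 0 by rewrite sqn_eq0 mx.1.
      rewrite !qfE mulmxA -/(y t) yN !tr_dirmx_cross.
      rewrite !(std_dotDl, std_dotDr, std_dotZl, std_dotZr) (std_dot_sym v).
      by field; rewrite xx yy.
    by rewrite E; apply: le_ln1Dx; rewrite -subr_gt0 opprK addrC -E divr_gt0.
  have F1 : frob (g *m N) = frob g + s * (std_dot (v *m (g^T *m g)) u *+ 2) +
      s ^+ 2 * (std_dot (u *m g^T) (u *m g^T) * std_dot v v).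
    have -> : g *m N = g + (s *: (u *m g^T))^T *m v.
      by rewrite mulmxDr mulmx1 !linearZ /= trmx_mul trmxK mulmxA -scalemxAr.
    have -> : std_dot (v *m (g^T *m g)) u = std_dot (v *m g^T) (u *m g^T).
      by rewrite mulmxA std_dotMr.
    by rewrite frob_rank1 !std_dotZr !std_dotZl; ring.
  rewrite /energy F1 /a /b.
  have -> : std_dot (v *m S) u = \tr (u^T *m v *m M) + e * std_dot (v *m (g^T *m g)) u.
    rewrite mulmxDr std_dotDl -scalemxAr std_dotZl; congr (_ + _).
    by rewrite -mulmxA mxtrace_mulC [RHS]big_ord1.
  move: I1; move: (\int[P]_(t in D) lnq x (g *m N) t).
  move: (\int[P]_(t in D) lnq x g t) (\tr (u^T *m v *m M)) (\tr (u^T *m u *m M)).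
  move: (std_dot (v *m (g^T *m g)) u) (std_dot (u *m g^T) (u *m g^T)).
  move: (std_dot v v) (frob g) {gmin} => z1 z2 z3 z4 z5 z6 z7 z8; clear; lra.
have symS : S^T = S by rewrite linearD linearZ /= symM trmx_mul trmxK.
have := scalar_of_orth symS orth.
rewrite {2}/S mxtraceD mxtraceZ [\tr (g^T *m g)]mxtrace_mulC -/(frob g) /M tr_avg// -/M.
move/(canRL (addrK _)) => ->.
rewrite scalerBr addrA; congr (_ - _).
by rewrite mulrDl raddfD /= -mulrA scale_scalar_mx.
Qed.

End Critical.

(** * Balancing under the strict inequalities *)

Section Existence.
Context d (T : measurableType d) (R : realType) (P : probability T R).
Context (D : set T) (mD : measurable D) (m : nat).
Context (x : T -> 'rV[R]_m) (mx : dirmeas D x).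
Implicit Types g h : 'M[R]_m.

Lemma avg_scale (y : T -> 'rV[R]_m) (c : T -> R) : (forall t, D t -> c t != 0) ->
  avg P D (fun t => c t *: y t) = avg P D y.
Proof.
move=> c0; apply/matrixP => i j; rewrite !mxE; apply: eq_Rint => t Dt.
by rewrite dirmxZ// c0.
Qed.

Lemma avg_cvg (h_ : nat -> 'M[R]_m) h : mxcvg h_ h -> \det h != 0 ->
  mxcvg (fun k => avg P D (fun t => x t *m h_ k)) (avg P D (fun t => x t *m h)).
Proof.
move=> hh h0 i j; rewrite mxE; under eq_fun do rewrite mxE.
have hu : h \in unitmx by rewrite unitmxE unitfE.
apply: (bdd_cvg mD (M := 1)) => [k|k t _|t Dt|].
- exact: dirmx_meas.
- exact: dirmx_le1.
- have xh0 := (dirmeasM hu mx).1 t Dt.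
  by apply: (mxcvg_dirmx xh0); apply: (mxcvgM _ hh); exact: mxcvg_cst.
- exact: dirmx_meas.
Qed.

(* The mass on a proper subspace [ker h] dominates the part of the averages of
   [x h_k] transverse to the image of the singular limit [h]. *)
Lemma avg_singular (h_ : nat -> 'M[R]_m) h w (U : 'M[R]_(w, m)) (b : R) :
  (forall k, \det (h_ k) != 0) -> mxcvg h_ h ->
  U *m U^T = 1%:M -> h *m U^T = 0 ->
  (\forall k \near \oo, b <= \tr (U^T *m U *m avg P D (fun t => x t *m h_ k))) ->
  b <= fine (P (D `&` [set t | (x t <= kermx h)%MS])).
Proof.
move=> h_0 hh UU hU hb.
have mW := measurable_sub mD (kermx h) mx.
have h_u k : h_ k \in unitmx by rewrite unitmxE unitfE.
have mxk k := dirmeasM (h_u k) mx.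
pose f k t := \tr (U^T *m U *m dirmx (x t *m h_ k)).
have fE k t : f k t =
    std_dot (x t *m h_ k *m U^T) (x t *m h_ k *m U^T) / std_dot (x t *m h_ k) (x t *m h_ k).
  by have := tr_dirmx_gram U^T (x t *m h_ k); rewrite trmxK.
have f0 k t : 0 <= f k t by rewrite fE divr_ge0 ?sqn_ge0.
have f1 k t : D t -> f k t <= 1.
  move=> Dt; rewrite fE ler_pdivrMr ?sqn_gt0 ?(mxk k).1// mul1r.
  exact: orthonormal_bessel.
set W := D `&` _ in mW *.
(* [F] majorises [f] on [D] and is 1 on [W]. Off [W] it tends to 0, since x h is nonzero there and
   orthogonal to the rows of [U]; so its limit is the indicator of [W]. *)
pose F k t := f k t * \1_(~` W) t + \1_W t : R.
have bf k : bdd_meas D (f k) := dirmeas_tr _ (mxk k).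
have bF k : bdd_meas D (F k).
  apply: bdd_measD; last exact: bdd_meas_indic.
  by apply: bdd_measM => //; apply: bdd_meas_indic; exact: measurableC.
have WE t : W t -> \1_W t = 1 :> R /\ \1_(~` W) t = 0 :> R.
  by move=> Wt; rewrite !indicE mem_set//= memNset//=; apply.
have WN t : ~ W t -> \1_W t = 0 :> R /\ \1_(~` W) t = 1 :> R.
  by move=> Wt; rewrite !indicE memNset//= mem_set.
have Fc : \int[P]_(t in D) F k t @[k --> \oo] --> \int[P]_(t in D) (\1_W t : R).
  apply: (bdd_cvg mD (M := 1)) => [k|k t Dt|t Dt|]; first exact: (bF k).1.
  - rewrite /F; have [/WE[-> ->]|/WN[-> ->]] := pselect (W t).
      by rewrite mulr0 add0r normr1.
    by rewrite addr0 mulr1 ger0_norm ?f1.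
  - have [Wt|Wt] := pselect (W t).
      have [E1 E2] := WE t Wt; rewrite E1 /F; under eq_fun do rewrite E1 E2 mulr0 add0r.
      exact: cvg_cst.
    have [E1 E2] := WN t Wt; rewrite E1 /F; under eq_fun do rewrite E1 E2 mulr1 addr0.
    have xh0 : x t *m h != 0.
      by apply/negP => /eqP xh; apply: Wt; split => //=; exact/sub_kermxP.
    rewrite (_ : 0 = \tr (U^T *m U *m dirmx (x t *m h))).
      apply: (mxcvg_trace (A_ := fun k => U^T *m U *m dirmx (x t *m h_ k))).
      apply: mxcvgM; first exact: mxcvg_cst.
      by apply: mxcvg_dirmx => //; apply: (mxcvgM _ hh); exact: mxcvg_cst.
    have := tr_dirmx_gram U^T (x t *m h); rewrite trmxK => ->.
    by rewrite -mulmxA hU mulmx0 std_dot0l mul0r.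
  - exact: measurable_indic.
rewrite Rint_indic// setIA setIid in Fc.
apply: (cvgr_to_ge Fc).
near=> k; rewrite (@le_trans _ _ (\tr (U^T *m U *m avg P D (fun t => x t *m h_ k))))//.
  by near: k.
rewrite -int_tr//; apply: (bdd_le P mD (bf k) (bF k)) => t Dt; rewrite /F.
have [/WE[-> ->]|/WN[-> ->]] := pselect (W t).
  by rewrite mulr0 add0r f1.
by rewrite mulr1 addr0.
Unshelve. all: by end_near. Qed.

Theorem strict_balanced (kp : R) :
  fine (P D) = kp * m%:R ->
  (forall W : 'M[R]_m, (0 < \rank W < m)%N ->
     fine (P (D `&` [set t | (x t <= W)%MS])) < kp * (\rank W)%:R) ->
  exists2 g, 0 < \det g & avg P D (fun t => x t *m g) = kp%:M.
Proof.
move=> Pm strict; have [m0|m0] := posnP m.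
  exists 1%:M; first by rewrite det1.
  by apply/matrixP => i; move: (leq_ltn_trans (leq0n i) (ltn_ord i)); rewrite {1}m0.
have mR : (m%:R : R) != 0 by rewrite pnatr_eq0 -lt0n.
pose e k : R := k.+1%:R^-1.
have /choice[g_ hg_] (k : nat) : exists g, \det g = 1 /\
    forall h, \det h = 1 -> energy P D x (e k) g <= energy P D x (e k) h.
  by have [|g g1 gm] := energy_min P mD mx (_ : 0 < e k); [rewrite invr_gt0|exists g].
pose N k := frob (g_ k).
have N0 k : 0 < N k.
  rewrite lt0r frob_ge0 andbT; apply/eqP => N0.
  have g0 : g_ k = 0.
    apply/matrixP => i j; rewrite mxE; apply/eqP; rewrite -sqrf_eq0.
    by rewrite eq_le sqr_ge0 andbT -N0 frob_coord.
  have := (hg_ k).1; rewrite g0 -(scale0r 1%:M) detZ expr0n eqn0Ngt m0 mul0r.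
  by move/eqP; rewrite eq_sym oner_eq0.
pose s k := Num.sqrt (N k); have s0 k : 0 < s k by rewrite sqrtr_gt0.
have ss k : s k ^+ 2 = N k by rewrite sqr_sqrtr// ltW.
pose h_ k := (s k)^-1 *: g_ k.
have hfrob k : frob (h_ k) = 1.
  rewrite /frob linearZ /= -scalemxAl -scalemxAr scalerA mxtraceZ -/(frob _).
  by rewrite -invfM -expr2 ss mulVf// gt_eqF.
(* Projections ignore the factor [(s k)^-1], so the critical equation of [g_ k] becomes one for
   [h_ k], with [N k] moved into the coefficient. *)
have hE k : avg P D (fun t => x t *m h_ k) =
    kp%:M + (e k * N k) *: (m%:R^-1%:M - (h_ k)^T *m h_ k).
  have -> : avg P D (fun t => x t *m h_ k) = avg P D (fun t => x t *m g_ k).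
    rewrite -(@avg_scale (fun t => x t *m g_ k) (fun=> (s k)^-1)) => [|t _].
      by congr avg; apply/funext => t; rewrite scalemxAr.
    by rewrite invr_neq0// gt_eqF.
  rewrite (energy_critical mD mx (hg_ k).1 (hg_ k).2) Pm mulfK//.
  have gg : N k *: ((h_ k)^T *m h_ k) = (g_ k)^T *m g_ k.
    have -> : (h_ k)^T = (s k)^-1 *: (g_ k)^T by rewrite linearZ.
    rewrite -scalemxAl -scalemxAr !scalerA -mulrA -invfM -expr2 ss.
    by rewrite mulfV ?scale1r// gt_eqF.
  by rewrite -scalerA [N k *: _]scalerBr gg scale_scalar_mx.
have [|f incf [h hh]] := mx_bolzano_weierstrass (A_ := h_) (C := 1).
  move=> k i j; rewrite -(ler_pXn2r (_ : 0 < 2)%N) ?nnegrE// real_normK ?num_real//.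
  by rewrite expr1n -(hfrob k) frob_coord.
have fc := increasing_seq_cvg incf.
have ec : e (f k) @[k --> \oo] --> (0 : R) := cvg_comp _ _ fc (@cvg_harmonic R).
have hdet k : \det (h_ k) = (s k)^-1 ^+ m by rewrite detZ (hg_ k).1 mulr1.
have dh0 k : 0 < \det (h_ k) by rewrite hdet exprn_gt0// invr_gt0 s0.
have dc := mxcvg_det hh.
have dh : 0 <= \det h.
  by apply: (cvgr_to_ge dc); apply: nearW => k; exact: ltW (dh0 (f k)).
(* Singular limit: h is nonzero because every [frob (h_ k)] is 1, so its kernel is a nonzero proper
   subspace. *)
have [hdet0|hdetN0] := eqVneq (\det h) 0.
  have rh : (\rank h < m)%N.
    rewrite ltn_neqAle rank_leq_row andbT -/(row_free h) row_free_unit unitmxE.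
    by rewrite hdet0 unitr0.
  have rh0 : (0 < \rank h)%N.
    rewrite lt0n mxrank_eq0; apply/eqP => h0.
    have := mxcvg_trace (mxcvgM hh (mxcvg_tr hh)).
    rewrite h0 mul0mx mxtrace0.
    under eq_fun do rewrite /= -/(frob _) hfrob.
    by move/cvg_lim => /(_ (@norm_hausdorff _ _)); rewrite lim_cst// => /eqP; rewrite oner_eq0.
  have [U [UU hU]] := orthonormal_ker h.
  pose w := (m - \rank h)%N; have w0 : (0 < w)%N by rewrite subn_gt0.
  have := strict (kermx h); rewrite mxrank_ker -/w w0 ltn_subrL rh0 m0 => /(_ isT).
  rewrite ltNge => /negP; case.
  apply: (avg_singular (h_ := h_ \o f) (U := U)) => // [k|].
    by rewrite /= gt_eqF.
  have hUc : \tr (U^T *m U *m ((h_ (f k))^T *m h_ (f k))) @[k --> \oo] --> (0 : R).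
    have -> : 0 = \tr (U^T *m U *m (h^T *m h)) :> R.
      rewrite -mulmxA (mulmxA U) (_ : U *m h^T = 0) ?mul0mx ?mulmx0 ?mxtrace0//.
      by apply/trmx_inj; rewrite trmx_mul trmxK hU trmx0.
    apply: (mxcvg_trace (A_ := fun k => U^T *m U *m ((h_ (f k))^T *m h_ (f k)))).
    apply: mxcvgM; first exact: mxcvg_cst.
    by apply: mxcvgM => //; exact: mxcvg_tr.
  (* Once the trace of [(h_ (f k))^T *m h_ (f k)] against [U^T *m U] is below w / m, the correction
     term is nonnegative whatever the size of its coefficient, and the average over these directions
     is at least kp w. *)
  have wm : 0 < w%:R / m%:R :> R by rewrite divr_gt0 ?ltr0n.
  have trU : \tr (U^T *m U) = w%:R by rewrite mxtrace_mulC UU mxtrace1.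
  apply: (filterS _ (cvgr_lt _ hUc _ wm)) => k /= kw.
  rewrite hE mulmxDr mxtraceD mul_mx_scalar mxtraceZ trU lerDl.
  rewrite -scalemxAr mxtraceZ mulr_ge0 ?mulr_ge0 ?invr_ge0//; first exact: ltW.
  rewrite mulmxBr raddfB /= mul_mx_scalar mxtraceZ trU subr_ge0 mulrC.
  exact: ltW.
exists h; first by rewrite lt0r hdetN0.
(* Invertible limit: the inverse of [\det (h_ k)] is [s k ^+ m], so the [s (f k)] stay bounded and
   the correction vanishes with [e]. *)
have tc : e (f k) * N (f k) @[k --> \oo] --> (0 : R).
  have ic : (\det (h_ (f k)))^-1 @[k --> \oo] --> (\det h)^-1 by exact: cvgV.
  have [K [Kr Kb]] := cvg_seq_bounded (cvgP _ ic).
  pose C := 1 + `|K + 1|.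
  have Nb k : N (f k) <= C ^+ 2.
    have C0 : 0 <= C by rewrite addr_ge0.
    have s0' := ltW (s0 (f k)); rewrite -ss ler_pXn2r ?nnegrE//.
    have [s1|s1] := leP (s (f k)) 1; first by rewrite (le_trans s1)// lerDl.
    have := Kb (K + 1) (_ : K < K + 1) k I.
    rewrite ltrDl ltr01 => /(_ isT) /=.
    rewrite hdet exprVn invrK ger0_norm ?exprn_ge0// => sK.
    rewrite (@le_trans _ _ (s (f k) ^+ m))//.
      by rewrite -{1}(expr1 (s (f k))) ler_eXn2l.
    by rewrite (le_trans sK)// (le_trans (ler_norm _))// lerDr.
  apply: (@squeeze_cvgr _ _ _ _ (fun=> 0) (fun k => e (f k) * C ^+ 2)).
  - apply: nearW => k; have e0 : 0 <= e (f k) by rewrite invr_ge0.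
    by rewrite mulr_ge0 ?(ltW (N0 _))//= ler_wpM2l.
  - exact: cvg_cst.
  - by rewrite -(mul0r (C ^+ 2)); apply: cvgM => //; exact: cvg_cst.
have hh2 : mxcvg (fun k => (m%:R^-1)%:M - (h_ (f k))^T *m h_ (f k))
    ((m%:R^-1)%:M - h^T *m h).
  apply: mxcvgD; first exact: mxcvg_cst.
  move=> i j; rewrite mxE; under eq_fun do rewrite mxE; apply: cvgN.
  exact: (mxcvgM (mxcvg_tr hh) hh).
have := mxcvgD (@mxcvg_cst _ _ _ kp%:M) (mxcvgZ tc hh2).
rewrite scale0r addr0 => c1; have c2 := avg_cvg hh hdetN0.
apply/matrixP => i j; have := c1 i j; under eq_fun do rewrite -hE.
by move=> c3; exact: (cvg_unique _ (c2 i j) c3).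
Qed.

End Existence.

(** * The largest eigenvalue of a symmetric matrix *)

Section Uniqueness.
Context (R : realType) (m : nat).

(** Moving a maximiser [v] along the residual [v *m S - l *: v] raises the form, relative to [l]
    times the squared norm, to first order by twice the squared norm of the residual, which must
    therefore vanish. *)
Lemma rayleigh_eq (S : 'M[R]_m) (l : R) (v : 'rV_m) : S^T = S ->
  (forall u : 'rV_m, std_dot (u *m S) u <= l * std_dot u u) ->
  std_dot (v *m S) v = l * std_dot v v -> v *m S = l *: v.
Proof.
move=> symS lmax vv.
have [w wE] : {w | w = v *m S - l *: v} by exists (v *m S - l *: v).
apply/eqP; rewrite -subr_eq0 -wE -sqn_eq0.
suff : std_dot w w *- 2 = 0 by move/eqP; rewrite oppr_eq0 mulrn_eq0.
apply: (@quad_lin0 _ _ (l * std_dot w w - std_dot (w *m S) w)) => t.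
have := lmax (v + t *: w); rewrite -subr_ge0; congr (0 <= _).
rewrite mulmxDl -scalemxAl !(std_dotDl, std_dotDr, std_dotZl, std_dotZr) vv.
have -> : std_dot (w *m S) v = std_dot (v *m S) w.
  by rewrite std_dotMr symS std_dot_sym.
have E : std_dot w w = std_dot (v *m S) w - l * std_dot v w.
  by rewrite {1}wE std_dotDl std_dotNl std_dotZl.
have -> : std_dot (v *m S) w = std_dot w w + l * std_dot v w by rewrite E subrK.
by rewrite (std_dot_sym w v) mulr2n; ring.
Qed.

Lemma sym_max_eigen (S : 'M[R]_m) : (0 < m)%N -> S^T = S ->
  exists l : R, (exists2 v : 'rV_m, v != 0 & v *m S = l *: v) /\
    forall u : 'rV_m, std_dot (u *m S) u <= l * std_dot u u.
Proof.
move=> m0 symS; pose q u := \tr (S *m dirmx u) : R.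
have qE u : q u = std_dot (u *m S) u / std_dot u u by rewrite /q tr_dirmx.
pose V := [set u : 'rV[R]_m | std_dot u u = 1].
pose Q := [set q u | u in V].
pose C : R := \sum_i \sum_j `|S i j|.
have qC u : q u <= C.
  rewrite /q tr_sumE; apply: ler_sum => i _; apply: ler_sum => j _.
  rewrite (le_trans (ler_norm _))// normrM ler_piMr//; exact: dirmx_le1.
have nrm (u : 'rV[R]_m) : u != 0 -> exists2 v, V v & dirmx v = dirmx u.
  rewrite -sqn_gt0 => u0; exists ((Num.sqrt (std_dot u u))^-1 *: u).
    rewrite /V /= std_dotZl std_dotZr mulrA -invfM -expr2 sqr_sqrtr ?ltW//.
    by rewrite mulVf// gt_eqF.
  by rewrite dirmxZ// invr_neq0// gt_eqF// sqrtr_gt0.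
have [v0 Vv0] : V !=set0.
  have [|v Vv _] := nrm (const_mx 1); last by exists v.
  apply/eqP => /matrixP /(_ 0 (Ordinal m0)) /eqP.
  by rewrite !mxE oner_eq0.
have hQ : has_sup Q by split; [exists (q v0), v0|exists C => _ [u _ <-]].
have /choice[v_ hv_] (k : nat) : exists v, V v /\ sup Q - k.+1%:R^-1 < q v.
  have [|_ [v Vv <-] lt] := sup_adherent (_ : 0 < k.+1%:R^-1 :> R) hQ.
    by rewrite invr_gt0.
  by exists v.
have [|f incf [v hv]] := mx_bolzano_weierstrass (A_ := v_) (C := 1).
  move=> k i j; rewrite ord1 -(ler_pXn2r (_ : 0 < 2)%N) ?nnegrE//.
  by rewrite real_normK ?num_real// expr1n -(hv_ k).1 sqn_coord.
have vv : std_dot v v = 1.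
  have := mxcvg_std_dot hv hv; under eq_fun do rewrite /= (hv_ _).1.
  by move/cvg_lim => <- //; rewrite lim_cst.
have v_n0 : v != 0 by rewrite -sqn_gt0 vv.
have hq : q ((v_ \o f) k) @[k --> \oo] --> q v.
  apply: (mxcvg_trace (A_ := fun k => S *m dirmx (v_ (f k)))).
  by apply: mxcvgM; [exact: mxcvg_cst|exact: mxcvg_dirmx].
have hs : sup Q - (f k).+1%:R^-1 @[k --> \oo] --> sup Q.
  rewrite -[X in _ --> X]subr0; apply: cvgB; first exact: cvg_cst.
  exact: (cvg_comp _ _ (increasing_seq_cvg incf) (@cvg_harmonic R)).
have sq : sup Q <= q v.
  by apply: ler_cvg_to hs hq _; apply: nearW => k; exact: ltW (hv_ (f k)).2.
have mxq u : std_dot (u *m S) u <= q v * std_dot u u.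
  have [->|u0] := eqVneq u 0; first by rewrite std_dot_sym !std_dot0l mulr0.
  rewrite -ler_pdivrMr ?sqn_gt0// -qE; apply: le_trans sq.
  by have [w Vw E] := nrm u u0; rewrite /q -E; apply: sup_upper_bound => //; exists w.
exists (q v); split => //; exists v => //.
have qv : std_dot (v *m S) v = q v by rewrite qE vv divr1.
by apply: rayleigh_eq => //; rewrite qE vv divr1 mulr1.
Qed.

End Uniqueness.

(** * Masses of subspaces under a balanced field *)

Section Balanced.
Context d (T : measurableType d) (R : realType) (P : probability T R).
Context (D : set T) (mD : measurable D) (m : nat) (kp : R).
Implicit Types (x y : T -> 'rV[R]_m) (g h W : 'M[R]_m).

Definition mass x W : R := fine (P (D `&` [set t | (x t <= W)%MS])).

Lemma mass_le_tr x w (U : 'M[R]_(w, m)) W : dirmeas D x ->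
  U *m U^T = 1%:M -> (U :=: W)%MS ->
  [/\ bdd_meas D (fun t => \tr (U^T *m U *m dirmx (x t))),
    forall t, D t -> \1_(D `&` [set t | (x t <= W)%MS]) t <=
      \tr (U^T *m U *m dirmx (x t)) &
    mass x W <= \tr (U^T *m U *m avg P D x)].
Proof.
move=> mx UU UW; have mW := measurable_sub mD W mx.
have bf := dirmeas_tr (U^T *m U) mx.
have le t : D t -> \1_(D `&` [set t | (x t <= W)%MS]) t <=
      \tr (U^T *m U *m dirmx (x t)).
  move=> Dt; have := tr_dirmx_gram U^T (x t); rewrite trmxK => ->.
  rewrite indicE; case: (boolP (t \in _)) => [/set_mem[_ /=]|_].
    rewrite -UW orthonormal_submx// => /eqP ->.
    by rewrite divff// sqn_eq0 mx.1.
  by rewrite divr_ge0 ?sqn_ge0.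
split => //; rewrite -int_tr// /mass -{1}(setIid D) -setIA.
by rewrite -Rint_indic//; apply: bdd_le => //; exact: bdd_meas_indic.
Qed.

(** The mass is at most the trace of the average against the projection onto [W], and this bound
    tolerates errors in the average. *)
Lemma mass_approx x W e : dirmeas D x ->
  (forall i j, `|avg P D x i j - kp *+ (i == j)| <= e) ->
  mass x W <= kp * (\rank W)%:R + (m * m * m.+1)%:R * e.
Proof.
move=> mx he; have [U [UU UW]] := orthonormal_rows W.
have [_ _] := mass_le_tr mx UU UW; move/le_trans; apply.
rewrite -[avg P D x](subrK kp%:M) mulmxDr mxtraceD addrC mul_mx_scalar mxtraceZ.
rewrite [\tr (U^T *m U)]mxtrace_mulC UU mxtrace1 lerD2l.
rewrite tr_sumE.
(* The crude bound [frob_norm], with frob equal to the rank for a projection; there are m^2 such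
   entries. *)
have bQ i j : `|(U^T *m U) i j| <= m.+1%:R.
  rewrite (le_trans (frob_norm _ _ _))// -natr1 addrC lerD2r /frob.
  rewrite trmx_mul trmxK mulmxA -(mulmxA U^T) UU mulmx1 mxtrace_mulC UU mxtrace1.
  by rewrite ler_nat rank_leq_col.
rewrite (@le_trans _ _ (\sum_(i < m) \sum_(j < m) m.+1%:R * e))//.
  apply: ler_sum => i _; apply: ler_sum => j _.
  rewrite (le_trans (ler_norm _))// normrM ler_pM//.
  by rewrite [X in `|X|]mxE [X in _ + X]mxE [X in _ - X]mxE.
by rewrite !sumr_const !card_ord -mulrnA -[leLHS]mulr_natl mulrA -natrM.
Qed.

Lemma balanced_le x W : dirmeas D x -> avg P D x = kp%:M ->
  mass x W <= kp * (\rank W)%:R.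
Proof.
move=> mx bx; have := @mass_approx x W 0 mx; rewrite mulr0 addr0; apply.
by move=> i j; rewrite bx mxE subrr normr0.
Qed.

(** [W'] is the orthogonal complement of [W]. Equality makes the indicator of the lines in [W] and
    the squared cosine of the angle with [W], which dominates it, have the same integral. They agree
    almost everywhere, so the cosine is 0 off [W]. *)
Lemma balanced_eq x W : dirmeas D x -> avg P D x = kp%:M ->
  mass x W = kp * (\rank W)%:R ->
  exists W', [/\ (W :&: W' = 0)%MS, (\rank W + \rank W' = m)%N &
    P (D `&` [set t | ~~ (x t <= W)%MS && ~~ (x t <= W')%MS]) = 0%E].
Proof.
move=> mx bx eqW; have [U [UU UW]] := orthonormal_rows W.
have [bf le _] := mass_le_tr mx UU UW; have mW := measurable_sub mD W mx.
exists (kermx U^T); split.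
- apply/eqP; rewrite -submx0; apply/row_subP => i; rewrite submx0.
  set u := row i _; have : (u <= W :&: kermx U^T)%MS by exact: row_sub.
  rewrite sub_capmx -UW orthonormal_submx// => /andP[+ /sub_kermxP uU].
  by rewrite uU std_dot0l eq_sym sqn_eq0.
- by rewrite mxrank_ker mxrank_tr UW subnKC// rank_leq_col.
pose f t := \tr (U^T *m U *m dirmx (x t)) - \1_(D `&` [set t | (x t <= W)%MS]) t.
have bi : bdd_meas D (\1_(D `&` [set t | (x t <= W)%MS]) : T -> R).
  exact: bdd_meas_indic.
have : P (D `&` [set t | f t != 0]) = 0%E.
  apply: Rint_ge0_eq0 => //; first exact: bdd_measB.
    by move=> t Dt; rewrite subr_ge0 le.
  rewrite bddB// int_tr// bx mul_mx_scalar mxtraceZ mxtrace_mulC UU mxtrace1.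
  by rewrite Rint_indic// setIA setIid -/(mass x W) eqW subrr.
move=> f0; apply/eqP; rewrite -measure_le0 -f0 le_measure ?inE//.
- rewrite (_ : _ `&` _ = D `\` (D `&` [set t | (x t <= W)%MS]) `\`
      (D `&` [set t | (x t <= kermx U^T)%MS])).
    by do 2?apply: measurableD => //; exact: measurable_sub.
  apply/seteqP; split => [t [Dt /= /andP[/negP a /negP b]]|t [[Dt /= a] b]].
    by split; [split=> // -[_ /a]|case=> _ /b].
  by split => //=; apply/andP; split; apply/negP => c; [apply: a|apply: b].
- rewrite (_ : _ `&` _ = D `&` f @^-1` (~` [set 0])).
    by apply: (bdd_measB bf bi).1 => //; exact: measurableC.
  by apply/seteqP; split => t [Dt /= /eqP ft].
move=> t [Dt /= /andP[a b]]; split => //=; rewrite /f indicE memNset => [|[_ /=]]; last first.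
  exact/negP.
have := tr_dirmx_gram U^T (x t); rewrite trmxK subr0 => ->.
rewrite mulf_neq0// ?invr_neq0 ?sqn_eq0 ?mx.1//.
by apply: contra b => /eqP h; exact/sub_kermxP.
Qed.

(** Let Q project onto the eigenspace [L] of h h^T for the top eigenvalue l. As |x h|^2 <= l |x|^2,
    the quotient |x Q|^2 / |x h|^2 dominates |x Q|^2 / (l |x|^2), yet balance of x h and of x gives
    both the integral kp dim L / l. So almost every line lies in [L] or is orthogonal to it; [L]
    then has mass kp dim L, and strictness forces it to be the whole space. *)
Lemma balanced_unique x h : (0 < m)%N -> dirmeas D x ->
  avg P D x = kp%:M -> avg P D (fun t => x t *m h) = kp%:M -> \det h = 1 ->
  (forall W, (0 < \rank W < m)%N -> mass x W < kp * (\rank W)%:R) ->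
  h *m h^T = 1%:M.
Proof.
move=> m0 mx bx bxh h1 strict; pose S := h *m h^T.
have hu : h \in unitmx by rewrite unitmxE h1 unitr1.
have mxh := dirmeasM hu mx.
have symS : S^T = S by rewrite trmx_mul trmxK.
have [l [[v v0 vS] lmax]] := sym_max_eigen m0 symS.
have Sdot u : std_dot (u *m S) u = std_dot (u *m h) (u *m h).
  by rewrite [RHS]std_dotMr mulmxA std_dot_sym.
have l0 : 0 < l.
  have vh : v *m h != 0.
    by apply: contra v0 => /eqP vh; rewrite -(mulmxK hu v) vh mul0mx.
  move: vh; rewrite -sqn_gt0 -Sdot vS std_dotZl pmulr_lgt0 ?sqn_gt0//.
pose L := kermx (S - l%:M).
have LP u : (u <= L)%MS = (u *m S == l *: u).
  by rewrite (sameP sub_kermxP eqP) mulmxBr mul_mx_scalar subr_eq0.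
have rL : (0 < \rank L)%N.
  rewrite lt0n mxrank_eq0; apply: contra v0 => /eqP L0.
  by rewrite -submx0 -L0 LP vS.
have [U [UU UL]] := orthonormal_rows L.
set w := \rank L in U UU UL rL *.
pose Q := U^T *m U.
have QS : Q *m S = l *: Q.
  rewrite /Q -mulmxA scalemxAr; congr (_ *m _).
  by apply/row_matrixP => i; rewrite row_mul linearZ /=; apply/eqP; rewrite -LP -UL row_sub.
have trQ : \tr Q = w%:R by rewrite mxtrace_mulC UU mxtrace1.
have Qdot u : (u *m Q *m u^T) 0 0 = std_dot (u *m U^T) (u *m U^T).
  by rewrite /Q -{2}(trmxK U) mulmx_gram.
pose f t := (x t *m Q *m (x t)^T) 0 0 / std_dot (x t *m h) (x t *m h) -
  l^-1 * ((x t *m Q *m (x t)^T) 0 0 / std_dot (x t) (x t)).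
(* In terms of the field x h, the first quotient is a trace against [A]; the trace of [A] itself
   follows from [Q *m S = l *: Q]. *)
pose A := invmx h *m Q *m (invmx h)^T.
have AE t : \tr (A *m dirmx (x t *m h)) =
    (x t *m Q *m (x t)^T) 0 0 / std_dot (x t *m h) (x t *m h).
  rewrite tr_dirmx; congr (_ 0 0 / _); rewrite /A trmx_mul !mulmxA.
  by rewrite mulmxK// -[_ *m h^T]mulmxA -trmx_mul mulmxV// trmx1 mulmx1.
have trA : \tr A = l^-1 * w%:R.
  rewrite /A mxtrace_mulC mulmxA -trQ -mxtraceZ; congr (\tr _).
  have Su : S \in unitmx by rewrite unitmx_mul hu unitmx_tr.
  have XS : (invmx h)^T *m invmx h *m S = 1%:M.
    by rewrite /S -mulmxA (mulmxA (invmx h)) mulVmx// mul1mx -trmx_mul mulmxV// trmx1.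
  have -> : (invmx h)^T *m invmx h = invmx S.
    by rewrite -[LHS](mulmxK Su) XS mul1mx.
  have SQ : S *m Q = l *: Q.
    by apply/trmx_inj; rewrite trmx_mul symS linearZ /= trmx_mul trmxK.
  rewrite -[RHS](mulKmx Su) -scalemxAr SQ scalerA mulVf ?scale1r//.
  by rewrite gt_eqF.
have b1 := dirmeas_tr A mxh; have b2 := dirmeas_tr Q mx.
have fE t : f t = \tr (A *m dirmx (x t *m h)) - l^-1 * \tr (Q *m dirmx (x t)).
  by rewrite AE tr_dirmx.
have bf : bdd_meas D f.
  by apply: (bdd_meas_eq _ (bdd_measB b1 (bdd_measZ l^-1 b2))) => t _; rewrite fE.
have f_ge0 t : D t -> 0 <= f t.
  move=> Dt; rewrite /f mulrCA -mulrBr Qdot mulr_ge0 ?sqn_ge0// subr_ge0 -invfM.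
  rewrite lef_pV2 ?posrE ?mulr_gt0 ?sqn_gt0 ?mx.1 ?mxh.1//.
  by rewrite -Sdot lmax.
have Nf : P (D `&` [set t | f t != 0]) = 0%E.
  apply: Rint_ge0_eq0 => //; under eq_Rint do rewrite fE.
  rewrite bddB ?bddZ//; last exact: bdd_measZ.
  by rewrite !int_tr// bx bxh !mul_mx_scalar !mxtraceZ trA trQ mulrCA subrr.
have mL : mass x L = kp * w%:R.
  (* For the reverse inequality, the trace of [Q *m dirmx (x t)] is bounded by the indicator of [L]
     plus that of the null set f != 0: where f = 0 and x Q is nonzero, |x h|^2 = l |x|^2 and
     [rayleigh_eq] puts x in [L]. *)
  apply/eqP; rewrite eq_le balanced_le//= -trQ -mxtraceZ -mul_mx_scalar -bx -int_tr//.
  have mW := measurable_sub mD L mx.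
  have mN : measurable (D `&` [set t | f t != 0]).
    rewrite (_ : _ `&` _ = D `&` f @^-1` (~` [set 0])).
      by apply: bf.1 => //; exact: measurableC.
    by apply/seteqP; split => t [Dt /= /eqP ft].
  have IE A' : measurable (D `&` A') ->
      fine (P (D `&` A')) = \int[P]_(t in D) (\1_(D `&` A') t).
    by move=> ?; rewrite Rint_indic// setIA setIid.
  rewrite -[mass x L]addr0 -[0]/(fine 0%E) -Nf /mass !IE// -bddD//;
    [|exact: bdd_meas_indic..].
  apply: bdd_le => //; first by apply: bdd_measD; exact: bdd_meas_indic.
  move=> t Dt; rewrite tr_dirmx Qdot.
  have le1 : std_dot (x t *m U^T) (x t *m U^T) / std_dot (x t) (x t) <= 1.
    by rewrite ler_pdivrMr ?sqn_gt0 ?mx.1// mul1r orthonormal_bessel.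
  rewrite !indicE; have [ft|ft] := eqVneq (f t) 0; last first.
    have -> : t \in D `&` [set t | f t != 0] by exact: mem_set.
    by rewrite (le_trans le1)// lerDr.
  have [xU0|xU0] := eqVneq (std_dot (x t *m U^T) (x t *m U^T)) 0.
    by rewrite xU0 mul0r addr_ge0.
  suff -> : t \in D `&` [set t | (x t <= L)%MS] by rewrite (le_trans le1)// lerDl.
  apply: mem_set; split => //=.
  move: ft; rewrite /f mulrCA -mulrBr Qdot => /eqP; rewrite mulf_eq0 (negPf xU0) /=.
  rewrite subr_eq0 -invfM => /eqP /invr_inj; rewrite -Sdot => e.
  rewrite LP; apply/eqP/rayleigh_eq => //.
have wm : w = m.
  apply/eqP; rewrite eqn_leq rank_leq_row leqNgt; apply/negP => wm.
  by have := strict L; rewrite rL wm mL ltxx => /(_ isT).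
have Sl : S = l%:M.
  apply/eqP; rewrite -subr_eq0 -mxrank_eq0 -leqn0.
  have := mxrank_ker (S - l%:M); rewrite -/L -/w wm.
  by move: (rank_leq_row (S - l%:M)); move: (\rank _) => r; lia.
suff -> : 1%:M = S by [].
rewrite Sl; suff -> : l = 1 by [].
have : \det S = 1 by rewrite det_mulmx det_tr h1 mulr1.
by rewrite Sl det_scalar => /eqP; rewrite pexpr_eq1 ?ltW// => /eqP.
Qed.

End Balanced.

(** * Scale-invariant open sets of vectors *)

Section Conic.
Context (R : realType).

Definition conic m (U : set 'rV[R]_m) :=
  open U /\ forall c v, c != 0 -> U v -> U (c *: v).

Lemma mulmx_coord_cvg m n (A : 'M[R]_(m, n)) (F : set_system 'rV[R]_m)
    {FF : Filter F} (v : 'rV[R]_m) j :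
  (forall i, u 0 i @[u --> F] --> v 0 i) ->
  (u *m A) 0 j @[u --> F] --> (v *m A) 0 j.
Proof.
move=> Fv; rewrite mxE; under eq_fun do rewrite mxE.
by apply: cvg_sumr => k; exact: cvgM (Fv k) (cvg_cst _).
Qed.

Lemma dirmx_coord_cvg m (F : set_system 'rV[R]_m) {FF : Filter F}
    (v : 'rV[R]_m) i j : v != 0 ->
  (forall i, u 0 i @[u --> F] --> v 0 i) ->
  dirmx u i j @[u --> F] --> dirmx v i j.
Proof.
move=> v0 Fv; under eq_fun do rewrite dirmxE; rewrite dirmxE.
apply: cvgM; first exact: cvgM (Fv i) (Fv j).
apply: cvgV; first by rewrite sqn_eq0.
under eq_fun do rewrite std_dotE; rewrite std_dotE.
by apply: cvg_sumr => k; exact: cvgM (Fv k) (Fv k).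
Qed.

Lemma rv_cvgM m n (A : 'M[R]_(m, n)) :
  continuous (fun v : 'rV[R]_m => v *m A : 'rV[R]_n).
Proof.
move=> v; apply/(@cvgrPdist_lt _ _ _ (nbhs v) (nbhs_filter v)) => e e0.
have H : \forall u \near v, forall j : 'I_n, `|(v *m A) 0 j - (u *m A) 0 j| < e.
  apply: (@filter_forall _ _ (fun (j : 'I_n) (u : 'rV[R]_m) =>
    `|(v *m A) 0 j - (u *m A) 0 j| < e) (nbhs v) (nbhs_filter v)) => j.
  have := @mulmx_coord_cvg _ _ A (nbhs v) (nbhs_filter v) v j
    (fun i => @coord_continuous _ _ _ 0 i v).
  by move/(@cvgrPdist_lt _ _ _ (nbhs v) (nbhs_filter v)) => /(_ e e0).
apply: (@filterS _ (nbhs v) (nbhs_filter v) _ _ _ H) => u Hu.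
rewrite /Num.Def.normr /= mx_normrE.
apply/bigmax_ltP; split => // -[i j] _ /=; rewrite ord1.
by have := Hu j; rewrite !mxE.
Qed.

Lemma conic_preimage m n (A : 'M[R]_(m, n)) (U : set 'rV[R]_n) :
  conic U -> conic [set v | U (v *m A)].
Proof.
move=> [oU cU]; split; last by move=> c v c0 /= Uv; rewrite -scalemxAl; exact: cU.
by apply: open_comp => // v _; exact: rv_cvgM.
Qed.

Lemma open_neq0 m : open [set v : 'rV[R]_m | v != 0].
Proof.
rewrite (_ : mkset _ = ~` [set 0]); last first.
  by apply/seteqP; split=> c /= /eqP.
rewrite openC; apply: accessible_closed_set1; apply: hausdorff_accessible.
exact: norm_hausdorff.
Qed.

Context d (T : measurableType d).

(** Borel measurability of t |-> [x t]. It speaks of all open sets of lines, as required to push a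
    measure forward along the field. *)
Definition conic_meas m (D : set T) (x : T -> 'rV[R]_m) :=
  (forall t, D t -> x t != 0) /\
  forall U, conic U -> measurable (D `&` x @^-1` U).

Lemma conic_dirmeas m D (x : T -> 'rV[R]_m) : measurable D ->
  conic_meas D x -> dirmeas D x.
Proof.
move=> mD [x0 mx]; split => // i j.
apply: (measurability _ (RGenOInfty.measurableE R)) => _ [_ [a ->] <-].
(* The origin is removed because continuity of [dirmx] is only available away from it. *)
pose U := [set v : 'rV[R]_m | v != 0 /\ a < dirmx v i j].
rewrite (_ : _ `&` _ = D `&` x @^-1` U).
  apply: mx; split; last by move=> c v c0 [v0 av]; split;
    [rewrite scaler_eq0 negb_or c0|rewrite dirmxZ].
  rewrite openE => v [v0 av] /=.
  apply: filterI; first by move: (@open_neq0 m); rewrite openE; exact.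
  exact: (cvgr_gt _ (@dirmx_coord_cvg _ (nbhs v) (nbhs_filter v) v i j v0 (fun i => @coord_continuous _ _ _ 0 i v)) _ av).
by apply/seteqP; split => t [Dt /=]; rewrite in_itv /= andbT => h; split => //;
  [split => //; exact: x0|case: h].
Qed.

Lemma conic_measM m n D D' (x : T -> 'rV[R]_m) (A : 'M[R]_(m, n)) :
  conic_meas D x -> measurable D' -> D' `<=` D ->
  (forall t, D' t -> x t *m A != 0) -> conic_meas D' (fun t => x t *m A).
Proof.
move=> [x0 mx] mD' D'D xA; split => // U cU.
rewrite (_ : _ `&` _ = D' `&` (D `&` x @^-1` [set v | U (v *m A)])).
  by apply: measurableI => //; apply: mx; exact: conic_preimage.
by apply/seteqP; split => t [D't /=]; [move=> Ut; split => //; split => //; exact: D'D|case].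
Qed.

End Conic.

(** * Degeneration *)

Section Blocks.
Context (R : realType).

Lemma std_dot_row_mx p q (a c : 'rV[R]_p) (b d : 'rV[R]_q) :
  std_dot (row_mx a b) (row_mx c d) = std_dot a c + std_dot b d.
Proof. by rewrite /std_dot tr_row_mx mul_row_col mxE. Qed.

Lemma dirmx_row0 p q (v : 'rV[R]_p) :
  dirmx (row_mx v (0 : 'rV_q)) = block_mx (dirmx v) 0 0 0.
Proof.
rewrite /dirmx std_dot_row_mx std_dot0l addr0 tr_row_mx mul_col_row.
by rewrite !trmx0 !(mul0mx, mulmx0) scale_block_mx !scaler0.
Qed.

Lemma dirmx_0row p q (v : 'rV[R]_q) :
  dirmx (row_mx (0 : 'rV_p) v) = block_mx 0 0 0 (dirmx v).
Proof.
rewrite /dirmx std_dot_row_mx std_dot0l add0r tr_row_mx mul_col_row.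
by rewrite !trmx0 !(mul0mx, mulmx0) scale_block_mx !scaler0.
Qed.

Lemma row_mx_neq0 p q (a : 'rV[R]_p) (b : 'rV[R]_q) :
  (row_mx a b != 0) = (a != 0) || (b != 0).
Proof.
rewrite -negb_and; congr (~~ _); apply/eqP/andP => [|[/eqP-> /eqP->]].
  move=> E; split; apply/eqP.
    by rewrite -[a](row_mxKl _ b) E linear0.
  by rewrite -[b](row_mxKr a) E linear0.
exact: row_mx0.
Qed.

Definition norm1 p q (A : 'M[R]_(p, q)) : R := \sum_i \sum_j `|A i j|.

Lemma norm1_ge0 p q (A : 'M[R]_(p, q)) : 0 <= norm1 A.
Proof. by apply: sumr_ge0 => i _; apply: sumr_ge0. Qed.

Lemma norm1_coord p q (A : 'M[R]_(p, q)) i j : `|A i j| <= norm1 A.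
Proof.
rewrite /norm1 (bigD1 i)//= (bigD1 j)//= -addrA lerDl addr_ge0//.
  exact: sumr_ge0.
by apply: sumr_ge0 => k _; exact: sumr_ge0.
Qed.

Lemma norm1_mul p q (v : 'rV[R]_p) (A : 'M[R]_(p, q)) j :
  `|(v *m A) 0 j| <= norm1 v * norm1 A.
Proof.
rewrite mxE (le_trans (ler_norm_sum _ _ _))// {1}/norm1 big_ord1 mulr_suml.
by apply: ler_sum => i _; rewrite normrM ler_wpM2l// norm1_coord.
Qed.

End Blocks.

Section Degeneration.
(* The induction on the dimension [m] passes to subspaces and subsets [D] of
   [T], so the slope [kp = fine (P D) / m] is fixed once and for all. *)
Context d (T : measurableType d) (R : realType) (P : probability T R) (kp : R).

Lemma fine_probU (A B : set T) : measurable A -> measurable B ->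
  A `&` B = set0 -> fine (P (A `|` B)) = fine (P A) + fine (P B).
Proof. by move=> mA mB AB; rewrite measureU// fineD//; exact: fin_num_measure. Qed.

Lemma ae_le_prob (A B : set T) : measurable A -> measurable B ->
  {ae P, forall t, A t -> B t} -> (P A <= P B)%E.
Proof.
move=> mA mB [N [mN N0 sN]]; rewrite (@le_trans _ _ (P (B `|` N)))//.
  rewrite le_measure ?inE//; first exact: measurableU.
  move=> t At; have [Bt|Bt] := pselect (B t); first by left.
  by right; apply: sN => /= h; apply: Bt; exact: h.
by have := measureU2 P mB mN; rewrite [X in (_ + X)%E]N0 adde0.
Qed.

Lemma ae_eq_prob (A B : set T) : measurable A -> measurable B ->
  {ae P, forall t, A t <-> B t} -> fine (P A) = fine (P B).
Proof.
move=> mA mB AB; congr fine; apply/eqP; rewrite eq_le; apply/andP; split.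
  by apply: ae_le_prob => //; apply: filterS AB => t [].
by apply: ae_le_prob => //; apply: filterS AB => t [].
Qed.

Lemma avg_setU m (D1 D2 : set T) (y : T -> 'rV[R]_m) : measurable D1 ->
  measurable D2 -> D1 `&` D2 = set0 -> dirmeas (D1 `|` D2) y ->
  avg P (D1 `|` D2) y = avg P D1 y + avg P D2 y.
Proof.
move=> m1 m2 D12 my; apply/matrixP => i j; rewrite !mxE Rintegral_setU//.
  by apply: bdd_meas_integrable; [exact: measurableU|exact: dirmeas_bdd].
by apply/disj_setPS; rewrite D12.
Qed.

Definition semistable_field m D (x : T -> 'rV[R]_m) :=
  forall W : 'M[R]_m, mass P D x W <= kp * (\rank W)%:R.

(** The counterpart of polystability: under this property the balanced limit field is attained. *)
Definition reducible_field m D (x : T -> 'rV[R]_m) :=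
  forall W : 'M[R]_m, mass P D x W = kp * (\rank W)%:R ->
  exists W' : 'M[R]_m, [/\ (W :&: W' = 0)%MS, (\rank W + \rank W' = m)%N &
    {ae P, forall t, D t -> (x t <= W)%MS || (x t <= W')%MS}].

(** [W1'] is the preimage under [A] of the complement of [W1 *m A]. Counting codimensions, its rank
    is at least w - rank W1, and at most that since it meets [W1] trivially. *)
Lemma reducible_sub m w (A : 'M[R]_(w, m)) (D D1 : set T)
    (x : T -> 'rV[R]_m) (x1 : T -> 'rV[R]_w) :
  row_free A -> D1 `<=` D -> reducible_field D x ->
  (forall W1, mass P D1 x1 W1 = mass P D x <<W1 *m A>>%MS) ->
  {ae P, forall t, D1 t -> x t = x1 t *m A} -> reducible_field D1 x1.
Proof.
move=> fA D1D red massE xA W1 eqW1.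
have rW1 : \rank <<W1 *m A>>%MS = \rank W1 by rewrite genmxE mxrankMfree.
have [|W' [cap rk aeW]] := red <<W1 *m A>>%MS; first by rewrite -massE rW1.
rewrite rW1 in rk.
pose W1' := kermx (A *m cokermx W').
have W1'P (v : 'rV_w) : (v <= W1')%MS = (v *m A <= W')%MS.
  by rewrite [RHS]submxE -mulmxA; apply/sub_kermxP/eqP.
have cap1 : (W1 :&: W1' = 0)%MS.
  apply/eqP; rewrite -submx0; apply/row_subP => i.
  set v := row i _; have : (v <= W1 :&: W1')%MS by exact: row_sub.
  rewrite sub_capmx W1'P => /andP[v1 v2].
  have : (v *m A <= <<W1 *m A>> :&: W')%MS.
    by rewrite sub_capmx genmxE v2 submxMr.
  by rewrite cap !submx0 => /eqP vA; apply/eqP/(row_free_inj fA); rewrite vA mul0mx.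
exists W1'; split => //.
  have := mxrank_ker (A *m cokermx W'); rewrite -/W1' => rk1.
  have := mxrankM_maxr A (cokermx W'); rewrite mxrank_coker => rk2.
  have := rank_leq_row (A *m cokermx W') => rk3.
  have := mxrank_sum_cap W1 W1'; rewrite cap1 mxrank0 addn0 => rk4.
  have := rank_leq_col (W1 + W1')%MS; rewrite rk4; move: rk1 rk2 rk3 rk.
  move: (\rank (A *m _)) (\rank W1) (\rank W1') (\rank W') => *; lia.
apply: filterS2 aeW xA => t h xE D1t.
have := h (D1D _ D1t); rewrite W1'P genmxE (xE D1t) => /orP[|->]; last by rewrite orbT.
by rewrite submxMfree// => ->.
Qed.

(** The dimensions are fresh variables tied to [m] by an equation, so that [m] can be replaced by
    [w + w'] and block matrices become available. *)
Lemma complement_basis m (W W' : 'M[R]_m) : (W :&: W' = 0)%MS ->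
  (\rank W + \rank W' = m)%N -> exists w w' (A : 'M[R]_(w, m)) (A' : 'M[R]_(w', m)),
    [/\ w = \rank W, (w + w')%N = m, (A :=: W)%MS, (A' :=: W')%MS & row_free (col_mx A A')].
Proof.
move=> cap rk; exists (\rank W), (\rank W'), (row_base W), (row_base W').
split => //; [exact: eq_row_base..|].
have E : (row_base W + row_base W' :=: W + W')%MS.
  by apply: adds_eqmx; exact: eq_row_base.
rewrite /row_free -addsmxE E.
by have := mxrank_sum_cap W W'; rewrite cap mxrank0 addn0 => ->.
Qed.

End Degeneration.

Section DegenerationTheorem.
Context d (T : measurableType d) (R : realType) (P : probability T R) (kp : R).

Lemma subspace_mass m (D D1 : set T) w (A : 'M[R]_(w, m)) (W1 : 'M[R]_w)
    (x : T -> 'rV[R]_m) (x1 : T -> 'rV[R]_w) : row_free A ->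
  D1 = D `&` [set t | (x t <= A)%MS] -> (forall t, D1 t -> x t = x1 t *m A) ->
  mass P D1 x1 W1 = mass P D x <<W1 *m A>>%MS.
Proof.
move=> fA D1E xE; congr (fine (P _)); apply/seteqP; split => t /=; rewrite genmxE.
  by move=> [D1t tW]; split; [by move: D1t; rewrite D1E => -[]|
    rewrite xE// submxMfree].
move=> [Dt tW]; have D1t : D1 t.
  by rewrite D1E; split => //=; exact: submx_trans tW (submxMl _ _).
by split => //; move: tW; rewrite xE// submxMfree.
Qed.

(** The factors [c k] that make the second component converge are at most of the order of |g2^-1|,
    and the first component grows at most like |g1|; [s] beats the product by the factor k + 1. *)
Lemma transverse_cvg w w' (v1 : 'rV[R]_w) (v2 y2 : 'rV[R]_w')
    (g1 : nat -> 'M[R]_w) (g2 : nat -> 'M[R]_w') (c s : nat -> R) :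
  (forall k, g2 k \in unitmx) -> v2 != 0 ->
  mxcvg (fun k => c k *: (v2 *m g2 k)) y2 ->
  (forall k, s k = k.+1%:R * ((1 + norm1 (g1 k)) * (1 + norm1 (invmx (g2 k))))) ->
  mxcvg (fun k => (c k / s k) *: (v1 *m g1 k)) 0.
Proof.
move=> g2u v20 cy sE i j; rewrite mxE ord1 {i}.
have [i vi] : exists i, v2 0 i != 0.
  apply: contrapT => h; move/eqP: v20; apply; apply/rowP => i; rewrite mxE.
  by apply: contrapT => hi; apply: h; exists i; exact/eqP.
pose b k := norm1 (c k *: (v2 *m g2 k)).
have bc : b k @[k --> \oo] --> norm1 y2.
  by do 2 (apply: cvg_sumr => ?); apply: cvg_norm; exact: cy.
have [K [Kr Kb]] := cvg_seq_bounded (cvgP _ bc).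
have {}Kb k : b k <= K + 1.
  have := Kb (K + 1) (_ : K < K + 1) k I; rewrite ltrDl ltr01 => /(_ isT) /=.
  exact/le_trans/ler_norm.
pose C := (K + 1) / `|v2 0 i| * norm1 v1.
apply/norm_cvg0P; apply: (@squeeze_cvgr _ _ _ _ (fun=> 0) (fun k => C * k.+1%:R^-1)).
- apply: nearW => k; rewrite normr_ge0 /= mxE normrM.
  have n1 : 0 < 1 + norm1 (g1 k) by rewrite ltr_pwDl ?norm1_ge0.
  have n2 : 0 < 1 + norm1 (invmx (g2 k)) by rewrite ltr_pwDl ?norm1_ge0.
  have s0 : 0 < s k by rewrite sE !mulr_gt0.
  have cb : `|c k| * `|v2 0 i| <= (K + 1) * (1 + norm1 (invmx (g2 k))).
    rewrite -normrM (_ : c k * v2 0 i = ((c k *: (v2 *m g2 k)) *m invmx (g2 k)) 0 i).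
      rewrite (le_trans (norm1_mul _ _ _))// ler_pM ?norm1_ge0 ?Kb// lerDr//.
    by rewrite -scalemxAl mulmxK// mxE.
  rewrite normrM normfV (gtr0_norm s0).
  have v_gt0 : 0 < `|v2 0 i| by rewrite normr_gt0.
  have gb := norm1_mul v1 (g1 k) j.
  rewrite mulrAC ler_pdivrMr// sE /C.
  rewrite [leRHS](_ : _ = (K + 1) / `|v2 0 i| * (1 + norm1 (invmx (g2 k))) *
     (norm1 v1 * (1 + norm1 (g1 k)))); last first.
    have : k.+1%:R != 0 :> R by rewrite pnatr_eq0.
    move: k.+1%:R => q q0; field; by rewrite q0 gt_eqF.
  apply: ler_pM => //; last first.
    by rewrite (le_trans gb)// ler_wpM2l ?norm1_ge0// lerDr.
  by rewrite mulrAC ler_pdivlMr.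
- exact: cvg_cst.
- by rewrite -(mulr0 C); apply: cvgM; [exact: cvg_cst|exact: cvg_harmonic].
Qed.

Lemma eq_avg m (D : set T) (y z : T -> 'rV[R]_m) :
  (forall t, D t -> dirmx (y t) = dirmx (z t)) -> avg P D y = avg P D z.
Proof.
by move=> yz; apply/matrixP => i j; rewrite !mxE; apply: eq_Rint => t /yz ->.
Qed.

Lemma avg_row0 p q (D : set T) (y : T -> 'rV[R]_p) : measurable D ->
  avg P D (fun t => row_mx (y t) (0 : 'rV_q)) = block_mx (avg P D y) 0 0 0.
Proof.
move=> mD; apply/matrixP => i j; rewrite [LHS]mxE.
under eq_Rint do rewrite dirmx_row0.
case: (split_ordP i) => i' ->; case: (split_ordP j) => j' ->.
- under eq_Rint do rewrite block_mxEul.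
  by rewrite block_mxEul mxE.
- under eq_Rint do rewrite block_mxEur mxE.
  by rewrite block_mxEur mxE Rintegral_cst// mul0r.
- under eq_Rint do rewrite block_mxEdl mxE.
  by rewrite block_mxEdl mxE Rintegral_cst// mul0r.
- under eq_Rint do rewrite block_mxEdr mxE.
  by rewrite block_mxEdr mxE Rintegral_cst// mul0r.
Qed.

Lemma avg_0row p q (D : set T) (y : T -> 'rV[R]_q) : measurable D ->
  avg P D (fun t => row_mx (0 : 'rV_p) (y t)) = block_mx 0 0 0 (avg P D y).
Proof.
move=> mD; apply/matrixP => i j; rewrite [LHS]mxE.
under eq_Rint do rewrite dirmx_0row.
case: (split_ordP i) => i' ->; case: (split_ordP j) => j' ->.
- under eq_Rint do rewrite block_mxEul mxE.
  by rewrite block_mxEul mxE Rintegral_cst// mul0r.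
- under eq_Rint do rewrite block_mxEur mxE.
  by rewrite block_mxEur mxE Rintegral_cst// mul0r.
- under eq_Rint do rewrite block_mxEdl mxE.
  by rewrite block_mxEdl mxE Rintegral_cst// mul0r.
- under eq_Rint do rewrite block_mxEdr.
  by rewrite block_mxEdr mxE.
Qed.

Lemma mxcvg_row_mx p q (a_ : nat -> 'rV[R]_p) (b_ : nat -> 'rV[R]_q) a b :
  mxcvg a_ a -> mxcvg b_ b -> mxcvg (fun k => row_mx (a_ k) (b_ k)) (row_mx a b).
Proof.
move=> ha hb i j; case: (split_ordP j) => j' ->.
  by rewrite row_mxEl; under eq_fun do rewrite row_mxEl; exact: ha.
by rewrite row_mxEr; under eq_fun do rewrite row_mxEr; exact: hb.
Qed.

(** One induction serves semistability and polystability. Positive products of determinants say that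
    all have the same sign; the factors [c k] are there because only the lines converge. *)
Theorem degeneration m (D : set T) (x : T -> 'rV[R]_m) :
  measurable D -> conic_meas D x -> fine (P D) = kp * m%:R ->
  semistable_field P kp D x ->
  exists (g_ : nat -> 'M[R]_m) (y : T -> 'rV[R]_m),
    [/\ forall k l, 0 < \det (g_ k) * \det (g_ l),
        conic_meas D y, avg P D y = kp%:M,
        forall t, D t -> exists c : nat -> R, (forall k, c k != 0) /\
          mxcvg (fun k => c k *: (x t *m g_ k)) (y t) &
        reducible_field P kp D x ->
          {ae P, forall t, D t -> dirmx (x t *m g_ 0%N) = dirmx (y t)}].
Proof.
elim/ltn_ind: m D x => m IH D x mD cx PD ss.
have mx := conic_dirmeas mD cx.
have [strict|] := pselect (forall W : 'M[R]_m, (0 < \rank W < m)%N ->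
    mass P D x W < kp * (\rank W)%:R).
  have [g g0 gb] := strict_balanced mD mx PD strict.
  have gu : g \in unitmx by rewrite unitmxE unitfE gt_eqF.
  exists (fun=> g), (fun t => x t *m g); split => //.
  - by move=> _ _; rewrite mulr_gt0.
  - by apply: (conic_measM cx) => // t Dt; exact: (dirmeasM gu mx).1.
  - move=> t Dt; exists (fun=> 1); split => [_|]; first exact: oner_neq0.
    by under eq_fun do rewrite scale1r; exact: mxcvg_cst.
  - by move=> _; exact: aeW.
move=> /existsNP[W /not_implyP[/andP[W0 Wm] /negP]].
rewrite -leNgt => leW; have {leW} eqW : mass P D x W = kp * (\rank W)%:R.
  by apply/eqP; rewrite eq_le ss leW.
(* In the reducible case the complement must be the one carrying the other lines; otherwise any
   complement will do. *)
have [W' [cap rk aeW']] : exists W' : 'M[R]_m, [/\ (W :&: W' = 0)%MS,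
    (\rank W + \rank W' = m)%N & reducible_field P kp D x ->
    {ae P, forall t, D t -> (x t <= W)%MS || (x t <= W')%MS}].
  have [red|nred] := pselect (reducible_field P kp D x).
    by have [W' [? ? ?]] := red W eqW; exists W'.
  exists (W^C)%MS; split => //; first exact: capmx_compl.
  by rewrite mxrank_compl subnKC// rank_leq_col.
have [w [w' [A [A' [wE mE AW A'W' fC]]]]] := complement_basis cap rk.
have {W0 Wm} [w0 w'0] : (0 < w)%N /\ (0 < w')%N.
  by move: W0 Wm mE; rewrite -wE => *; split; lia.
have {}eqW : mass P D x <<A>>%MS = kp * w%:R.
  move: eqW; rewrite -wE => <-; congr (fine (P (_ `&` _))).
  by apply/seteqP; split => t /=; rewrite genmxE AW.
have {rk cap} aeA : reducible_field P kp D x ->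
    {ae P, forall t, D t -> (x t <= A)%MS || (x t <= A')%MS}.
  by move=> /aeW'; apply: filterS => t h /h; rewrite AW A'W'.
move: mE => {W W' aeW' AW A'W' wE} mE; subst m.
pose C := col_mx A A'; have Cu : C \in unitmx by rewrite -row_free_unit.
pose B := invmx C.
have [fA fA'] : row_free A /\ row_free A'.
  have : C *m row_mx (lsubmx B) (rsubmx B) = 1%:M by rewrite hsubmxK mulmxV.
  rewrite mul_col_row scalar_mx_block => /eq_block_mx[AB _ _ AB'].
  by split; apply/row_freeP; [exists (lsubmx B)|exists (rsubmx B)].
pose x1 t := lsubmx (x t *m B); pose x2 t := rsubmx (x t *m B).
have xB t : x t *m B = row_mx (x1 t) (x2 t) by rewrite hsubmxK.
have xE t : x t = x1 t *m A + x2 t *m A'.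
  by rewrite -[LHS](mulmxKV Cu) -/B xB mul_row_col.
have xA t : (x t <= A)%MS = (x2 t == 0).
  apply/idP/eqP => [/submxP[v vE]|x20]; last by rewrite xE x20 mul0mx addr0 submxMl.
  have : x t *m B = row_mx v 0.
    by rewrite -[RHS](mulmxK Cu) mul_row_col mul0mx addr0 -vE.
  by rewrite xB => /eq_row_mx[].
have xA' t : (x t <= A')%MS = (x1 t == 0).
  apply/idP/eqP => [/submxP[v vE]|x10]; last by rewrite xE x10 mul0mx add0r submxMl.
  have : x t *m B = row_mx 0 v.
    by rewrite -[RHS](mulmxK Cu) mul_row_col mul0mx add0r -vE.
  by rewrite xB => /eq_row_mx[].
have xBn0 t : D t -> (x1 t != 0) || (x2 t != 0).
  move=> Dt; rewrite -row_mx_neq0 -xB; apply: contra (cx.1 t Dt) => /eqP h.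
  by rewrite -[x t](mulmxKV Cu) -/B h mul0mx.
(* On [D1] the line lies in [W]; on [D2] only its component [x2] along the complement will survive
   the stretch. *)
pose D1 := D `&` [set t | (x t <= A)%MS]; pose D2 := D `\` D1.
have mD1 : measurable D1 by exact: measurable_sub.
have mD2 : measurable D2 by exact: measurableD.
have D1D : D1 `<=` D by move=> t [].
have D2D : D2 `<=` D by move=> t [].
have D12 : D1 `&` D2 = set0 by apply/seteqP; split => // t [? []].
have DE : D = D1 `|` D2 by rewrite /D2 setUDr setDv setD0; apply/esym/setUidr.
have x1E t : D1 t -> x t = x1 t *m A.
  by move=> [_ /=]; rewrite xA xE => /eqP ->; rewrite mul0mx addr0.
have x1n0 t : D1 t -> x1 t != 0.
  by move=> [Dt /=]; rewrite xA => x20; have := xBn0 t Dt; rewrite x20 orbF.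
have x2n0 t : D2 t -> x2 t != 0.
  move=> [Dt nD1]; apply/negP => x20; apply: nD1; split => //=.
  by rewrite xA.
have cx1 : conic_meas D1 x1.
  have E t : x1 t = x t *m lsubmx B by rewrite mulmx_lsub.
  rewrite (_ : x1 = fun t => x t *m lsubmx B); last exact/funext.
  by apply: (conic_measM cx) => // t /x1n0; rewrite E.
have cx2 : conic_meas D2 x2.
  have E t : x2 t = x t *m rsubmx B by rewrite mulmx_rsub.
  rewrite (_ : x2 = fun t => x t *m rsubmx B); last exact/funext.
  by apply: (conic_measM cx) => // t /x2n0; rewrite E.
have PD1 : fine (P D1) = kp * w%:R.
  by rewrite -eqW; congr (fine (P (_ `&` _))); apply/seteqP; split => t /=; rewrite genmxE.
have PD2 : fine (P D2) = kp * w'%:R.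
  have := PD; rewrite DE fine_probU// PD1 natrD mulrDr => /addrI ->//.
have ss1 : semistable_field P kp D1 x1.
  move=> W1; rewrite (subspace_mass W1 fA erefl x1E) (le_trans (ss _))//.
  by rewrite genmxE mxrankMfree.
have ss2 : semistable_field P kp D2 x2.
  (* [V] contains the lines of [D1] besides those tested by [W2]; subtracting the extremal mass kp w
     of [D1] from its bound leaves the one for [W2]. *)
  move=> W2; pose V := (A + W2 *m A')%MS.
  have rV : (\rank V <= w + \rank W2)%N.
    rewrite (leq_trans (mxrank_adds_leqif _ _))//.
    by rewrite leq_add ?rank_leq_row ?mxrankMfree.
  have xV t : D2 t -> (x2 t <= W2)%MS -> (x t <= V)%MS.
    move=> _ h; rewrite xE; apply: addmx_sub_adds; first exact: submxMl.
    exact: submxMr.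
  have kp0 : 0 <= kp.
    have := PD1; have := fine_ge0 (measure_ge0 P D1).
    by move=> /[swap] ->; rewrite pmulr_lge0// ltr0n.
  have m1 := measurable_sub mD2 W2 (conic_dirmeas mD2 cx2).
  have : fine (P D1) + mass P D2 x2 W2 <= mass P D x V.
    rewrite -fine_probU//; last by rewrite setIA D12 set0I.
    have mV := measurable_sub mD V mx.
    have mU := measurableU _ _ mD1 m1.
    apply: fine_le; [exact: fin_num_measure|exact: fin_num_measure|].
    rewrite le_measure ?inE//.
    move=> t [[Dt /= h]|[D2t h]]; split => //=.
    - exact: submx_trans h (addsmxSl _ _).
    - exact: D2D.
    - exact: xV.
  rewrite PD1 => /le_trans /(_ (ss _)) h.
  rewrite -(lerD2l (kp * w%:R)) (le_trans h)// -mulrDr -natrD.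
  by rewrite ler_wpM2l// ler_nat.
have wlt : (w < w + w')%N by rewrite -[X in (X < _)%N]addn0 ltn_add2l.
have w'lt : (w' < w + w')%N by rewrite -[X in (X < _)%N]add0n ltn_add2r.
have [g1 [y1 [dg1 cy1 ay1 cvg1 red1]]] := IH w wlt D1 x1 mD1 cx1 PD1 ss1.
have [g2 [y2 [dg2 cy2 ay2 cvg2 red2]]] := IH w' w'lt D2 x2 mD2 cx2 PD2 ss2.
have g2u k : g2 k \in unitmx.
  by rewrite unitmxE unitfE; apply: contraTneq (dg2 k k) => ->; rewrite mul0r ltxx.
(* The stretch must outrun both inductive sequences. *)
pose s k : R := k.+1%:R * ((1 + norm1 (g1 k)) * (1 + norm1 (invmx (g2 k)))).
have s0 k : 0 < s k by rewrite !mulr_gt0// ltr_pwDl ?norm1_ge0.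
pose g k := B *m block_mx (g1 k) 0 0 (s k *: g2 k).
pose y t := if t \in D1 then row_mx (y1 t) 0 else row_mx 0 (y2 t).
have xg t k : x t *m g k = row_mx (x1 t *m g1 k) (s k *: (x2 t *m g2 k)).
  by rewrite mulmxA xB mul_row_block !mulmx0 addr0 add0r -scalemxAr.
have yD1 t : D1 t -> y t = row_mx (y1 t) 0 by move=> h; rewrite /y mem_set.
have yD2 t : D2 t -> y t = row_mx 0 (y2 t) by move=> [_ h]; rewrite /y memNset.
have cy : conic_meas D y.
  split=> [t|U cU].
    rewrite DE => -[Dt|Dt]; [rewrite (yD1 t Dt)|rewrite (yD2 t Dt)]; rewrite row_mx_neq0.
      by rewrite (cy1.1 t Dt).
    by rewrite (cy2.1 t Dt) orbT.
  rewrite (_ : _ `&` _ = (D1 `&` y1 @^-1` [set v | U (v *m row_mx 1%:M 0)]) `|`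
                      (D2 `&` y2 @^-1` [set v | U (v *m row_mx 0 1%:M)])).
    by apply: measurableU; [apply: cy1.2|apply: cy2.2]; exact: conic_preimage.
  rewrite {1}DE setIUl; congr (_ `|` _); apply/seteqP.
    by split => t [Dt /= h]; split => //=; move: h;
      rewrite (yD1 t Dt) mul_mx_row mulmx1 mulmx0.
  by split => t [Dt /= h]; split => //=; move: h;
    rewrite (yD2 t Dt) mul_mx_row mulmx1 mulmx0.
have my := conic_dirmeas mD cy.
exists g, y; split => //.
- have dB : 0 < \det B ^+ 2.
    by rewrite lt0r sqr_ge0 sqrf_eq0 -unitfE -unitmxE unitmx_inv Cu.
  (* Besides the inductive products, only a square and powers of the positive [s] remain. *)
  move=> k l; rewrite !det_mulmx !det_ublock !detZ.
  rewrite (_ : _ * _ = (\det B) ^+ 2 * (\det (g1 k) * \det (g1 l)) *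
     ((s k ^+ w') * (s l ^+ w')) * (\det (g2 k) * \det (g2 l))); last by ring.
  apply: mulr_gt0 (dg2 k l); apply: mulr_gt0; first exact: mulr_gt0 dB (dg1 k l).
  by rewrite mulr_gt0 ?exprn_gt0 ?s0.
- rewrite {1}DE avg_setU// -?DE//.
  rewrite scalar_mx_block.
  have -> : avg P D1 y = block_mx kp%:M 0 0 0.
    rewrite -ay1 -avg_row0//; apply: eq_avg => t Dt; by rewrite yD1.
  have -> : avg P D2 y = block_mx 0 0 0 kp%:M.
    rewrite -ay2 -avg_0row//; apply: eq_avg => t Dt; by rewrite yD2.
  by rewrite add_block_mx !addr0 !add0r.
- move=> t; rewrite DE => -[Dt|Dt].
    have [c [c0 hc]] := cvg1 t Dt; exists c; split => // i j.
    rewrite (yD1 t Dt); have x20 : x2 t = 0 by case: Dt => _ /=; rewrite xA => /eqP.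
    under eq_fun do rewrite xg x20 mul0mx scaler0 scale_row_mx scaler0.
    by apply: mxcvg_row_mx => //; exact: mxcvg_cst.
  have [c [c0 hc]] := cvg2 t Dt; exists (fun k => c k / s k); split => [k|].
    by rewrite mulf_neq0 ?invr_neq0// gt_eqF.
  rewrite (yD2 t Dt); under eq_fun do rewrite xg scale_row_mx.
  apply: mxcvg_row_mx.
    exact: (transverse_cvg (x1 t) g2u (x2n0 t Dt) hc (fun k => erefl)).
  by under eq_fun do rewrite scalerA divfK ?gt_eqF//.
(* Now [x1] vanishes almost everywhere on [D2], so the first map already sends these lines into the
   second block, without a limit. *)
- move=> red; have {}aeA := aeA red.
  have r1 : {ae P, forall t, D1 t -> dirmx (x1 t *m g1 0%N) = dirmx (y1 t)}.
    apply: red1; apply: (reducible_sub fA D1D red) => [W1|].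
      exact: subspace_mass fA erefl x1E.
    by apply: aeW => t; exact: x1E.
  have x2E : {ae P, forall t, D2 t -> x t = x2 t *m A'}.
    apply: filterS aeA => t h [Dt nD1].
    have := h Dt; rewrite xA' => /orP[xa|/eqP x10]; first by case: nD1.
    by rewrite xE x10 mul0mx add0r.
  have r2 : {ae P, forall t, D2 t -> dirmx (x2 t *m g2 0%N) = dirmx (y2 t)}.
    apply: red2; apply: (reducible_sub fA' D2D red) => // W2.
    have mW2 := measurable_sub mD2 W2 (conic_dirmeas mD2 cx2).
    have mW := measurable_sub mD <<W2 *m A'>>%MS mx.
    apply: ae_eq_prob => //; apply: filterS x2E => t h; rewrite /= genmxE.
    split=> [[D2t xW]|[Dt xW]].
      by split; [exact: D2D|rewrite (h D2t) submxMfree].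
    have xa' : (x t <= A')%MS := submx_trans xW (submxMl _ _).
    have D2t : D2 t.
      split => // -[_ /=]; rewrite xA => x20.
      by have := xBn0 t Dt; rewrite x20 -xA' xa'.
    by split => //; move: xW; rewrite (h D2t) submxMfree.
  have x10 : {ae P, forall t, D2 t -> x1 t = 0}.
    apply: filterS aeA => t h [Dt nD1].
    have := h Dt; rewrite xA' => /orP[xa|/eqP //]; by case: nD1.
  apply: filterS3 r1 r2 x10 => t h1 h2 h3; rewrite DE => -[Dt|Dt].
    have x20 : x2 t = 0 by case: Dt => _ /=; rewrite xA => /eqP.
    by rewrite (yD1 t Dt) xg x20 mul0mx scaler0 !dirmx_row0 h1.
  rewrite (yD2 t Dt) xg (h3 Dt) mul0mx -[0](scaler0 _ (s 0%N)) -scale_row_mx.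
  by rewrite dirmxZ ?gt_eqF// scaler0 !dirmx_0row h2.
Qed.

End DegenerationTheorem.

(** * Coordinates on the projective space *)

Section Coordinates.
Import passmx.
Context (R : realType).

Section Basis.
Context (V : vectType R) (e : (\dim {:V}).-tuple V).
Context (eb : basis_of {:V} e).

Lemma rank_msof (L : {vspace V}) : \rank (msof e L) = \dim L.
Proof.
pose B : 'M[R]_(\dim L, \dim {:V}) := \matrix_i rVof e (vbasis L)`_i.
have BE : (B :=: msof e L)%MS.
  apply/eqmxP/andP; split; [apply/row_subP => i|apply/rV_subP => v].
    by rewrite rowK -mem_vecof// rVofK// vbasis_mem// mem_nth// size_tuple.
  rewrite -mem_vecof// => /coord_vbasis vE; apply/submxP.
  exists (\row_i coord (vbasis L) i (vecof e v)).
  rewrite -[LHS](vecofK eb) {1}vE linear_sum mulmx_sum_row.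
  by apply: eq_bigr => i _; rewrite linearZ /= rowK mxE.
rewrite -BE; apply/eqP/row_freeP; apply/row_freeP/inj_row_free => v vB.
have : \sum_i v 0 i *: (vbasis L)`_i = 0.
  apply: (can_inj (rVofK eb)); rewrite linear0 linear_sum -[RHS]vB mulmx_sum_row.
  by apply: eq_bigr => i _; rewrite linearZ /= rowK.
have /freeP fr := basis_free (vbasisP L).
move/(fr (fun i => v 0 i)) => v0.
by apply/rowP => i; rewrite mxE v0.
Qed.

Lemma dim_vsof (W : 'M[R]_(\dim {:V})) : \dim (vsof e W) = \rank W.
Proof. by rewrite -rank_msof (eqmxP (vsofK eb W)). Qed.

(** Lets the condition defining [SL], stated in [vbasis], be read in an orthonormal basis. *)
Lemma det_mxof_basis (b : (\dim {:V}).-tuple V) (g : 'End(V)) :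
  basis_of {:V} b -> \det (mxof e e g) = \det (mxof b b g).
Proof.
move=> bb; have -> : mxof e e g = mxof e b \1%VF *m mxof b b g *m mxof b e \1%VF.
  by rewrite -!mxof_comp// comp_lfun1l comp_lfun1r.
rewrite !det_mulmx mulrAC -det_mulmx -mxof_comp// comp_lfun1l mxof1 ?det1 ?mul1r//.
exact: basis_free eb.
Qed.

End Basis.

(** With S the Cholesky factor of the Gram matrix of [vbasis], the rows of S^-1 are the coordinates
    of the new basis. *)
Lemma orthonormal_basis (E : euclidean R) :
  exists e : (\dim {:E}).-tuple E, basis_of {:E} e /\
    forall u v, edot E u v = std_dot (rVof e u) (rVof e v).
Proof.
pose b := vbasis {:E}; have bb : basis_of {:E} b := vbasisP _.
pose G : 'M[R]_(\dim {:E}) := \matrix_(i, j) edot E b`_i b`_j.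
have GE u v : edot E u v = std_dot (rVof b u *m G) (rVof b v).
  rewrite -{1}(rVofK bb u) -{1}(rVofK bb v) /vecof std_dotE.
  rewrite linear_sumr; apply: eq_bigr => j _.
  rewrite linearZr /= mulrC; congr (_ * _).
  rewrite linear_sumlz mxE; apply: eq_bigr => i _.
  by rewrite linearZl_LR /= [G _ _]mxE.
have sym u v : edot E u v = edot E v u.
  by rewrite (hermC (edot E)) /= expr0 mul1r.
have [||S Su SE] := @cholesky _ _ G.
- by apply/matrixP => i j; rewrite !mxE sym.
- move=> v v0; have -> : (v *m G *m v^T) 0 0 = edot E (vecof b v) (vecof b v).
    by rewrite GE vecofK.
  by apply: (neq0_dnorm_gt0 (s := edot E)); rewrite vecof_eq0.
pose e := [tuple vecof b (row i (invmx S)) | i < \dim {:E}].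
have eE c : vecof e c = vecof b (c *m invmx S).
  rewrite mulmx_sum_row linear_sum; apply: eq_bigr => i _.
  rewrite linearZ /=; congr (_ *: _).
  by rewrite -[RHS](tnth_mktuple (fun i => vecof b (row i (invmx S)))) (tnth_nth 0).
have eb : basis_of {:E} e.
  rewrite basisEfree subvf size_tuple leqnn !andbT; apply/freeP => k k0 i.
  have : vecof e (\row_i k i) = 0.
    by rewrite -[RHS]k0; apply: eq_bigr => j _; rewrite mxE.
  rewrite eE => /eqP; rewrite vecof_eq0// => /eqP kS.
  have : \row_i k i = 0 :> 'rV_(\dim {:E}).
    by rewrite -[LHS](mulmxKV Su) kS mul0mx.
  by move/rowP => /(_ i); rewrite !mxE.
exists e; split => // u v.
rewrite -{1}(rVofK eb u) -{1}(rVofK eb v) !eE GE !vecofK// SE mulmxA mulmxKV//.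
by rewrite std_dotMr trmxK -mulmxA mulVmx// mulmx1.
Qed.

End Coordinates.

(** * Normalising the determinant *)

Section NormalizeDet.
Context d (T : measurableType d) (R : realType) (P : probability T R) (kp : R).
Context (D : set T) (mD : measurable D) (m : nat) (x : T -> 'rV[R]_m).
Context (mx : dirmeas D x).

(** Entry (i, j) of the average is multiplied by s_i s_j, which is 1 on the diagonal; the other
    entries are 0. *)
Lemma avg_reflection (z : T -> 'rV[R]_m) (s : 'rV[R]_m) : dirmeas D z ->
  (forall i, s 0 i ^+ 2 = 1) ->
  avg P D z = kp%:M -> avg P D (fun t => z t *m diag_mx s) = kp%:M.
Proof.
move=> mz s1 ax; have ss (y : 'rV_m) : std_dot (y *m diag_mx s) (y *m diag_mx s) = std_dot y y.
  rewrite !std_dotE; apply: eq_bigr => i _; rewrite mul_mx_diag !mxE.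
  by rewrite mulrACA -[s 0 i * _]expr2 s1 mulr1.
apply/matrixP => i j; rewrite mxE.
have -> : \int[P]_(t in D) dirmx (z t *m diag_mx s) i j = s 0 i * s 0 j * avg P D z i j.
  rewrite mxE -bddZ//; last exact: dirmeas_bdd.
  apply: eq_Rint => t _; rewrite !dirmxE ss mul_mx_diag !mxE; ring.
rewrite ax mxE; case: eqVneq => [->|_]; last by rewrite mulr0.
by rewrite -expr2 s1 mul1r.
Qed.

(** Reflects one coordinate when [r] is negative: in even dimension no rescaling changes the sign of
    a determinant. *)
Definition sign_row (m0 : (0 < m)%N) (r : R) : 'rV[R]_m :=
  \row_i (if i == Ordinal m0 then Num.sg r else 1).

Lemma sign_row_sqr (m0 : (0 < m)%N) (r : R) i : r != 0 ->
  sign_row m0 r 0 i ^+ 2 = 1.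
Proof. by move=> r0; rewrite mxE; case: ifP => _; rewrite ?expr1n// sqr_sg r0. Qed.

Lemma det_sign_scale (m0 : (0 < m)%N) g : \det g != 0 ->
  \det (`|\det g| `^ (- m%:R^-1) *: (g *m diag_mx (sign_row m0 (\det g)))) = 1.
Proof.
move=> dg; rewrite detZ det_mulmx det_diag (bigD1 (Ordinal m0))//= big1; last first.
  by move=> i /negPf im; rewrite mxE im.
rewrite mxE eqxx mulr1 [\det g * _]mulrC -normrEsg.
rewrite -powR_mulrn ?powR_ge0// -powRrM mulNr mulVf ?pnatr_eq0 -?lt0n// powR_inv1//.
by rewrite mulVf// normr_eq0.
Qed.

Lemma balanced_det1 g : (0 < m)%N -> g \in unitmx ->
  avg P D (fun t => x t *m g) = kp%:M ->
  exists2 g', \det g' = 1 & avg P D (fun t => x t *m g') = kp%:M.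
Proof.
move=> m0; rewrite unitmxE unitfE => dg ag; eexists; first exact: (det_sign_scale m0 dg).
have my : dirmeas D (fun t => x t *m g) by apply: dirmeasM; rewrite // unitmxE unitfE.
rewrite -[RHS](avg_reflection my (fun i => sign_row_sqr m0 i dg) ag).
rewrite -[RHS](@avg_scale _ _ _ P D _ _ (fun=> `|\det g| `^ (- m%:R^-1))).
  by congr avg; apply/funext => t; rewrite -scalemxAr mulmxA.
by move=> t _; rewrite gt_eqF// powR_gt0// normr_gt0.
Qed.

End NormalizeDet.

Section Push.
Context d d' (T : measurableType d) (T' : measurableType d') (R : realType).

Lemma prob_push (P : probability T R) (f : T -> T') : measurable_fun setT f ->
  exists P' : probability T' R, forall B, P' B = P (f @^-1` B).
Proof.
move=> mf; have fP : f \in mfun by exact: mem_set.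
by exists (distribution P (mfun_Sub fP)).
Qed.

Lemma Rint_push (P : probability T R) (P' : probability T' R) (f : T -> T')
    (h : T' -> R) : measurable_fun setT f ->
  (forall B, measurable B -> P' B = P (f @^-1` B)) ->
  bdd_meas setT h -> \int[P']_y h y = \int[P]_x h (f x).
Proof.
move=> mf PE bh; rewrite /Rintegral; congr fine.
rewrite (eq_measure_integral (pushforward P f)) => [|B mB _]; last exact: PE.
have bhf : bdd_meas setT (h \o f).
  case: bh => mh [M hM]; split; first exact: measurableT_comp.
  by exists M => t _; exact: hM.
rewrite integral_pushforward//; first by apply/measurable_EFinP; case: bh.
exact: bdd_meas_integrable bhf.
Qed.

End Push.

Section Projective.
Import passmx.
Context (R : realType) (E : euclidean R).
Context (e : (\dim {:E}).-tuple E) (eb : basis_of {:E} e).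
Notation m := (\dim {:E}).

Lemma dim_proj (p : proj_space E) : \dim (val p) = 1%N.
Proof. by case: p => l /= /eqP. Qed.

Lemma line_repr (p : proj_space E) : val p = <[proj_repr p]>%VS.
Proof.
apply/esym/eqP; rewrite eqEdim -memvE memv_pick dim_vline vpick0 -dimv_eq0.
by rewrite dim_proj.
Qed.

Lemma proj_repr_neq0 (p : proj_space E) : proj_repr p != 0.
Proof. by rewrite vpick0 -dimv_eq0 dim_proj. Qed.

Lemma proj_classK (p : proj_space E) : proj_class (proj_repr p) = p.
Proof. by apply: val_inj; rewrite val_insubd -line_repr dim_proj. Qed.

Lemma vlineZ (c : R) (u : E) : c != 0 -> <[c *: u]>%VS = <[u]>%VS.
Proof.
move=> c0; apply/eqP; rewrite eqEsubv; apply/andP; split.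
  by rewrite -memvE memvZ ?memv_line.
by rewrite -memvE -{1}[u](scale1r) -(mulVf c0) -scalerA memvZ ?memv_line.
Qed.

Lemma proj_classZ (c : R) (u : E) : c != 0 -> proj_class (c *: u) = proj_class u.
Proof. by move=> c0; rewrite /proj_class vlineZ. Qed.

Lemma val_proj_class (u : E) : u != 0 -> val (proj_class u) = <[u]>%VS.
Proof. by move=> u0; rewrite val_insubd dim_vline u0. Qed.

Lemma proj_repr_class (u : E) : u != 0 ->
  exists2 c, c != 0 & proj_repr (proj_class u) = c *: u.
Proof.
move=> u0; have : proj_repr (proj_class u) \in val (proj_class u) by exact: memv_pick.
rewrite val_proj_class// => /vlineP[c cE]; exists c => //.
by apply: contraNneq (proj_repr_neq0 (proj_class u)) => c0; rewrite cE c0 scale0r.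
Qed.

(** [proj_repr] is an arbitrary choice on each line; [conic_pcoord] states the measurability that is
    independent of it. *)
Definition pcoord (p : proj_borel E) : 'rV[R]_m := rVof e (proj_repr p).

Lemma pcoord_neq0 p : pcoord p != 0.
Proof. by rewrite rVof_eq0// proj_repr_neq0. Qed.

Lemma pcoordK p : proj_class (vecof e (pcoord p)) = p.
Proof. by rewrite rVofK// proj_classK. Qed.

Lemma pcoord_class (v : 'rV[R]_m) : v != 0 ->
  exists2 c, c != 0 & pcoord (proj_class (vecof e v)) = c *: v.
Proof.
move=> v0; have [|c c0 cE] := @proj_repr_class (vecof e v); first by rewrite vecof_eq0.
by exists c => //; rewrite /pcoord cE linearZ /= vecofK.
Qed.

Lemma proj_class_vecofZ (c : R) (v : 'rV[R]_m) : c != 0 ->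
  proj_class (vecof e (c *: v)) = proj_class (vecof e v).
Proof. by move=> c0; rewrite linearZ /= proj_classZ. Qed.

Definition lift_set (B : set (proj_space E)) : set 'rV[R]_m :=
  [set v | v != 0 /\ B (proj_class (vecof e v))].

(** The topology of [proj_space] is defined in the coordinates of [vbasis]; passing to [e] is a
    linear, hence continuous, change of variables. *)
Lemma conic_lift (B : set (proj_space E)) : open B -> conic (lift_set B).
Proof.
move=> oB; split=> [|c v c0 [v0 Bv]]; last first.
  by split; [rewrite scaler_eq0 negb_or c0|rewrite proj_class_vecofZ].
pose b := vbasis {:E}; have bb : basis_of {:E} b := vbasisP _.
pose M := mxof e b \1%VF.
have ME v : vecof e v = vecof b (v *m M).
  by rewrite mul_mxof rVofK// lfunE.
rewrite (_ : lift_set B = [set v | [set c | c != 0 /\ B (proj_class (vecof b c))] (v *m M)]).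
  by apply: open_comp => [v _|]; [exact: rv_cvgM|exact: oB].
apply/seteqP; split => v /=; rewrite /lift_set /= ME.
  by move=> [v0 Bv]; split => //; rewrite -(vecof_eq0 bb) -ME vecof_eq0.
by move=> [v0 Bv]; split => //; rewrite -(vecof_eq0 eb) ME vecof_eq0.
Qed.

Lemma open_of_conic (U : set 'rV[R]_m) : conic U ->
  open ([set p | U (pcoord p)] : set (proj_space E)).
Proof.
move=> [oU cU].
pose b := vbasis {:E}; have bb : basis_of {:E} b := vbasisP _.
pose M := mxof b e \1%VF.
have ME v : rVof e (vecof b v) = v *m M by rewrite mul_mxof lfunE.
suff : Defs.proj_open [set p | U (pcoord p)] by [].
rewrite /Defs.proj_open (_ : mkset _ = [set c | c != 0] `&` [set c | U (c *m M)]).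
  apply: openI; first exact: open_neq0.
  by apply: open_comp => // v _; exact: rv_cvgM.
apply/seteqP; split => v [v0 /=]; have [|c c0 cE] := @proj_repr_class (vecof b v);
  rewrite ?vecof_eq0// /pcoord cE linearZ /= ME => Uv; split => //.
  by rewrite -[_ *m M](scalerK c0) ; apply: cU => //; rewrite invr_neq0.
exact: cU.
Qed.

Lemma proj_open_meas (B : set (proj_space E)) : open B ->
  measurable (B : set (proj_borel E)).
Proof. by move=> oB; apply: sub_sigma_algebra. Qed.

Lemma conic_pcoord : conic_meas setT pcoord.
Proof.
split=> [p _|U cU]; first exact: pcoord_neq0.
by rewrite setTI; apply: proj_open_meas; exact: open_of_conic.
Qed.

Lemma measurable_class d (T : measurableType d) (y : T -> 'rV[R]_m) :
  (forall U, conic U -> ~ U 0 -> measurable (y @^-1` U)) ->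
  measurable_fun setT (fun t => proj_class (vecof e (y t)) : proj_borel E).
Proof.
move=> my; apply: (@measurability _ _ T (proj_borel E) setT _ (@open (proj_space E)) erefl) => _ [B oB <-].
rewrite setTI.
(* Where [y t] is 0, [proj_class] takes its default value, so the preimage splits accordingly. *)
have -> : (fun t => proj_class (vecof e (y t)) : proj_borel E) @^-1` B =
    (y @^-1` lift_set B) `|`
    (~` (y @^-1` [set v | v != 0]) `&` [set _ | B (proj_class 0)]).
  apply/seteqP; split => t /=.
    have [->|y0] := eqVneq (y t) 0.
      by rewrite linear0; right; split => //=; rewrite eqxx.
    by left.
  move=> [[] //|[/negP]]; rewrite negbK => /eqP ->; by rewrite linear0.
apply: measurableU.
  by apply: my; [exact: conic_lift|case=> /eqP].
apply: measurableI.
  apply: measurableC; apply: my => /=; last by rewrite eqxx.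
  by split; [exact: open_neq0|move=> c v c0 v0; rewrite /= scaler_eq0 negb_or c0].
have [h|h] := pselect (B (proj_class 0)).
  rewrite [X in measurable X](_ : _ = setT)//.
  by apply/seteqP; split.
rewrite [X in measurable X](_ : _ = set0)//.
by apply/seteqP; split.
Qed.

Lemma proj_subE (L : {vspace E}) :
  proj_sub L = [set p | (pcoord p <= msof e L)%MS].
Proof.
apply/seteqP; split => p; rewrite /proj_sub /= line_repr -memvE -mem_vecof//;
  by rewrite /pcoord rVofK.
Qed.

Lemma mass_proj_sub (nu : proj_prob E) (L : {vspace E}) :
  mass nu setT pcoord (msof e L) = fine (nu (proj_sub L)).
Proof. by rewrite /mass setTI proj_subE. Qed.

Lemma measurable_proj_sub (L : {vspace E}) : measurable (proj_sub L).
Proof.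
rewrite proj_subE -[X in measurable X]setTI; apply: measurable_sub => //.
by apply: conic_dirmeas => //; exact: conic_pcoord.
Qed.

End Projective.

Section ProjMap.
Import passmx.
Context (R : realType) (E F : euclidean R).

Lemma proj_mapE (f : 'Hom(E, F)) (p : proj_borel E) :
  proj_map f p = proj_class (f (proj_repr p)).
Proof. by rewrite /proj_map line_repr limg_line. Qed.

Lemma measurable_proj_map (f : 'Hom(E, F)) : measurable_fun setT (proj_map f).
Proof.
have eb : basis_of {:E} (vbasis {:E}) := vbasisP _.
have eb' : basis_of {:F} (vbasis {:F}) := vbasisP _.
pose M := mxof (vbasis {:E}) (vbasis {:F}) f.
have -> : proj_map f = fun p => proj_class (vecof (vbasis {:F}) (pcoord (vbasis {:E}) p *m M)).
  by apply/funext => p; rewrite proj_mapE -hom_vecof// rVofK.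
apply: measurable_class => // U cU _.
rewrite -[X in measurable X]setTI.
exact: (conic_pcoord eb).2 (conic_preimage M cU).
Qed.

End ProjMap.

(** * The gradient map and balanced fields *)

Section Gradient.
Import passmx.
Context (R : realType) (E : euclidean R).
Context (e : (\dim {:E}).-tuple E) (eb : basis_of {:E} e).
Context (eo : forall u v, edot E u v = std_dot (rVof e u) (rVof e v)).
Notation m := (\dim {:E}).
Notation kp := (m%:R^-1 : R).

Lemma dirmeas_pcoord : dirmeas setT (pcoord e).
Proof. exact: conic_dirmeas (conic_pcoord eb). Qed.

Lemma grad_mapE (p : proj_borel E) :
  grad_map p = 2^-1 *: (hommx e e (dirmx (pcoord e p)) - kp *: \1%VF).
Proof.
rewrite /grad_map; congr (_ *: (_ - _)); set x := proj_repr p.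
pose f (v : E) : E := edot E v x *: x.
have flin : linear f.
  by move=> a u v; rewrite /f linearPl /= scalerDl scalerA.
(* [linfun] can be evaluated only once its argument is known to be linear. *)
pose F : {linear E -> E} := HB.pack f
  (GRing.isSemilinear.Build R E E _ f (GRing.semilinear_linear flin)).
apply/lfunP => v; rewrite scale_lfunE -/f (lfunE F) /= /f.
apply: (can_inj (rVofK eb)); rewrite -rVof_mul// linearZ /= linearZ /=.
rewrite !eo -/(pcoord e p) /dirmx -scalemxAr mulmxA; congr (_ *: _).
by rewrite [rVof e v *m _]mx11_scalar mul_scalar_mx.
Qed.

Lemma grad_int_eq0 (nu : proj_prob E) :
  grad_int nu = 0 <-> avg nu setT (pcoord e) = kp%:M.
Proof.
set A := avg _ _ _.
suff -> : grad_int nu = 2^-1 *: (hommx e e A - kp *: \1%VF).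
  rewrite -(hommx1 eb) -linearZ -linearB /= scalemx1; split.
    move/eqP; rewrite scaler_eq0 invr_eq0 pnatr_eq0 /= hommx_eq0// subr_eq0.
    by move/eqP.
  by move=> ->; rewrite subrr linear0 scaler0.
rewrite [RHS](coord_vbasis (memvf _)) /grad_int /vintegral.
apply: eq_bigr => i _; congr (_ *: _).
(* A coordinate of End(E) is linear in the matrix entries, so it commutes with the entrywise
   integral [A]. *)
pose l (M : 'M[R]_m) : R := coord (vbasis {:'End(E)}) i (2^-1 *: hommx e e M).
have lE M : l M = \sum_j \sum_k M j k * l (delta_mx j k).
  rewrite /l {1}[M]matrix_sum_delta; rewrite !linear_sum; apply: eq_bigr => j _.
  rewrite !linear_sum; apply: eq_bigr => k _.
  by rewrite !linearZ /= mulrCA.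
have b0 j k : bdd_meas setT (fun p => l (delta_mx j k) * dirmx (pcoord e p) j k).
  by apply: bdd_measZ; exact: dirmeas_bdd dirmeas_pcoord.
under eq_Rint do rewrite grad_mapE scalerBr linearB /= -/(l _) lE.
rewrite bddB//; last exact: bdd_meas_cst.
  rewrite Rintegral_cst// [X in fine X]probability_setT mulr1.
  rewrite scalerBr linearB /= -/(l _) lE; congr (_ - _).
  rewrite bdd_sum// => [|j]; last first.
    by apply: bdd_meas_sum => k; under eq_fun do rewrite mulrC; exact: b0.
  apply: eq_bigr => j _; rewrite bdd_sum// => [|k]; last first.
    by under eq_fun do rewrite mulrC; exact: b0.
  apply: eq_bigr => k _; rewrite mxE mulrC -bddZ//; last exact: dirmeas_bdd dirmeas_pcoord.
  by apply: eq_Rint => p _; rewrite mulrC.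
apply: bdd_meas_sum => j; apply: bdd_meas_sum => k.
by under eq_fun do rewrite mulrC; exact: b0.
Qed.

Lemma pcoord_proj_map (f : 'End(E)) (p : proj_borel E) : mxof e e f \in unitmx ->
  exists2 c, c != 0 & pcoord e (proj_map f p) = c *: (pcoord e p *m mxof e e f).
Proof.
move=> fu; rewrite proj_mapE -{1}(rVofK eb (proj_repr p)) (@hom_vecof _ _ _ e e eb) -/(pcoord e p).
apply: pcoord_class => //; apply: contra (pcoord_neq0 eb p) => /eqP h.
by rewrite -(mulmxK fu (pcoord e p)) h mul0mx.
Qed.

Lemma avg_translate (f : 'End(E)) (nu nu' : proj_prob E) (G : 'M[R]_m) :
  mxof e e f \in unitmx -> G \in unitmx -> is_translate f nu nu' ->
  avg nu' setT (fun p => pcoord e p *m G) =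
  avg nu setT (fun p => pcoord e p *m (mxof e e f *m G)).
Proof.
move=> fu Gu tr; apply/matrixP => i j; rewrite !mxE.
rewrite (Rint_push (measurable_proj_map f) tr); last first.
  exact: dirmeas_bdd (dirmeasM Gu dirmeas_pcoord).
apply: eq_Rint => p _; have [c c0 ->] := pcoord_proj_map p fu.
by rewrite -scalemxAl dirmxZ// mulmxA.
Qed.

Lemma SL_mxof g : SL g <-> \det (mxof e e g) = 1.
Proof. by rewrite (det_mxof_basis eb g (vbasisP _)). Qed.

Lemma SL_unit g : SL g -> mxof e e g \in unitmx.
Proof. by move=> /SL_mxof h; rewrite unitmxE h unitr1. Qed.

Lemma translate_exists (g : 'End(E)) (nu : proj_prob E) :
  exists nu', is_translate g nu nu'.
Proof.
have [nu' nuE] := prob_push nu (measurable_proj_map g).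
by exists nu' => B _; exact: nuE.
Qed.

(** A change of variables moves the integral from the translate back to [nu], turning the orbit
    condition into the existence of a balancing matrix. *)
Lemma polystableP (nu : proj_prob E) : polystable nu <->
  exists2 G : 'M[R]_m, \det G = 1 &
    avg nu setT (fun p => pcoord e p *m G) = kp%:M.
Proof.
split=> [[nu' [[g Sg tr] /grad_int_eq0 h]]|[G G1 bG]].
  exists (mxof e e g); first exact/SL_mxof.
  have := avg_translate (SL_unit Sg) (unitmx1 _ _) tr; rewrite mulmx1 => <-.
  by rewrite -h; congr avg; apply/funext => p; rewrite mulmx1.
have [nu' tr] := translate_exists (hommx e e G) nu.
exists nu'; split.
  by exists (hommx e e G) => //; apply/SL_mxof; rewrite hommxK.
apply/grad_int_eq0; have Gu : mxof e e (hommx e e G) \in unitmx.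
  by rewrite hommxK// unitmxE G1 unitr1.
have := avg_translate Gu (unitmx1 _ _) tr; rewrite mulmx1 hommxK// bG => <-.
by congr avg; apply/funext => p; rewrite mulmx1.
Qed.

Lemma mass_mulr d (T : measurableType d) (P : probability T R)
    (D : set T) (y : T -> 'rV[R]_m) (W G : 'M[R]_m) : G \in unitmx ->
  mass P D (fun t => y t *m G) (W *m G) = mass P D y W.
Proof.
move=> Gu; congr (fine (P _)); apply/seteqP; split => t /= [Dt h]; split => //;
  by move: h; rewrite submxMfree// row_free_unit.
Qed.

Lemma mass_vsof (nu : proj_prob E) (W : 'M[R]_m) :
  mass nu setT (pcoord e) W = fine (nu (proj_sub (vsof e W))).
Proof.
rewrite -(mass_proj_sub eb); congr (fine (nu _)); apply/seteqP.
by split => t /= [_ h]; split => //; move: h; rewrite (eqmxP (vsofK eb W)).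
Qed.

End Gradient.

(** * Stability *)

Section MatrixExp.
Context (R : realType) (m : nat).
Implicit Types A B : 'M[R]_m.

(** Matrices act on row vectors: composing on the left, as in [lfun_exp], multiplies the matrix on
    the right. *)
Definition mpow A k : 'M[R]_m := iter k (mulmx^~ A) 1%:M.

Definition expmx_sum A N : 'M[R]_m := \sum_(k < N) (k`!%:R)^-1 *: mpow A k.

Lemma norm1_mulmx A B : norm1 (A *m B) <= norm1 A * norm1 B.
Proof.
rewrite {1}/norm1 [norm1 A]/norm1 mulr_suml; apply: ler_sum => i _.
rewrite (le_trans (_ : _ <= \sum_j \sum_k `|A i k| * `|B k j|))//.
  apply: ler_sum => j _; rewrite mxE (le_trans (ler_norm_sum _ _ _))//.
  by apply: ler_sum => k _; rewrite normrM.
rewrite exchange_big /= mulr_suml; apply: ler_sum => k _.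
rewrite -mulr_sumr ler_wpM2l// /norm1 [leRHS](bigD1 k)//= lerDl.
by apply: sumr_ge0 => l _; exact: sumr_ge0.
Qed.

Lemma mpow_bound A k i j : `|mpow A k i j| <= norm1 (1%:M : 'M[R]_m) * norm1 A ^+ k.
Proof.
rewrite (le_trans (norm1_coord _ _ _))//; elim: k {i j} => [|k ih].
  by rewrite expr0 mulr1.
by rewrite /= (le_trans (norm1_mulmx _ _))// exprSr mulrA ler_wpM2r ?norm1_ge0.
Qed.

(** The second-order remainder serves to differentiate t |-> exp (t A) at 0. The factor [norm1 1%:M]
    appears because [norm1] of the identity is m. *)
Lemma expmx_cvg A : exists2 M, mxcvg (expmx_sum A) M &
  forall i j, `|M i j - (1%:M + A) i j| <=
    norm1 (1%:M : 'M[R]_m) * (norm1 A ^+ 2 * expR (norm1 A)).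
Proof.
set c := norm1 1%:M; set a := norm1 A.
have a0 : 0 <= a by exact: norm1_ge0.
have c0 : 0 <= c by exact: norm1_ge0.
pose u i j k := (k`!%:R)^-1 * mpow A k i j.
have uE i j N : expmx_sum A N i j = series (u i j) N.
  rewrite /expmx_sum summxE seriesEord; apply: eq_bigr => k _.
  by rewrite mxE.
have ub i j k : `|u i j k| <= c * exp_coeff a k.
  rewrite normrM ger0_norm ?invr_ge0//.
  have -> : c * exp_coeff a k = (k`!%:R)^-1 * (c * a ^+ k).
    by rewrite /exp_coeff /= mulrA mulrC.
  by rewrite ler_wpM2l ?invr_ge0// mpow_bound.
have cv i j : cvgn (series (u i j)).
  apply: normed_cvg; apply: (@series_le_cvg _ _ (fun k => c * exp_coeff a k)).
  - by move=> k /=.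
  - by move=> k; rewrite mulr_ge0// exp_coeff_ge0.
  - exact: ub.
  - by apply: is_cvg_seriesZ; exact: is_cvg_series_exp_coeff.
pose M : 'M[R]_m := \matrix_(i, j) limn (series (u i j)).
have hM : mxcvg (expmx_sum A) M.
  move=> i j; rewrite mxE; under eq_fun do rewrite uE; exact: cv.
exists M => // i j.
(* In the term of index k + 2, a^2 factors out and k! <= (k + 2)! compares the rest with the
   exponential series. *)
have part N : `|series (u i j) N.+2 - (1%:M + A) i j| <=
    c * (a ^+ 2 * series (exp_coeff a) N).
  elim: N => [|N ih].
    rewrite !seriesEord /= !big_ord_recr !big_ord0 /= /u /mpow /= mul1mx add0r.
    by rewrite invr1 !mul1r [(_ + A) i j]mxE subrr normr0 !mulr0.
  rewrite seriesSr [series (exp_coeff a) N.+1]seriesSr !mulrDr addrAC.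
  rewrite (le_trans (ler_normD _ _))// lerD// (le_trans (ub _ _ _))// ler_wpM2l//.
  rewrite /exp_coeff /= mulrA -exprD add2n ler_wpM2l ?exprn_ge0//.
  rewrite lef_pV2 ?posrE ?ltr0n ?fact_gt0// ler_nat.
  by rewrite !factS mulnA leq_pmull.
have le_exp N : series (exp_coeff a) N <= expR a.
  apply: nondecreasing_cvgn_le; last exact: is_cvg_series_exp_coeff.
  by apply: nondecreasing_series => k _ _; exact: exp_coeff_ge0.
have h : `|series (u i j) N.+2 - (1%:M + A) i j| @[N --> \oo] -->
    `|M i j - (1%:M + A) i j|.
  apply: cvg_norm; apply: cvgB; last exact: cvg_cst.
  have := hM i j; under eq_fun do rewrite uE.
  by rewrite -(cvg_shiftn 2); under eq_fun do rewrite addn2.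
apply: (cvgr_to_le h); apply: nearW => N.
by rewrite (le_trans (part N))// ler_wpM2l// ler_wpM2l ?exprn_ge0.
Qed.

Lemma mpow_diag (s : 'rV[R]_m) k : mpow (diag_mx s) k = diag_mx (\row_i s 0 i ^+ k).
Proof.
elim: k => [|k ih].
  by apply/matrixP => i j; rewrite !mxE expr0.
rewrite /= -/(mpow _ _) ih; apply/matrixP => i j.
rewrite mul_mx_diag !mxE exprSr; case: eqVneq => [->|_]; first by rewrite !mulr1n.
by rewrite mulr0n mul0r.
Qed.

Lemma expmx_diag (s : 'rV[R]_m) :
  mxcvg (expmx_sum (diag_mx s)) (diag_mx (\row_i expR (s 0 i))).
Proof.
move=> i j; rewrite !mxE.
have E N : expmx_sum (diag_mx s) N i j = series (exp_coeff (s 0 i)) N *+ (i == j).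
  rewrite summxE seriesEord /= -sumrMnl; apply: eq_bigr => k _.
  by rewrite mpow_diag !mxE mulrC mulrnAl.
under eq_fun do rewrite E; case: eqVneq => _; last by rewrite mulr0n; exact: cvg_cst.
by rewrite mulr1n; exact: is_cvg_series_exp_coeff.
Qed.

End MatrixExp.

Section LinearExp.
Import passmx.
Context (R : realType) (V : vectType R) (e : (\dim {:V}).-tuple V).
Context (eb : basis_of {:V} e).

Lemma vlim_mx (u : nat -> 'End(V)) (M : 'M[R]_(\dim {:V})) :
  mxcvg (fun k => mxof e e (u k)) M -> vlim u = hommx e e M.
Proof.
move=> hu; rewrite [RHS](coord_vbasis (memvf _)) /vlim.
apply: eq_bigr => i _; congr (_ *: _).
pose l (N : 'M[R]_(\dim {:V})) : R := coord (vbasis {:'End(V)}) i (hommx e e N).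
have lE N : l N = \sum_j \sum_k N j k * l (delta_mx j k).
  rewrite /l {1}[N]matrix_sum_delta; rewrite !linear_sum; apply: eq_bigr => j _.
  rewrite !linear_sum; apply: eq_bigr => k _.
  by rewrite !linearZ.
apply/cvg_lim => //; rewrite -/(l M) lE.
under eq_fun do rewrite -[u _](mxofK eb eb) -/(l _) lE.
by apply: cvg_sumr => j; apply: cvg_sumr => k; apply: cvgM; [exact: hu|exact: cvg_cst].
Qed.

Lemma lfun_exp_mx (X : 'End(V)) (M : 'M[R]_(\dim {:V})) :
  mxcvg (expmx_sum (mxof e e X)) M -> lfun_exp X = hommx e e M.
Proof.
move=> hM; apply: vlim_mx => i j.
have E N : mxof e e (\sum_(k < N) (k`!%:R)^-1 *: iter k (comp_lfun X) \1%VF) =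
    expmx_sum (mxof e e X) N.
  rewrite linear_sum /=; apply: eq_bigr => k _; rewrite linearZ /=; congr (_ *: _).
  elim: (nat_of_ord k) => [|l ih] /=; first by rewrite mxof1// (basis_free eb).
  by rewrite (@mxof_comp _ _ _ _ e e e eb) ih.
by under eq_fun do rewrite E; exact: hM.
Qed.

End LinearExp.

Section Stable.
Import passmx.
Context (R : realType) (E : euclidean R).
Context (e : (\dim {:E}).-tuple E) (eb : basis_of {:E} e).
Context (eo : forall u v, edot E u v = std_dot (rVof e u) (rVof e v)).
Notation m := (\dim {:E}).
Notation kp := (m%:R^-1 : R).
Implicit Types (nu : proj_prob E).

Lemma mass_coord nu (G W : 'M[R]_m) : G \in unitmx ->
  exists2 L : {vspace E}, \dim L = \rank W &
    mass nu setT (fun p => pcoord e p *m G) W = fine (nu (proj_sub L)).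
Proof.
move=> Gu; exists (vsof e (W *m invmx G)).
  by rewrite dim_vsof// mxrankMfree// row_free_unit unitmx_inv.
by rewrite -{1}(mulmxKV Gu W) mass_mulr// mass_vsof.
Qed.

Lemma coord_mass nu (G : 'M[R]_m) (L : {vspace E}) : G \in unitmx ->
  \rank (msof e L *m G) = \dim L /\
  mass nu setT (fun p => pcoord e p *m G) (msof e L *m G) = fine (nu (proj_sub L)).
Proof.
move=> Gu; split; first by rewrite mxrankMfree ?row_free_unit// rank_msof.
by rewrite mass_mulr// mass_proj_sub.
Qed.

Lemma prob_dim nu : fine (nu setT) = kp * m%:R.
Proof.
by rewrite [nu _]probability_setT mulVf// pnatr_eq0 -lt0n (edim_gt0 E).
Qed.

(** If exp (t X) fixes [nu], its conjugate by the balancing map [G] fixes the balanced field, hence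
    is orthogonal; the derivative at t = 0 of these conjugates is skew. *)
Lemma stable_of_strict nu :
  (forall L : {vspace E}, (0 < \dim L < m)%N ->
    fine (nu (proj_sub L)) < kp * (\dim L)%:R) -> stable nu.
Proof.
move=> strict; have m0 := edim_gt0 E.
have mx := dirmeas_pcoord eb.
have strictG G : G \in unitmx -> forall W : 'M[R]_m, (0 < \rank W < m)%N ->
    mass nu setT (fun p => pcoord e p *m G) W < kp * (\rank W)%:R.
  by move=> Gu W; have [L <- ->] := mass_coord nu W Gu; exact: strict.
have [g0 g0_gt0 bg0] : exists2 g, 0 < \det g &
    avg nu setT (fun p => pcoord e p *m g) = kp%:M.
  apply: strict_balanced => //; first exact: prob_dim.
  move=> W hW; have := strictG 1%:M (unitmx1 _ _) W hW; rewrite /mass.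
  by under eq_set do rewrite mulmx1.
have [|G G1 bG] := balanced_det1 measurableT mx m0 _ bg0.
  by rewrite unitmxE unitfE gt_eqF.
have Gu : G \in unitmx by rewrite unitmxE G1 unitr1.
split; first by apply/(polystableP eb eo); exists G.
pose g := hommx e e G; have gE : mxof e e g = G by rewrite hommxK.
exists g; first by apply/(SL_mxof eb); rewrite gE.
move=> X stX; pose A := mxof e e X.
pose y p := pcoord e p *m G.
have my : dirmeas setT y by exact: dirmeasM.
have orth (t : R) M : mxcvg (expmx_sum (t *: A)) M ->
    (invmx G *m M *m G) *m (invmx G *m M *m G)^T = 1%:M.
  move=> hM; have [SLt tr] := stX t.
  have expE : lfun_exp (t *: X) = hommx e e M.
    by apply: lfun_exp_mx => //; rewrite linearZ.
  rewrite expE in SLt tr.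
  have M1 : \det M = 1 by move/(SL_mxof eb): SLt; rewrite hommxK.
  have Mu : M \in unitmx by rewrite unitmxE M1 unitr1.
  apply: (balanced_unique measurableT m0 my bG) => //; last exact: strictG.
    have fu : mxof e e (hommx e e M) \in unitmx by rewrite hommxK.
    have trE := avg_translate eb fu Gu tr; rewrite -bG trE (hommxK eb eb).
    by congr avg; apply/funext => p; rewrite /y !mulmxA mulmxK.
  by rewrite !det_mulmx M1 mulr1 -det_mulmx mulVmx// det1.
pose Y := invmx G *m A *m G.
have /choice[M_ hM_] (n : nat) : exists M, mxcvg (expmx_sum (n.+1%:R^-1 *: A)) M /\
    forall i j, `|M i j - (1%:M + n.+1%:R^-1 *: A) i j| <=
    norm1 (1%:M : 'M[R]_m) * (norm1 (n.+1%:R^-1 *: A) ^+ 2 * expR (norm1 (n.+1%:R^-1 *: A))).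
  by have [M h1 h2] := expmx_cvg (n.+1%:R^-1 *: A); exists M.
(* [Z n] is the difference quotient at 0, with step 1/(n+1), of t |-> exp (t A). *)
pose Z n := n.+1%:R *: (M_ n - 1%:M).
have norm1Z (c : R) (B : 'M[R]_m) : 0 <= c -> norm1 (c *: B) = c * norm1 B.
  move=> c0; rewrite /norm1 mulr_sumr; apply: eq_bigr => i _; rewrite mulr_sumr.
  by apply: eq_bigr => j _; rewrite mxE normrM ger0_norm.
have hZ : mxcvg Z A.
  move=> i j; apply/subr_cvg0.
  pose C := norm1 (1%:M : 'M[R]_m) * (norm1 A ^+ 2 * expR (norm1 A)).
  apply/norm_cvg0P; apply: (@squeeze_cvgr _ _ _ _ (fun=> 0) (fun k => C * k.+1%:R^-1)).
  - apply: nearW => k; rewrite normr_ge0 /=.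
    have k0 : 0 < k.+1%:R :> R by [].
    have -> : Z k i j - A i j = k.+1%:R * (M_ k i j - (1%:M + k.+1%:R^-1 *: A) i j).
      rewrite !mxE; move: (k.+1%:R : R) k0 => q q0; field.
      by rewrite gt_eqF.
    rewrite normrM (gtr0_norm k0) mulrC -ler_pdivlMr//.
    rewrite (le_trans ((hM_ k).2 i j))// norm1Z ?invr_ge0//.
    have -> : C * k.+1%:R^-1 / k.+1%:R = norm1 (1%:M : 'M[R]_m) *
        ((k.+1%:R^-1 * norm1 A) ^+ 2 * expR (norm1 A)).
      rewrite /C; move: (k.+1%:R : R) k0 => q q0; field.
      by rewrite gt_eqF.
    have a0 : 0 <= k.+1%:R^-1 * norm1 A by rewrite mulr_ge0 ?invr_ge0 ?norm1_ge0.
    rewrite ler_wpM2l ?norm1_ge0// ler_wpM2l ?exprn_ge0// ler_expR.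
    by rewrite ler_piMl ?norm1_ge0// invf_le1// ler1n.
  - exact: cvg_cst.
  - by rewrite -(mulr0 C); apply: cvgM; [exact: cvg_cst|exact: cvg_harmonic].
pose Z' n := invmx G *m Z n *m G.
have hZ' : mxcvg Z' Y.
  by apply: mxcvgM; [apply: mxcvgM => //|]; exact: mxcvg_cst.
(* Orthogonality of 1 + Z' / (n + 1), expanded and multiplied by n + 1; its limit is Y + Y^T = 0. *)
have Z'0 n : Z' n + (Z' n)^T + n.+1%:R^-1 *: (Z' n *m (Z' n)^T) = 0.
  have := orth n.+1%:R^-1 (M_ n) (hM_ n).1.
  have n0 : n.+1%:R != 0 :> R by rewrite pnatr_eq0.
  have -> : invmx G *m M_ n *m G = 1%:M + n.+1%:R^-1 *: Z' n.
    rewrite /Z' /Z -scalemxAr -scalemxAl scalerA mulVf// scale1r mulmxBr mulmxBl mulmx1.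
    by rewrite mulVmx// addrC subrK.
  rewrite linearD /= trmx1 linearZ /= mulmxDl mul1mx mulmxDr mulmx1 -!addrA.
  rewrite -[RHS]addr0 => /addrI; rewrite -scalemxAl -scalemxAr => h.
  have := congr1 ( *:%R n.+1%:R) h; rewrite scaler0 !scalerDr !scalerA mulfV// !scale1r mul1r.
  by move=> h2; rewrite addrCA h2.
have Y0 : Y + Y^T = 0.
  apply/matrixP => i j; rewrite [RHS]mxE.
  have h : mxcvg (fun n => Z' n + (Z' n)^T + n.+1%:R^-1 *: (Z' n *m (Z' n)^T))
     (Y + Y^T + (0 : R) *: (Y *m Y^T)).
    apply: mxcvgD; first by apply: mxcvgD => //; exact: mxcvg_tr.
    by apply: mxcvgZ; [exact: cvg_harmonic|apply: mxcvgM => //; exact: mxcvg_tr].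
  have := h i j; under eq_fun do rewrite Z'0 mxE.
  by rewrite scale0r addr0 => /cvg_lim <-//; rewrite lim_cst.
have ginv : mxof e e (g^-1)%VF = invmx G.
  have k0 : lker g == 0%VS.
    apply/eqP/vspaceP => u; rewrite memv_ker memv0.
    have := @rVof_app _ _ _ e e eb g u; rewrite gE => gu.
    rewrite -[LHS](rVof_eq0 eb) gu -[RHS](rVof_eq0 eb).
    apply/eqP/eqP => [h|->]; last by rewrite mul0mx.
    by rewrite -(mulmxK Gu (rVof e u)) h mul0mx.
  have : mxof e e (g^-1 \o g)%VF = 1%:M by rewrite lker0_compVf// mxof1// (basis_free eb).
  rewrite (@mxof_comp _ _ _ _ e e e eb) gE => h.
  by rewrite -[LHS](mulKmx Gu) h mulmx1.
(* The row convention reverses products, so g X g^-1 has matrix G^-1 A G. *)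
have YE : mxof e e (g \o X \o g^-1)%VF = Y.
  by rewrite !(@mxof_comp _ _ _ _ e e e eb) gE ginv mulmxA.
move=> u v; rewrite !eo !(@rVof_app _ _ _ e e eb) YE std_dotMr.
have -> : Y^T = - Y by apply/eqP; rewrite -addr_eq0 addrC Y0.
by rewrite mulmxN std_dotNr addNr.
Qed.

End Stable.

(** * From stability to strict inequalities *)

Section StableStrict.
Import passmx.
Context (R : realType) (E : euclidean R).
Notation m := (\dim {:E}).
Notation kp := (m%:R^-1 : R).
Implicit Types (nu : proj_prob E) (L : {vspace E}).

Definition supported_on_pair nu L L' :=
  [/\ (L :&: L' = 0)%VS, (L + L' = fullv)%VS &
    nu (~` (proj_sub L `|` proj_sub L')) = 0%E].

Lemma polystable_mass nu : polystable nu -> forall L,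
  fine (nu (proj_sub L)) <= kp * (\dim L)%:R /\
  (fine (nu (proj_sub L)) = kp * (\dim L)%:R ->
   exists L', supported_on_pair nu L L').
Proof.
have [e [eb eo]] := orthonormal_basis E.
move=> /(polystableP eb eo)[G G1 bG] L.
have Gu : G \in unitmx by rewrite unitmxE G1 unitr1.
have my := dirmeasM Gu (dirmeas_pcoord eb).
have [rL mL] := coord_mass eb nu L Gu; rewrite -rL -mL; split.
  exact: balanced_le.
move=> /(balanced_eq measurableT my bG)[W' [cap rk nul]].
exists (vsof e (W' *m invmx G)).
have inL' u : (u \in vsof e (W' *m invmx G)) = (rVof e u *m G <= W')%MS.
  by rewrite -rVof_sub// -[RHS](submxMfree _ _ (_ : row_free (invmx G)))
    ?row_free_unit ?unitmx_inv// mulmxK.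
have inL u : (u \in L) = (rVof e u *m G <= msof e L *m G)%MS.
  by rewrite submxMfree ?row_free_unit// -mem_vecof// rVofK.
have dL' : \dim (vsof e (W' *m invmx G)) = \rank W'.
  by rewrite dim_vsof// mxrankMfree// row_free_unit unitmx_inv.
have capL : (L :&: vsof e (W' *m invmx G) = 0)%VS.
  apply/eqP; rewrite -subv0; apply/subvP => u; rewrite memv_cap inL inL' => /andP[h1 h2].
  have : (rVof e u *m G <= (msof e L *m G) :&: W')%MS by rewrite sub_capmx h1.
  rewrite cap submx0 => /eqP h; rewrite memv0 -(rVof_eq0 eb).
  by rewrite -(mulmxK Gu (rVof e u)) h mul0mx.
split => //.
  apply/eqP; rewrite eqEdim subvf /= dimv_disjoint_sum// dL' -rL.
  by rewrite rk.
rewrite -nul setTI; congr (nu _); apply/seteqP.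
have pL p : proj_sub L p <-> (pcoord e p *m G <= msof e L *m G)%MS.
  by rewrite -inL /proj_sub /= line_repr -memvE.
have pL' p : proj_sub (vsof e (W' *m invmx G)) p <-> (pcoord e p *m G <= W')%MS.
  by rewrite -inL' /proj_sub /= line_repr -memvE.
split => p /=.
  move=> h; rewrite -negb_or; apply/negP => /orP[/pL|/pL'] h'; apply: h.
    by left.
  by right.
by rewrite -negb_or => /negP h [/pL|/pL'] h'; apply: h; rewrite h' ?orbT.
Qed.

Lemma fixed_translate nu (f : 'End(E)) (L L' : {vspace E}) :
  nu (~` (proj_sub L `|` proj_sub L')) = 0%E ->
  (forall p, proj_sub L p -> proj_map f p = p) ->
  (forall p, proj_sub L' p -> proj_map f p = p) ->
  is_translate f nu nu.
Proof.
move=> nul fL fL' B mB.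
have [e [eb _]] := orthonormal_basis E.
have mL := measurable_proj_sub eb L; have mL' := measurable_proj_sub eb L'.
have mfB : measurable (proj_map f @^-1` B).
  by rewrite -[X in measurable X]setTI; exact: measurable_proj_map.
have ae : {ae nu, forall p, B p <-> (proj_map f @^-1` B) p}.
  exists (~` (proj_sub L `|` proj_sub L')); split => //.
    by apply: measurableC; exact: measurableU.
  apply: subsetC => p [pL|pL] /=; first by rewrite fL.
  by rewrite fL'.
apply/eqP; rewrite eq_le /pushforward; apply/andP; split; apply: ae_le_prob => //;
  by apply: filterS ae => p [].
Qed.

Lemma strict_of_stable nu : stable nu -> forall L, (0 < \dim L < m)%N ->
  fine (nu (proj_sub L)) < kp * (\dim L)%:R.
Proof.
move=> [pol [g0 Sg0 sog]] L /andP[L0 Lm].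
have [le eqL] := polystable_mass pol L; rewrite lt_neqAle le andbT.
apply/negP => /eqP /eqL [L' [cap sum nul]] {le eqL}.
have dsum : (\dim L + \dim L')%N = m by rewrite -dimv_disjoint_sum// sum.
pose s := vbasis L ++ vbasis L'.
have ss : size s == m by rewrite size_cat !size_tuple dsum.
pose e : m.-tuple E := Tuple ss.
have eb : basis_of {:E} e.
  have : basis_of (L + L')%VS s.
    by apply: cat_basis; [exact/directv_addP|exact: vbasisP|exact: vbasisP].
  by rewrite sum.
(* Two weights making the trace 0. The exponentials are scalar on [L] and on [L'], hence fix every
   point of P(L) and P(L'). *)
pose a (i : 'I_m) : R := if (i < \dim L)%N then (\dim L')%:R else - (\dim L)%:R.
pose X := hommx e e (diag_mx (\row_i a i)).
have expX (t : R) : lfun_exp (t *: X) = hommx e e (diag_mx (\row_i expR (t * a i))).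
  apply: lfun_exp_mx => //; rewrite linearZ /= hommxK//.
  have -> : t *: diag_mx (\row_i a i) = diag_mx (\row_i (t * a i)).
    by apply/matrixP => i j; rewrite !mxE mulrnAr.
  have -> : \row_i expR (t * a i) = \row_i expR ((\row_j (t * a j)) 0 i).
    by apply/rowP => i; rewrite !mxE.
  exact: expmx_diag.
have onL (c : 'I_m -> R) (b : R) (K : {vspace E}) :
    (forall i : 'I_m, e`_i \in vbasis K -> c i = b) -> {subset vbasis K <= e} ->
    forall u, u \in K -> hommx e e (diag_mx (\row_i c i)) u = b *: u.
  move=> cb sub; have := (@span_lfunP _ _ _ (vbasis K) (hommx e e (diag_mx (\row_i c i))) (b *: \1%VF)).2.
  rewrite (span_basis (vbasisP K)) => H u uK.
  rewrite H// ?lfunE /= ?lfunE//= => v vK.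
  have /nthP - /(_ 0) [i] := sub v vK; rewrite size_tuple => im vE.
  have {}vE : v = e`_(Ordinal im) by [].
  rewrite vE in vK *; rewrite scale_lfunE id_lfunE (hommxE eb eb) (rVofE eb) -rowE.
  have -> : row (Ordinal im) (diag_mx (\row_i0 c i0)) = c (Ordinal im) *: delta_mx 0 (Ordinal im).
    by apply/rowP => j; rewrite !mxE eqxx /= eq_sym mulr_natr.
  by rewrite linearZ /= vecof_delta cb.
have sub1 : {subset vbasis L <= e} by move=> v; rewrite mem_cat => ->.
have sub2 : {subset vbasis L' <= e} by move=> v; rewrite mem_cat => ->; rewrite orbT.
have disj v : v \in vbasis L -> v \in vbasis L' -> False.
  move=> /vbasis_mem v1 /[dup] /vbasis_mem v2 v3.
  have : v \in (L :&: L')%VS by rewrite memv_cap v1.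
  rewrite cap memv0 => /eqP v0.
  by have := basis_not0 (vbasisP L') v3; rewrite v0 eqxx.
have aL (i : 'I_m) : (e`_i \in vbasis L) -> (i < \dim L)%N.
  move=> h; rewrite ltnNge; apply/negP => iL.
  apply: (disj _ h); rewrite /= nth_cat size_tuple ltnNge iL /=.
  apply: mem_nth; rewrite size_tuple.
  by have := ltn_ord i; rewrite -{2}dsum; lia.
have aL' (i : 'I_m) : (e`_i \in vbasis L') -> (i < \dim L)%N = false.
  move=> h; apply/negP => iL; apply: (disj e`_i) => //.
  by rewrite /= nth_cat size_tuple iL mem_nth// size_tuple.
have fixK (f : 'End(E)) (b : R) (K : {vspace E}) : b != 0 -> (forall u, u \in K -> f u = b *: u) ->
    forall p, proj_sub K p -> proj_map f p = p.
  move=> b0 fb p pK; rewrite proj_mapE fb ?proj_classZ ?proj_classK//.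
  by move: pK; rewrite /proj_sub /= line_repr -memvE.
have stX : stabilizer_lie nu X.
  move=> t; rewrite expX; split.
    apply/(SL_mxof eb); rewrite hommxK// det_diag.
    under eq_bigr do rewrite mxE.
    rewrite -expR_sum (_ : \sum_i _ = 0) ?expR0//.
    rewrite -mulr_sumr (_ : \sum_i _ = 0) ?mulr0//.
    rewrite -(big_mkord xpredT (fun i =>
      if (i < \dim L)%N then (\dim L')%:R else - (\dim L)%:R : R)).
    rewrite (big_cat_nat (n := \dim L))//=; last exact: ltnW.
    rewrite (eq_big_nat _ _ (F2 := fun=> (\dim L')%:R)) => [|i /andP[_ ->]//].
    rewrite [X in _ + X](eq_big_nat _ _ (F2 := fun=> - (\dim L)%:R)) => [|i /andP[il _]]; last first.
      by rewrite ltnNge il.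
    have -> : m = (\dim L + \dim L')%N by rewrite dsum.
    rewrite !sumr_const_nat subn0 addKn mulNrn.
    by rewrite -(mulr_natr (\dim L')%:R) -(mulr_natr (\dim L)%:R) mulrC subrr.
  apply: (fixed_translate nul).
    apply: (fixK _ (expR (t * (\dim L')%:R))); first by rewrite gt_eqF ?expR_gt0.
    by apply: onL => // i /aL; rewrite /a => ->.
  apply: (fixK _ (expR (t * - (\dim L)%:R))); first by rewrite gt_eqF ?expR_gt0.
  by apply: onL => // i /aL'; rewrite /a => ->.
have skew := sog X stX.
pose u := vpick L; have u0 : u != 0 by rewrite vpick0 -dimv_eq0 -lt0n.
have uL : u \in L by exact: memv_pick.
have Xu : X u = (\dim L')%:R *: u.
  by apply: (onL a _ L) => // i /aL; rewrite /a => ->.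
have k0 : lker g0 == 0%VS.
  have g0u := SL_unit eb Sg0.
  apply/eqP/vspaceP => v; rewrite memv_ker memv0.
  have gv := @rVof_app _ _ _ e e eb g0 v.
  rewrite -[LHS](rVof_eq0 eb) gv -[RHS](rVof_eq0 eb).
  apply/eqP/eqP => [h|->]; last by rewrite mul0mx.
  by rewrite -(mulmxK g0u (rVof e v)) h mul0mx.
(* A skew map A satisfies <A v, v> = 0, but at v = g0 u the conjugate of X gives dim L' |v|^2. *)
have := skew (g0 u) (g0 u); rewrite !comp_lfunE.
rewrite (_ : (g0^-1)%VF (g0 u) = u); last by rewrite -comp_lfunE lker0_compVf// lfunE.
rewrite Xu linearZ /= linearZl_LR /= linearZr /= -mulr2n => /eqP.
rewrite mulrn_eq0 /= mulf_eq0 pnatr_eq0 => /orP[/eqP d0|]; first by move: dsum Lm; lia.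
have g0u0 : g0 u != 0.
  by apply: contra u0 => h; rewrite -memv0 -(eqP k0) memv_ker.
by rewrite gt_eqF// (neq0_dnorm_gt0 (s := edot E)).
Qed.

End StableStrict.

(** * Semistability *)

Lemma ptws_cvgP (R : realType) (I : Type) (F : set_system (I -> R)) (h : I -> R) :
  Filter F -> {ptws, F --> h} <-> forall i, g i @[g --> F] --> h i.
Proof.
move=> FF; split => [/cvg_sup cF i A|Fh].
  rewrite {1}nbhsE => -[B [oB Bh] sBA].
  change (F (fun g : I -> R => A (g i))); apply: (cF i); rewrite nbhsE.
  exists (fun g : I -> R => B (g i)); last by move=> g; exact: sBA.
  by split => //; exists B.
apply/cvg_sup => i A [_ [[B oB <-] Bh] sBA].
apply: (@filterS _ F FF _ _ sBA).
by have := Fh i; apply; exact: open_nbhs_nbhs.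
Qed.

Section WeakTopology.
Context (R : realType) (E : euclidean R).
Implicit Types (nu : proj_prob E).

Lemma weak_integral_continuous (f : proj_space E -> R) : continuous f ->
  continuous (fun nu : weak_prob E => \int[nu]_(p in setT) f p : R).
Proof.
move=> cf nu; pose F : {f : proj_space E -> R | continuous f} := exist _ f cf.
have : {ptws, (@test_integral R E) @ (nbhs (nu : weak_prob E)) --> test_integral nu}.
  exact: (@initial_continuous _ _ (@test_integral R E)).
by move=> cv; exact: ((ptws_cvgP _ _).1 cv F).
Qed.

(** Convergence against each test function is convergence in the pointwise topology that induces
    [weak_prob], so every neighbourhood contains a term. *)
Lemma weak_closure_seq (A : set (weak_prob E)) (nu_ : nat -> proj_prob E) nu :
  (forall k, A (nu_ k)) ->
  (forall f : proj_space E -> R, continuous f ->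
    \int[nu_ k]_(p in setT) f p @[k --> \oo] --> (\int[nu]_(p in setT) f p : R)) ->
  closure A nu.
Proof.
move=> nuA cvgf B; rewrite nbhsE => -[_ [[V oV <-] Vnu] sVB].
have : {ptws, (@test_integral R E \o nu_) @ \oo --> test_integral nu}.
  by apply/ptws_cvgP => -[f cf]; exact: cvgf.
move=> /(_ V) [|N _ hN]; first exact: open_nbhs_nbhs.
by exists (nu_ N); split => //; apply: sVB; apply: (hN N) => /=.
Qed.

End WeakTopology.

Section ContinuousOnProj.
Import passmx.
Context (R : realType) (E : euclidean R).
Context (e : (\dim {:E}).-tuple E) (eb : basis_of {:E} e).
Notation m := (\dim {:E}).

Lemma mxcvg_rv n (u_ : nat -> 'rV[R]_n) (u : 'rV[R]_n) : mxcvg u_ u ->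
  u_ k @[k --> \oo] --> u.
Proof.
move=> uu; apply/cvgrPdist_lt => z z0.
have H : \forall k \near \oo, forall j : 'I_n, `|u 0 j - u_ k 0 j| < z.
  apply: (@filter_forall _ _ (fun (j : 'I_n) k => `|u 0 j - u_ k 0 j| < z)) => j.
  by have /cvgrPdist_lt /(_ z z0) := uu 0 j.
apply: filterS H => k Hk.
rewrite /Num.Def.normr /= mx_normrE.
apply/bigmax_ltP; split => // -[i j] _ /=; rewrite ord1.
by have := Hk j; rewrite !mxE.
Qed.

Lemma continuous_proj_cvg (f : proj_space E -> R) (v_ : nat -> 'rV[R]_m) (v : 'rV[R]_m) :
  continuous f -> v != 0 -> mxcvg v_ v ->
  f (proj_class (vecof e (v_ k))) @[k --> \oo] --> f (proj_class (vecof e v)).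
Proof.
move=> cf v0 /mxcvg_rv vv U /= /cf; rewrite nbhsE => -[B [oB Bv] sBU].
have [oL _] := conic_lift eb oB.
have : nbhs v (lift_set e B) by apply: open_nbhs_nbhs; split => //; split.
by move=> nv; have [N _ hN] := vv _ nv; exists N => // k /hN [_ h]; exact: sBU.
Qed.

(** Compactness: unit representatives of points where |f| is large accumulate at a unit vector, near
    whose line f is bounded. *)
Lemma continuous_proj_bdd (f : proj_space E -> R) : continuous f ->
  exists M, forall p, `|f p| <= M.
Proof.
move=> cf; apply: contrapT => unb.
have big k : exists p, k%:R < `|f p|.
  apply: contrapT => h; apply: unb; exists k%:R.
  by move=> p; rewrite leNgt; apply/negP => hp; apply: h; exists p.
have [p_ hp] := choice big.
pose x k := pcoord e (p_ k).
pose v k := (Num.sqrt (std_dot (x k) (x k)))^-1 *: x k.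
have x0 k : x k != 0 by exact: pcoord_neq0.
have s0 k : 0 < Num.sqrt (std_dot (x k) (x k)) by rewrite sqrtr_gt0 std_dot_gt0.
have vv k : std_dot (v k) (v k) = 1.
  rewrite /v std_dotZl std_dotZr mulrA -invfM -expr2 sqr_sqrtr ?ltW ?std_dot_gt0//.
  by rewrite mulVf// gt_eqF// std_dot_gt0.
have vb k i j : `|v k i j| <= 1.
  rewrite -(expr_le1 (n := 2))// real_normK ?num_real// -(vv k) std_dotE.
  rewrite (ord1 i) (bigD1 j)//= -expr2 lerDl; apply: sumr_ge0 => l _.
  by rewrite -expr2 sqr_ge0.
have [g incg [w vw]] := mx_bolzano_weierstrass vb.
have ww : std_dot w w = 1.
  have := mxcvg_std_dot vw vw; under eq_fun do rewrite vv.
  by move/(cvg_lim (@Rhausdorff R)) => <-; rewrite lim_cst//; exact: Rhausdorff.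
have w0 : w != 0 by apply: contra_eq_neq ww => ->; rewrite std_dot0l eq_sym oner_neq0.
have fE k : f (proj_class (vecof e (v k))) = f (p_ k).
  by rewrite /v proj_class_vecofZ ?invr_eq0 ?gt_eqF// pcoordK.
have := continuous_proj_cvg cf w0 vw.
under eq_fun do rewrite /= fE.
move=> /cvgP /cvg_seq_bounded [K [Kr Kb]].
pose N := Num.bound (`|K| + 1).
have ltN : `|K| + 1 < N%:R by apply: archi_boundP; rewrite addr_ge0.
have KK1 : K < `|K| + 1 by rewrite (le_lt_trans (ler_norm K))// ltrDl ltr01.
have gN : (N <= g N)%N.
  elim: N {ltN} => // k ih; apply: leq_ltn_trans ih _.
  by rewrite ltnNge incg -ltnNge.
have := lt_le_trans (hp (g N)) (Kb _ KK1 N I).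
by apply/negP; rewrite -leNgt (le_trans (ltW ltN))// ler_nat.
Qed.

Lemma continuous_proj_meas (f : proj_space E -> R) : continuous f ->
  bdd_meas setT (f : proj_borel E -> R).
Proof.
move=> cf; split; last by have [M hM] := continuous_proj_bdd cf; exists M.
apply: (measurability _ (RGenOpens.measurableE R)) => _ [_ [a [b ->] <-]].
rewrite setTI; apply: proj_open_meas.
by apply: open_comp => // *; exact: cf.
Qed.

End ContinuousOnProj.

Section Semistable.
Import passmx.
Context (R : realType) (E : euclidean R).
Notation m := (\dim {:E}).
Notation kp := (m%:R^-1 : R).
Implicit Types (nu : proj_prob E) (L : {vspace E}).

(** The subspace moves with the translating map, so masses are not passed to the limit. The
    projection entries serve as test functions, and [mass_approx] applies to each translate close to
    nu' and the moved subspace. *)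
Lemma mass_of_semistable nu : semistable nu -> forall L,
  fine (nu (proj_sub L)) <= kp * (\dim L)%:R.
Proof.
have [e [eb eo]] := orthonormal_basis E.
move=> [nu' [clo /(grad_int_eq0 eb eo) avg']] L.
pose f i j (p : proj_space E) : R := dirmx (pcoord e p) i j.
have cf i j : continuous (f i j).
  apply/continuousP => A oA.
  pose U := [set v : 'rV[R]_m | v != 0 /\ A (dirmx v i j)].
  rewrite (_ : _ @^-1` _ = [set p | U (pcoord e p)]); last first.
    apply/seteqP; split => p /=; last by case.
    by move=> ?; split => //; exact: pcoord_neq0.
  apply: open_of_conic; split; last first.
    by move=> c v c0 [v0 Av]; split; [rewrite scaler_eq0 negb_or c0|rewrite dirmxZ].
  rewrite openE => v [v0 Av] /=; apply: filterI.
    by move: (@open_neq0 R m); rewrite openE; exact.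
  have := @dirmx_coord_cvg R m (nbhs v) (nbhs_filter v) v i j v0
    (fun i => @coord_continuous _ _ _ 0 i v).
  by apply; exact: open_nbhs_nbhs.
apply/ler_addgt0Pr => z z0.
(* Undoes the constant of [mass_approx]. *)
pose z' := z / (m * m * m.+1)%:R.
have z'0 : 0 < z'.
  by rewrite divr_gt0// ltr0n !muln_gt0 (edim_gt0 E).
have nz : nbhs (nu' : weak_prob E) [set mu : weak_prob E | forall i j : 'I_m,
    `|\int[nu']_(p in setT) f i j p - \int[mu]_(p in setT) f i j p| < z'].
  pose close i j (mu : weak_prob E) :=
    `|\int[nu']_(p in setT) f i j p - \int[mu]_(p in setT) f i j p| < z'.
  apply: (@filter_forall _ _ (fun i mu => forall j, close i j mu) (nbhs (nu' : weak_prob E))) => i.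
  apply: (@filter_forall _ _ (close i) (nbhs (nu' : weak_prob E))) => j.
  have := @weak_integral_continuous R E (f i j) (cf i j) nu'.
  by move/cvgrPdist_lt => /(_ z' z'0).
have [mu [[g Sg tr] hmu]] := clo _ nz.
have gu := SL_unit eb Sg.
have my := dirmeasM gu (dirmeas_pcoord eb).
have [rL mL] := coord_mass eb nu L gu; rewrite -mL -rL.
have -> : z = (m * m * m.+1)%:R * z'.
  by rewrite mulrC divfK// pnatr_eq0 -lt0n !muln_gt0 (edim_gt0 E).
apply: (mass_approx measurableT _ my) => i j.
have := avg_translate eb gu (unitmx1 _ _) tr; rewrite mulmx1 => <-.
rewrite -[X in _ - X](_ : avg nu' setT (pcoord e) i j = _); last by rewrite avg' mxE.
rewrite distrC; apply: ltW; rewrite !mxE.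
under [X in _ - X]eq_Rintegral do rewrite mulmx1.
exact: hmu.
Qed.

Lemma proj_sub_dim0 L : \dim L = 0%N -> proj_sub L = set0.
Proof.
move=> /eqP; rewrite dimv_eq0 => /eqP ->; apply/seteqP; split => p //.
rewrite /proj_sub /= subv0 => /eqP p0.
by have := dim_proj p; rewrite [val _]p0 dimv0.
Qed.

Lemma mass_le_proper nu : (forall L, (0 < \dim L < m)%N ->
    fine (nu (proj_sub L)) <= kp * (\dim L)%:R) ->
  forall L, fine (nu (proj_sub L)) <= kp * (\dim L)%:R.
Proof.
move=> le L; have [L0|L0] := posnP (\dim L).
  by rewrite proj_sub_dim0// measure0 L0 mulr0.
have : (\dim L <= m)%N by exact: dimvS (subvf L).
rewrite leq_eqVlt => /orP[/eqP ->|Lm]; last by apply: le; rewrite L0.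
rewrite -(prob_dim nu) fine_le ?fin_num_measure ?le_measure ?inE//;
  exact: (measurable_proj_sub (vbasisP _)).
Qed.

Lemma semistable_of_mass nu : (forall L,
  fine (nu (proj_sub L)) <= kp * (\dim L)%:R) -> semistable nu.
Proof.
have [e [eb eo]] := orthonormal_basis E.
move=> le; have m0 := edim_gt0 E.
have ss : semistable_field nu kp setT (pcoord e).
  by move=> W; rewrite (mass_vsof eb) -(dim_vsof eb).
have [g_ [y [dgg cy ay yc _]]] :=
  degeneration measurableT (conic_pcoord eb) (prob_dim nu) ss.
have dg k : \det (g_ k) != 0.
  by apply: contraTneq (dgg k k) => ->; rewrite mul0r ltxx.
(* With a common sign, one reflection [S] corrects all determinants, and the limit field just
   becomes y S. *)
have sgg k : Num.sg (\det (g_ k)) = Num.sg (\det (g_ 0%N)).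
  have := dgg k 0%N; have [d0|d0|d0] := ltgtP (\det (g_ 0%N)) 0.
  - by rewrite nmulr_lgt0// => d1; rewrite !ltr0_sg.
  - by rewrite pmulr_lgt0// => d1; rewrite !gtr0_sg.
  - by rewrite d0 mulr0 ltxx.
pose S := diag_mx (sign_row m0 (\det (g_ 0%N))).
have Su : S \in unitmx.
  rewrite unitmxE det_diag unitfE; apply/prodf_neq0 => i _.
  by rewrite -sqrf_eq0 (sign_row_sqr m0 i (dg 0%N)) oner_neq0.
pose b k := `|\det (g_ k)| `^ (- m%:R^-1).
have b0 k : b k != 0 by rewrite gt_eqF// powR_gt0// normr_gt0.
pose G k := b k *: (g_ k *m S).
have G1 k : \det (G k) = 1.
  rewrite -(det_sign_scale m0 (dg k)); congr (\det (_ *: (_ *m diag_mx _))).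
  by apply/rowP => i; rewrite !mxE sgg.
have y0 t : y t != 0 by case: cy => + _; exact.
have y'0 t : y t *m S != 0.
  by apply: contra (y0 t) => /eqP h; rewrite -(mulmxK Su (y t)) h mul0mx.
have cy' : conic_meas setT (fun t => y t *m S) by exact: (conic_measM cy).
have ay' : avg nu setT (fun t => y t *m S) = kp%:M.
  by apply: avg_reflection => // [|i];
    [exact: conic_dirmeas cy|exact: sign_row_sqr].
(* The limit measure is the image of [nu] under the limit field; the factors [b k] and [c k] are
   invisible on lines. *)
pose h t : proj_borel E := proj_class (vecof e (y t *m S)).
have mh : measurable_fun setT h.
  apply: (measurable_class eb) => U cU _; rewrite -[X in measurable X]setTI.
  exact: cy'.2.
have [nu' nu'E] := prob_push nu mh.
exists nu'; split; last first.
  apply/(grad_int_eq0 eb eo); rewrite -ay'; apply/matrixP => i j; rewrite !mxE.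
  rewrite (Rint_push mh (fun B _ => nu'E B)); last first.
    exact: dirmeas_bdd (dirmeas_pcoord eb).
  apply: eq_Rint => t _; rewrite /h.
  by have [c c0 ->] := pcoord_class eb (y'0 t); rewrite dirmxZ.
have trG k : exists nuk, is_translate (hommx e e (G k)) nu nuk := translate_exists _ _.
have [nu_ nu_tr] := choice trG.
apply: (weak_closure_seq (nu_ := nu_)) => [k|f cf].
  by exists (hommx e e (G k)) => //; apply/(SL_mxof eb); rewrite hommxK.
have bf := continuous_proj_meas eb cf.
rewrite (Rint_push mh (fun B _ => nu'E B) bf).
under eq_fun => k do rewrite (Rint_push (measurable_proj_map _) (nu_tr k) bf).
have [M hM] := continuous_proj_bdd eb cf.
apply: (bdd_cvg measurableT (M := M)) => [k|k t _|t _|].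
- by apply: measurableT_comp; [case: bf|exact: measurable_proj_map].
- exact: hM.
- have [c [c0 cv]] := yc t I.
  have -> : (fun k => f (proj_map (hommx e e (G k)) t)) =
      fun k => f (proj_class (vecof e ((c k *: (pcoord e t *m g_ k)) *m S))).
    apply/funext => k; rewrite proj_mapE (hommxE eb eb) -/(pcoord e t) /G.
    by rewrite -scalemxAr mulmxA -scalemxAl !proj_class_vecofZ.
  apply: continuous_proj_cvg => //.
  by apply: mxcvgM => //; exact: mxcvg_cst.
- by apply: measurableT_comp; [case: bf|exact: mh].
Qed.

End Semistable.

(** * Polystability *)

Section SplitPolystable.
Import passmx.
Context (R : realType) (E : euclidean R).
Notation m := (\dim {:E}).
Notation kp := (m%:R^-1 : R).
Implicit Types (nu : proj_prob E) (L : {vspace E}).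

(** The hypothesis makes the field [pcoord e] reducible, so the first map of the degeneration
    balances it. *)
Lemma polystable_of_mass nu :
  (forall L, fine (nu (proj_sub L)) <= kp * (\dim L)%:R /\
    (fine (nu (proj_sub L)) = kp * (\dim L)%:R ->
     exists L', supported_on_pair nu L L')) -> polystable nu.
Proof.
have [e [eb eo]] := orthonormal_basis E.
move=> CR; have mx := dirmeas_pcoord eb.
have ss : semistable_field nu kp setT (pcoord e).
  by move=> W; rewrite (mass_vsof eb) -(dim_vsof eb); case: (CR (vsof e W)).
have red : reducible_field nu kp setT (pcoord e).
  move=> W; rewrite (mass_vsof eb) -(dim_vsof eb) => /(CR (vsof e W)).2.
  move=> [L' [cap sum nul]]; exists (msof e L'); split.
  - apply/eqP; rewrite -submx0; apply/rV_subP => u.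
    rewrite sub_capmx -(mem_vecof eb) -{1}(vecofK eb u) rVof_sub// => /andP[uW uL'].
    have : vecof e u \in (vsof e W :&: L')%VS by rewrite memv_cap uW.
    by rewrite cap memv0 vecof_eq0// => /eqP ->; rewrite sub0mx.
  - by rewrite rank_msof// -dimv_disjoint_sum// sum.
  - exists (~` (proj_sub (vsof e W) `|` proj_sub L')); split => //.
      by apply: measurableC; apply: measurableU; exact: (measurable_proj_sub eb).
    move=> p /= h [] hp; apply: h => _; apply/orP.
      by left; move: hp; rewrite (proj_subE eb) /= (eqmxP (vsofK eb W)).
    by right; move: hp; rewrite (proj_subE eb).
have [g_ [y [dgg cy ay _ yg]]] :=
  degeneration measurableT (conic_pcoord eb) (prob_dim nu) ss.
have gu : g_ 0%N \in unitmx.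
  by rewrite unitmxE unitfE; apply: contraTneq (dgg 0%N 0%N) => ->; rewrite mul0r ltxx.
have my := conic_dirmeas measurableT cy.
have bal : avg nu setT (fun p => pcoord e p *m g_ 0%N) = kp%:M.
  rewrite -ay; apply/matrixP => i j; rewrite !mxE; congr fine.
  apply: ae_eq_integral => //.
  - by apply/measurable_EFinP; case: (dirmeas_bdd i j (dirmeasM gu mx)).
  - by apply/measurable_EFinP; case: (dirmeas_bdd i j my).
  - by apply: filterS (yg red) => p /= h _; rewrite h.
apply/(polystableP eb eo).
by have [G G1 bG] := balanced_det1 measurableT mx (edim_gt0 E) gu bal; exists G.
Qed.

End SplitPolystable.

(** * Decomposition into strict components *)

Section Decomposition.
Context (R : realType) (E : euclidean R).
Notation m := (\dim {:E}).
Notation kp := (m%:R^-1 : R).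
Implicit Types (nu : proj_prob E) (L U W : {vspace E}).

Definition strict_inside nu L := forall W, (W <= L)%VS ->
  (0 < \dim W < \dim L)%N -> fine (nu (proj_sub W)) < kp * (\dim W)%:R.

Lemma proj_subI L L' : proj_sub L `&` proj_sub L' = proj_sub (L :&: L')%VS.
Proof.
by apply/seteqP; split => p; rewrite /proj_sub /= subv_cap => /andP.
Qed.

(** A non-strict [U] contains a proper nonzero [W] of extremal mass. The complement of [W] in the
    whole space, cut with [U], is a complement of [W] in [U] by the modular law, and is extremal by
    additivity; both parts have smaller dimension. *)
Lemma mass_decomposition nu :
  (forall L, fine (nu (proj_sub L)) <= kp * (\dim L)%:R /\
    (fine (nu (proj_sub L)) = kp * (\dim L)%:R ->
     exists L', supported_on_pair nu L L')) ->
  forall U, fine (nu (proj_sub U)) = kp * (\dim U)%:R ->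
  exists s : seq {vspace E},
    [/\ (\sum_(L <- s) L)%VS = U, (\sum_(L <- s) \dim L)%N = \dim U,
      nu.-negligible (proj_sub U `\` [set p | exists2 L, L \in s & proj_sub L p]) &
      forall L, L \in s -> [/\ (0 < \dim L)%N,
        fine (nu (proj_sub L)) = kp * (\dim L)%:R & strict_inside nu L]].
Proof.
move=> CR U; have [n] := ubnP (\dim U).
elim: n U => // n IH U; rewrite ltnS => Un massU.
have mP L : measurable (proj_sub L) := measurable_proj_sub (vbasisP _) L.
have [U0|U0] := posnP (\dim U).
  exists [::]; rewrite !big_nil; split => //.
    by apply/esym/eqP; rewrite -dimv_eq0 U0.
  by rewrite proj_sub_dim0// set0D; exact: negligible_set0.
have [strict|] := pselect (strict_inside nu U).
  exists [:: U]; rewrite !big_seq1; split => //.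
    apply: (@negligibleS _ _ _ _ set0); last exact: negligible_set0.
    by move=> p /= [pU]; apply; exists U; rewrite ?inE.
  by move=> L; rewrite inE => /eqP ->.
move=> /existsNP[W] /not_implyP[WU] /not_implyP[/andP[W0 Wlt]] /negP.
rewrite -leNgt => leW; have [geW eqW] := CR W.
have massW : fine (nu (proj_sub W)) = kp * (\dim W)%:R.
  by apply/eqP; rewrite eq_le geW.
have [L' [cap sum nul]] := eqW massW.
pose U' := (U :&: L')%VS.
have capU' : (W :&: U' = 0)%VS.
  by apply/eqP; rewrite -subv0 -cap capvS// capvSr.
have sumU' : (W + U' = U)%VS.
  by rewrite /U' capvC vspace_modl// sum capvC capvf.
have dimU' : (\dim W + \dim U' = \dim U)%N by rewrite -dimv_disjoint_sum// sumU'.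
have massU' : fine (nu (proj_sub U')) = kp * (\dim U')%:R.
  have : fine (nu (proj_sub U)) = fine (nu (proj_sub W `|` proj_sub U')).
    apply: ae_eq_prob => //; first exact: measurableU.
    exists (~` (proj_sub W `|` proj_sub L')); split => //.
      by apply: measurableC; exact: measurableU.
    move=> p /= h hp; apply: h; split => [pU|].
      by case: hp => h; [left|right; rewrite /U' -proj_subI].
    by case; rewrite /proj_sub /= => h; apply: subv_trans h _; rewrite ?capvSl.
  rewrite fine_probU//; last first.
    by rewrite proj_subI capU' proj_sub_dim0// dimv0.
  by rewrite massW massU -dimU' natrD mulrDr => /addrI.
have [|s1 [sum1 dim1 neg1 all1]] := IH W _ massW; first exact: leq_trans Wlt Un.
have [|s2 [sum2 dim2 neg2 all2]] := IH U' _ massU'.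
  by apply: leq_trans Un; rewrite -dimU' -addn1 addnC leq_add2r.
exists (s1 ++ s2); split; rewrite ?big_cat /= ?sum1 ?sum2 ?dim1 ?dim2//.
  have negL : nu.-negligible (~` (proj_sub W `|` proj_sub L')).
    by exists (~` (proj_sub W `|` proj_sub L')); split => //;
      apply: measurableC; exact: measurableU.
  apply: negligibleS (negligibleU negL (negligibleU neg1 neg2)) => p /= [pU ps].
  have [[pW|pL]|] := pselect ((proj_sub W `|` proj_sub L') p); last by left.
    right; left; split => // -[L Ls pL]; apply: ps.
    by exists L => //; rewrite mem_cat Ls.
  right; right; split => [|[L Ls pL']]; first by rewrite /U' -proj_subI.
  by apply: ps; exists L => //; rewrite mem_cat Ls orbT.
by move=> L; rewrite mem_cat => /orP[/all1|/all2].
Qed.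

End Decomposition.

(** * Measures carried by a subspace *)

Section Inclusion.
Context (R : realType) (E : euclidean R) (L : {vspace E}) (hL : (0 < \dim L)%N).
Let F := sub_euclidean hL.
Definition incl : 'Hom(F, E) := linfun vsval.
Implicit Types (q : proj_borel F) (W : {vspace E}) (K : {vspace F}).

Lemma inclE u : incl u = vsval u.
Proof. by rewrite /incl lfunE. Qed.

Lemma lker_incl : lker incl == 0%VS.
Proof. by apply/lker0P => u v; rewrite !inclE => /val_inj. Qed.

Lemma val_proj_incl q : val (proj_map incl q : proj_space E) = (incl @: val (q : proj_space F))%VS.
Proof.
rewrite val_insubd limg_dim_eq; first by rewrite dim_proj.
by rewrite (eqP lker_incl) capv0.
Qed.

Lemma dim_incl K : \dim (incl @: K) = \dim K.
Proof. by rewrite limg_dim_eq// (eqP lker_incl) capv0. Qed.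

Lemma limg_incl : limg incl = L.
Proof.
apply/vspaceP => v; apply/memv_imgP/idP => [[u _ ->]|vL].
  by rewrite inclE subvsP.
by exists (vsproj L v); rewrite ?memvf// inclE vsprojK.
Qed.

Lemma preim_proj_sub W : proj_map incl @^-1` proj_sub W = proj_sub (incl @^-1: W)%VS.
Proof.
apply/seteqP; split => q; rewrite /proj_sub /= val_proj_incl => /subvP h;
  apply/subvP => u uq.
  by rewrite -memv_preim; apply: h; exact: memv_img.
by have [v vq ->] := memv_imgP uq; rewrite memv_preim; exact: h.
Qed.

Lemma dim_preim W : \dim (incl @^-1: W) = \dim (L :&: W).
Proof. by rewrite -lpreim_cap_limg limg_incl capvC -dim_incl lpreimK// limg_incl capvSl. Qed.

Lemma dim_sub : \dim {:F} = \dim L.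
Proof. by rewrite -dim_incl limg_incl. Qed.

Lemma lpreim_incl K : (incl @^-1: (incl @: K) = K)%VS.
Proof.
apply/vspaceP => u; rewrite -memv_preim; apply/memv_imgP/idP => [[v vK]|uK].
  by move/(lker0P lker_incl) => ->.
by exists u.
Qed.

(** A stable measure is strict on nonzero proper subspaces of [L], and [L :&: W] is one of these
    unless it is 0 or [L]. *)
Lemma component_mass (delta : proj_prob F) W : stable delta ->
  fine (delta (proj_map incl @^-1` proj_sub W)) <=
    (\dim L)%:R^-1 * (\dim (L :&: W))%:R /\
  (fine (delta (proj_map incl @^-1` proj_sub W)) =
    (\dim L)%:R^-1 * (\dim (L :&: W))%:R ->
    (L :&: W = 0)%VS \/ (L <= W)%VS).
Proof.
move=> st; rewrite preim_proj_sub -dim_preim -dim_sub.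
set K := (incl @^-1: W)%VS; have strict := strict_of_stable st.
split; first by apply: mass_le_proper => K' /strict /ltW.
move=> eqK; have [K0|K0] := posnP (\dim K).
  by left; apply/eqP; rewrite -dimv_eq0 -dim_preim -/K K0.
have [Kf|Kf] := ltnP (\dim K) (\dim {:F}).
  by have := strict K; rewrite K0 Kf eqK ltxx => /(_ isT).
right; have : (L :&: W == L)%VS.
  by rewrite eqEdim capvSl /= -dim_preim -dim_sub.
by move/eqP/capv_idPl.
Qed.

Notation m := (\dim {:E}).
Notation kp := (m%:R^-1 : R).

Lemma component_exists (nu : proj_prob E) :
  fine (nu (proj_sub L)) = kp * (\dim L)%:R -> strict_inside nu L ->
  exists2 delta : proj_prob F, stable delta & forall B, measurable B ->
    nu (B `&` proj_sub L) =
      (((\dim L)%:R / m%:R)%:E * pushforward delta (proj_map incl) B)%E.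
Proof.
move=> massL strict.
have mP W : measurable (proj_sub W) := measurable_proj_sub (vbasisP _) W.
(* The mass kp dim L is finite and nonzero, so the default [nu] is not reached. *)
pose P := mnormalize (mrestr nu (mP L)) nu.
have m0 : (m%:R : R) != 0 by rewrite pnatr_eq0 -lt0n (edim_gt0 E).
have d0 : ((\dim L)%:R : R) != 0 by rewrite pnatr_eq0 -lt0n.
have finL : nu (proj_sub L) \is a fin_num by exact: fin_num_measure.
have nuL : nu (proj_sub L) = (kp * (\dim L)%:R)%:E by rewrite -massL fineK.
have PE B : P B = (nu (B `&` proj_sub L) * (kp * (\dim L)%:R)^-1%:E)%E.
  rewrite /P /mnormalize /= /mrestr setTI nuL orbF eqe mulf_eq0 invr_eq0.
  by rewrite (negPf m0) (negPf d0).
(* On P(L) the projection inverts the inclusion; outside P(L), where it may take default values, [P]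
   has no mass. *)
pose G : 'Hom(E, F) := linfun (vsproj L).
have inclG p : proj_sub L p -> proj_map incl (proj_map G p) = p.
  move=> pL; have xL : proj_repr p \in L.
    by move: pL; rewrite /proj_sub /= line_repr -memvE.
  have Gx : incl (G (proj_repr p)) = proj_repr p.
    by rewrite inclE /G lfunE /= vsprojK.
  apply: val_inj; rewrite val_proj_incl proj_mapE val_proj_class.
    by rewrite limg_line Gx -line_repr.
  by apply: contra (proj_repr_neq0 p) => /eqP h; rewrite -Gx h linear0.
have [delta deltaE] := prob_push P (measurable_proj_map G).
have {}deltaE B := etrans (deltaE B) (PE _).
have pushE B : measurable B -> nu (B `&` proj_sub L) =
    (((\dim L)%:R / m%:R)%:E * pushforward delta (proj_map incl) B)%E.
  move=> mB; rewrite /pushforward deltaE.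
  have -> : proj_map G @^-1` (proj_map incl @^-1` B) `&` proj_sub L = B `&` proj_sub L.
    by apply/seteqP; split => p /= [h pL]; split => //; move: h; rewrite inclG.
  have fB : nu (B `&` proj_sub L) \is a fin_num.
    by apply: fin_num_measure; exact: measurableI.
  rewrite [(\dim L)%:R / _]mulrC muleC -muleA -EFinM mulVf ?mule1//.
  by rewrite mulf_neq0// invr_neq0.
exists delta => //; have [e [eb eo]] := orthonormal_basis F.
apply: (stable_of_strict eb eo) => K /andP[K0]; rewrite dim_sub => Kd.
have := pushE _ (mP (incl @: K)%VS).
rewrite /pushforward preim_proj_sub lpreim_incl.
have KL : (incl @: K <= L)%VS by rewrite -limg_incl limgS// subvf.
rewrite proj_subI (capv_idPl KL) => eqK.
have := strict _ KL; rewrite dim_incl K0 Kd eqK => /(_ isT).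
rewrite fineM//; last first.
  by apply: fin_num_measure; exact: measurable_proj_sub (vbasisP _) _.
rewrite /= [X in X < _]mulrAC [X in _ < X]mulrC ltr_pM2r ?invr_gt0 ?ltr0n ?edim_gt0//.
by move=> h; rewrite mulrC ltr_pdivlMr ?ltr0n// mulrC.
Qed.

End Inclusion.

Section Splitting.
Context (R : realType) (E : euclidean R).
Notation m := (\dim {:E}).
Notation kp := (m%:R^-1 : R).
Implicit Types (nu : proj_prob E) (W : {vspace E}).

Definition stable_splitting nu (r : nat) (L : 'I_r -> {vspace E})
    (hL : forall j, (0 < \dim (L j))%N)
    (delta : forall j, proj_prob (sub_euclidean (hL j))) :=
  [/\ (\sum_(j < r) L j)%VS = fullv,
      directv (\sum_(j < r) L j),
      nu (~` \bigcup_j proj_sub (L j)) = 0%E,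
      forall j, stable (delta j)
    & forall B, measurable B ->
        nu B = (\sum_(j < r) ((\dim (L j))%:R / m%:R)%:E *
          pushforward (delta j) (proj_map (incl (hL j))) B)%E].

Lemma measurable_bigcup_proj_sub r (L : 'I_r -> {vspace E}) :
  measurable (\bigcup_j proj_sub (L j)).
Proof.
by apply: fin_bigcup_measurable; [exact: finite_finset|
  move=> j _; exact: measurable_proj_sub (vbasisP _) _].
Qed.

Lemma splitting_of_mass nu :
  (forall L, fine (nu (proj_sub L)) <= kp * (\dim L)%:R /\
    (fine (nu (proj_sub L)) = kp * (\dim L)%:R ->
     exists L', supported_on_pair nu L L')) ->
  exists r L hL delta, @stable_splitting nu r L hL delta.
Proof.
move=> CR.
have mP L : measurable (proj_sub L) := measurable_proj_sub (vbasisP _) L.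
have full : proj_sub fullv = setT :> set (proj_borel E).
  by apply/seteqP; split => p // _; exact: subvf.
have [|s [sum dim neg comp]] := mass_decomposition CR (U := fullv).
  by rewrite full prob_dim.
pose r := size s; pose L (j : 'I_r) := nth 0%VS s j.
have Ls j : L j \in s by apply: mem_nth.
have hL j : (0 < \dim (L j))%N by case: (comp _ (Ls j)).
have ex j : exists delta : proj_prob (sub_euclidean (hL j)), stable delta /\
    forall B, measurable B -> nu (B `&` proj_sub (L j)) =
      (((\dim (L j))%:R / m%:R)%:E * pushforward delta (proj_map (incl (hL j))) B)%E.
  have [_ massL strict] := comp _ (Ls j).
  by have [delta] := component_exists (hL j) massL strict; exists delta.
pose delta j := sval (cid (ex j)).
have [deltaS deltaE] : (forall j, stable (delta j)) /\
    forall j B, measurable B -> nu (B `&` proj_sub (L j)) =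
      (((\dim (L j))%:R / m%:R)%:E * pushforward (delta j) (proj_map (incl (hL j))) B)%E.
  by split => j; case: (svalP (cid (ex j))).
have sumL : (\sum_(j < r) L j)%VS = fullv.
  by rewrite -sum (big_nth 0%VS) big_mkord.
have dxL : directv (\sum_(j < r) L j).
  rewrite directvE /= sumL -dim (big_nth 0%VS) big_mkord.
  by apply/eqP; apply: eq_bigr.
have negC : nu.-negligible (~` \bigcup_j proj_sub (L j)).
  apply: negligibleS neg => p pN; rewrite full; split => // -[K /(nthP 0%VS)[i ir <-] pK].
  by apply: pN; exists (Ordinal ir).
exists r, L, hL, delta; split => //.
  by apply: measure_negligible => //; apply: measurableC; exact: measurable_bigcup_proj_sub.
move=> B mB; under eq_bigr => j _ do rewrite -deltaE//.
(* Directness makes the P(L_j) disjoint, and the complement of their union is null. *)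
rewrite -(@measure_semi_additive_ord _ _ _ nu r (fun j => B `&` proj_sub (L j))); last 3 first.
- by move=> j; exact: measurableI.
- apply/trivIsetP => i j _ _ ij; rewrite setIACA setIid proj_subI.
  rewrite (_ : (L i :&: L j)%VS = 0%VS) ?proj_sub_dim0 ?dimv0 ?setI0//.
  move/directv_sumP: dxL => /(_ i isT) dx; apply/eqP; rewrite -subv0 -dx capvS//.
  by apply: (sumv_sup j) => //; rewrite eq_sym.
- by apply: bigsetU_measurable => j _; exact: measurableI.
have mU : measurable (\big[setU/set0]_(j < r) (B `&` proj_sub (L j))).
  by apply: bigsetU_measurable => j _; exact: measurableI.
rewrite -[LHS]fineK ?fin_num_measure// -[RHS]fineK ?fin_num_measure//.
congr EFin; apply: ae_eq_prob => //; apply: negligibleS negC => p /= h [j _ pL]; apply: h.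
rewrite -bigcup_seq; split => [Bp|[i _ [] //]].
by exists j => //=; exact: mem_index_enum.
Qed.

(** By stability P(W) has mass at most the sum of the dim (L_j :&: W) / m, hence at most dim W / m
    by directness. In case of equality each [L j] lies in [W] or meets it trivially, and those not
    in [W] span the complement. *)
Lemma mass_of_splitting nu r L hL delta : @stable_splitting nu r L hL delta ->
  forall W, fine (nu (proj_sub W)) <= kp * (\dim W)%:R /\
    (fine (nu (proj_sub W)) = kp * (\dim W)%:R ->
     exists W', supported_on_pair nu W W').
Proof.
move=> [sumL dxL nul st nuE] W.
have mP K : measurable (proj_sub K) := measurable_proj_sub (vbasisP {:E}) K.
have m0 : 0 < (m%:R : R) by rewrite ltr0n edim_gt0.
have d0 j : 0 < ((\dim (L j))%:R : R) by rewrite ltr0n.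
pose a j : R := fine (delta j (proj_map (incl (hL j)) @^-1` proj_sub W)).
have nuW : fine (nu (proj_sub W)) = kp * \sum_j (\dim (L j))%:R * a j.
  rewrite nuE//= (_ : (\sum_(j < r) _)%E = (\sum_(j < r) (\dim (L j))%:R / m%:R * a j)%:E).
    by rewrite mulr_sumr; apply: eq_bigr => j _; rewrite mulrAC mulrC.
  rewrite -sumEFin; apply: eq_bigr => j _; rewrite [RHS]EFinM; congr (_ * _)%E.
  rewrite fineK// fin_num_measure// preim_proj_sub.
  exact: measurable_proj_sub (vbasisP _) _.
pose b j : R := (\dim (L j :&: W))%:R.
have le j : (\dim (L j))%:R * a j <= b j.
  by have [+ _] := component_mass W (st j); rewrite mulrC ler_pdivlMr// mulrC.
have dxI : directv (\sum_j (L j :&: W)).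
  apply/directv_sum_independent => us usL; move/directv_sum_independent: dxL; apply.
  by move=> j _; have := usL j isT; rewrite memv_cap => /andP[].
have subW : (\sum_j (L j :&: W) <= W)%VS by apply/subv_sumP => j _; exact: capvSr.
have sumb : \sum_j b j = (\dim (\sum_j (L j :&: W)))%:R.
  by rewrite (directvP dxI) /= natr_sum.
have lesum : \sum_j (\dim (L j))%:R * a j <= \sum_j b j by apply: ler_sum.
have leW : \sum_j b j <= (\dim W)%:R by rewrite sumb ler_nat dimvS.
split; first by rewrite nuW ler_pM2l ?invr_gt0// (le_trans lesum).
rewrite nuW => /mulfI; rewrite invr_eq0 gt_eqF// => /(_ isT) eqW.
have eqb : \sum_j b j = (\dim W)%:R by apply/eqP; rewrite eq_le leW -eqW lesum.
have dich j : (L j :&: W = 0)%VS \/ (L j <= W)%VS.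
  apply: (component_mass W (st j)).2.
  have /eqP : \sum_j (b j - (\dim (L j))%:R * a j) = 0.
    by rewrite sumrB eqb eqW subrr.
  rewrite psumr_eq0 => [/allP /(_ j)|i _]; last by rewrite subr_ge0.
  rewrite mem_index_enum subr_eq0 => /(_ isT) /eqP bj.
  by rewrite -/(b j) bj mulrA mulVf ?mul1r// gt_eqF.
pose W' := (\sum_(j | ~~ (L j <= W)%VS) L j)%VS; exists W'.
have sumW : (W + W' = fullv)%VS.
  apply/eqP; rewrite eqEsubv subvf -sumL; apply/subv_sumP => j _.
  have [LW|LW] := boolP (L j <= W)%VS; first exact: subv_trans LW (addvSl _ _).
  by apply: subv_trans (addvSr _ _); exact: (sumv_sup j).
split => //.
  (* [W] has the total dimension of the [L j] inside it, so the dimensions of [W] and [W'] add up to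
     at most m and the intersection is 0. *)
  apply/eqP; rewrite -dimv_eq0 -leqn0 -(leq_add2l m) addn0 -{1}sumW dimv_sum_cap.
  have dimW : \dim W = (\sum_(j | (L j <= W)%VS) \dim (L j))%N.
    apply/eqP; rewrite -(eqr_nat R) -eqb natr_sum [X in _ == X]big_mkcond /=.
    apply/eqP/eq_bigr => j _; rewrite /b; case: ifP => [/capv_idPl -> //|LW].
    by have [->|] := dich j; [rewrite dimv0|rewrite LW].
  have -> : m = (\sum_j \dim (L j))%N by rewrite -sumL (directvP dxL).
  rewrite (bigID (fun j => (L j <= W)%VS)) /= -dimW leq_add2l.
  exact: (dimv_sum_leqif _).1.
apply: (subset_measure0 _ _ _ nul).
- by apply: measurableC; exact: measurableU.
- by apply: measurableC; exact: measurable_bigcup_proj_sub.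
move=> p /= h [j _ pL]; apply: h.
have [LW|LW] := boolP (L j <= W)%VS; [left|right].
  by apply: subv_trans LW; exact: pL.
by rewrite /proj_sub /=; apply: (sumv_sup j) => //; exact: pL.
Qed.

End Splitting.

Theorem proposition60 (R : realType) (n : nat) (hn : (1 <= n)%N)
    (nu : proj_prob (std_euclidean R n)) :
  [/\ stable nu <->
        forall L : {vspace std_euclidean R n}, (0 < \dim L < n.+1)%N ->
          (nu (proj_sub L) < ((\dim L)%:R / n.+1%:R)%:E)%E,
      semistable nu <->
        forall L : {vspace std_euclidean R n}, (0 < \dim L < n.+1)%N ->
          (nu (proj_sub L) <= ((\dim L)%:R / n.+1%:R)%:E)%E
    & polystable nu <->
        exists (r : nat) (L : 'I_r -> {vspace std_euclidean R n})
          (hL : forall j, (0 < \dim (L j))%N)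
          (delta : forall j, proj_prob (sub_euclidean (hL j))),
          [/\ (\sum_(j < r) L j)%VS = fullv,
              directv (\sum_(j < r) L j),
              nu (~` \bigcup_j proj_sub (L j)) = 0%E,
              forall j, stable (delta j)
            & forall B, measurable B ->
                nu B = (\sum_(j < r) ((\dim (L j))%:R / n.+1%:R)%:E *
                  pushforward (delta j)
                    (proj_map (E := sub_euclidean (hL j))
                       (linfun vsval)) B)%E]].
Proof.
have mE : \dim {:std_euclidean R n} = n.+1 by rewrite [LHS]dimvf; exact: etrans (dim_matrix _ _ _) (mul1n _).
have nuE L : nu (proj_sub L) = (fine (nu (proj_sub L)))%:E.
  by rewrite fineK// fin_num_measure//; exact: measurable_proj_sub (vbasisP _) _.
have cE (L : {vspace std_euclidean R n}) :
    (\dim L)%:R / n.+1%:R = (\dim {:std_euclidean R n})%:R^-1 * (\dim L)%:R :> R.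
  by rewrite mE mulrC.
split; split.
- by move=> /strict_of_stable st L; rewrite nuE cE lte_fin -{1}mE; exact: st.
- move=> lt; have [e [eb eo]] := orthonormal_basis (std_euclidean R n).
  apply: (stable_of_strict eb eo) => L; rewrite mE => /lt.
  by rewrite nuE cE lte_fin mE.
- by move=> /mass_of_semistable le L _; rewrite nuE cE lee_fin; exact: le.
- move=> le; apply/semistable_of_mass/mass_le_proper => L; rewrite mE => /le.
  by rewrite nuE cE lee_fin mE.
- move=> /polystable_mass /splitting_of_mass[r [L [hL [delta [sum dx nul st nuB]]]]].
  by exists r, L, hL, delta; split => // B mB; rewrite nuB// mE.
- move=> [r [L [hL [delta [sum dx nul st nuB]]]]].
  apply/polystable_of_mass/(@mass_of_splitting _ _ _ r L hL delta).
  by split => // B mB; rewrite nuB// mE.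
Qed.
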